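(* Let $f(z)=\sum_{n=1}^\infty a_n e(nz)$ be a nonzero cusp form of weight $r>0$ with respect to a congruence group $\Gamma$ for which the cusp at $i\infty$ has width $1$, and let $\alpha>r/2$. Then the function $f_\alpha(x)=\sum_{n=1}^\infty \frac{a_n}{n^\alpha}e(nx)$ is not multifractal. If the coefficients $a_n$ are real, then the functions $f_\alpha^c(x)=\sum_{n=1}^\infty \frac{a_n}{n^\alpha}\cos(2\pi nx)$ and $f_\alpha^s(x)=\sum_{n=1}^\infty \frac{a_n}{n^\alpha}\sin(2\pi nx)$ are not multifractal either.
   Context: Notation: $e(x)=e^{2\pi i x}$. For $\alpha>r/2$ the series are understood as the limits of their partial sums, which converge uniformly on $\mathbb{R}$, so the functions are continuous. Modular forms: $\Gamma$ is a congruence group, i.e. $\Gamma(N)<\Gamma<\mathrm{SL}_2(\mathbb{Z})$ for some principal congruence subgroup $\Gamma(N)$. A modular form of weight $r>0$ (real) with respect to $\Gamma$ is a function $f$, holomorphic on the upper half plane and at the cusps of $\Gamma$, with $f(\gamma z)=m_\gamma\,(j_\gamma(z))^r f(z)$ for all $\gamma\in\Gamma$, where $m_\gamma$ is a multiplier system with $|m_\gamma|=1$ and $j_\gamma(z)$ is the denominator of the linear fractional transformation $\gamma$ (i.e. $j_\gamma(z)=cz+d$ if $(c,d)$ is the bottom row of $\gamma$). It is assumed that the width of the cusp at $i\infty$ is $1$, so that the integral translations belong to $\Gamma$ and $f(z)=\sum_{n\ge0}a_n e(nz)$. A cusp form is a modular form vanishing at all cusps. Pointwise Hölder exponent: for $s\ge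 0$, $C^s(x_0)$ is the set of continuous functions $g:\mathbb{R}\to\mathbb{C}$ for which there is a polynomial $P$ of degree at most $s$ with $|g(x)-P(x-x_0)|=O(|x-x_0|^s)$ as $x\to x_0$; the pointwise Hölder exponent of $g$ at $x_0$ is $\beta(x_0)=\sup\{s\ge0: g\in C^s(x_0)\}$. Spectrum of singularities: for a continuous complex valued function $g$, $d_g(\delta)=\dim_{\mathcal{H}}\{x\in[0,1]:\beta(x)=\delta\}$ if $\{x\in[0,1]:\beta(x)=\delta\}\ne\emptyset$, and $d_g(\delta)=-\infty$ otherwise, where $\dim_{\mathcal{H}}$ is the Hausdorff dimension and $\beta(x)$ is the pointwise Hölder exponent of $g$. The function $g$ is called multifractal if the image of $d_g$ is not discrete. *)

(* Defs.v *)
From Stdlib Require Import Reals ZArith ClassicalEpsilon.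
From Coquelicot Require Import Coquelicot.

Open Scope R_scope.

(** * Complex exponential and real powers *)

Definition Cexp (z : C) : C :=
  (exp (Re z) * cos (Im z), exp (Re z) * sin (Im z)).

Definition e (z : C) : C := Cexp (RtoC (2 * PI) * Ci * z)%C.

(** Principal argument, in (-PI, PI], of a nonzero complex number. *)
Definition Carg (z : C) : R :=
  if Rle_dec 0 (Im z) then acos (Re z / Cmod z) else - acos (Re z / Cmod z).

(** Principal branch of [z ^ r], for [z <> 0] and [r] real. *)
Definition Crpow (z : C) (r : R) : C :=
  (Rpower (Cmod z) r * cos (r * Carg z), Rpower (Cmod z) r * sin (r * Carg z)).

Definition upper_half_plane (z : C) : Prop := 0 < Im z.

(** * Integer matrices and congruence groups *)

Record M2Z : Set := mkM2Z { m11 : Z; m12 : Z; m21 : Z; m22 : Z }.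

Definition M2Z_one : M2Z := mkM2Z 1 0 0 1.

Definition M2Z_opp (g : M2Z) : M2Z :=
  mkM2Z (- m11 g) (- m12 g) (- m21 g) (- m22 g).

Definition M2Z_mul (g h : M2Z) : M2Z :=
  mkM2Z (m11 g * m11 h + m12 g * m21 h) (m11 g * m12 h + m12 g * m22 h)
        (m21 g * m11 h + m22 g * m21 h) (m21 g * m12 h + m22 g * m22 h).

(** The adjugate, which is the inverse in SL2(Z). *)
Definition M2Z_inv (g : M2Z) : M2Z :=
  mkM2Z (m22 g) (- m12 g) (- m21 g) (m11 g).

Definition SL2Z (g : M2Z) : Prop := (m11 g * m22 g - m12 g * m21 g = 1)%Z.

Definition translation (h : Z) : M2Z := mkM2Z 1 h 0 1.

Definition principal_congruence (N : Z) (g : M2Z) : Prop :=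
  SL2Z g /\
  (N | m11 g - 1)%Z /\ (N | m12 g)%Z /\ (N | m21 g)%Z /\ (N | m22 g - 1)%Z.

Definition subgroup_SL2Z (G : M2Z -> Prop) : Prop :=
  (forall g, G g -> SL2Z g) /\
  G M2Z_one /\
  (forall g h, G g -> G h -> G (M2Z_mul g h)) /\
  (forall g, G g -> G (M2Z_inv g)).

Definition congruence_group (G : M2Z -> Prop) : Prop :=
  subgroup_SL2Z G /\
  exists N : Z, (0 < N)%Z /\ forall g, principal_congruence N g -> G g.

(** The width is measured in [G] itself, not in [G] modulo -1: width 1 means
    that the integral translations belong to [G]. *)
Definition width_at_infinity (G : M2Z -> Prop) (h : Z) : Prop :=
  (0 < h)%Z /\ G (translation h) /\
  forall k : Z, (0 < k)%Z -> G (translation k) -> (h <= k)%Z.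

(** * Modular forms *)

Definition moebius (g : M2Z) (z : C) : C :=
  ((RtoC (IZR (m11 g)) * z + RtoC (IZR (m12 g))) /
   (RtoC (IZR (m21 g)) * z + RtoC (IZR (m22 g))))%C.

Definition j (g : M2Z) (z : C) : C :=
  (RtoC (IZR (m21 g)) * z + RtoC (IZR (m22 g)))%C.

Definition multiplier_system (G : M2Z -> Prop) (r : R) (m : M2Z -> C) : Prop :=
  (forall g, G g -> Cmod (m g) = 1) /\
  (forall g h z, G g -> G h -> upper_half_plane z ->
     (m (M2Z_mul g h) * Crpow (j (M2Z_mul g h) z) r =
      m g * m h * Crpow (j g (moebius h z)) r * Crpow (j h z) r)%C) /\
  (G (M2Z_opp M2Z_one) ->
     (m (M2Z_opp M2Z_one) * Crpow (RtoC (-1)) r = RtoC 1)%C).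

Definition holomorphic_on_H (f : C -> C) : Prop :=
  forall z, upper_half_plane z -> @ex_derive C_AbsRing C_NormedModule f z.

Definition slash (r : R) (f : C -> C) (s : M2Z) (z : C) : C :=
  (Crpow (j s z) (- r) * f (moebius s z))%C.

(** [f] is holomorphic at the cusp [s oo]: [slash r f s] has a Fourier expansion
    with nonnegative exponents.  Here [h] is a period of the cusp, and the shift
    [kappa] comes from the value of the multiplier system at the generator
    [s T^h s^-1], so that the exponents are the [(n + kappa) / h]. *)
Definition holomorphic_at_cusp
    (G : M2Z -> Prop) (r : R) (f : C -> C) (s : M2Z) : Prop :=
  exists (h : Z) (kappa : R) (c : nat -> C),
    (0 < h)%Z /\
    G (M2Z_mul s (M2Z_mul (translation h) (M2Z_inv s))) /\
    0 <= kappa < 1 /\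
    forall z, upper_half_plane z ->
      @is_series C_AbsRing C_NormedModule
        (fun n => c n * e (RtoC ((INR n + kappa) / IZR h) * z))%C
        (slash r f s z).

Definition vanishes_at_cusp (r : R) (f : C -> C) (s : M2Z) : Prop :=
  forall eps : posreal, exists Y : R, forall z, upper_half_plane z ->
    Y < Im z -> Cmod (slash r f s z) < eps.

(** Every cusp is [s oo] for some [s] in SL2(Z). *)
Definition modular_form (G : M2Z -> Prop) (r : R) (f : C -> C) : Prop :=
  holomorphic_on_H f /\
  (exists m : M2Z -> C, multiplier_system G r m /\
     forall g z, G g -> upper_half_plane z ->
       f (moebius g z) = (m g * Crpow (j g z) r * f z)%C) /\
  forall s, SL2Z s -> holomorphic_at_cusp G r f s.

Definition cusp_form (G : M2Z -> Prop) (r : R) (f : C -> C) : Prop :=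
  modular_form G r f /\ forall s, SL2Z s -> vanishes_at_cusp r f s.

(** * The Fourier series *)

(** Limit of the partial sums of a complex series. *)
Definition CSeries (u : nat -> C) : C :=
  (Series (fun n => Re (u n)), Series (fun n => Im (u n))).

(** The sums start at [n = 1], whence the shift; [a 0] plays no role. *)
Definition f_exp (a : nat -> C) (alpha : R) (x : R) : C :=
  CSeries (fun n => a (S n) / RtoC (Rpower (INR (S n)) alpha) *
                    e (RtoC (INR (S n) * x)))%C.

Definition f_cos (a : nat -> C) (alpha : R) (x : R) : C :=
  CSeries (fun n => a (S n) / RtoC (Rpower (INR (S n)) alpha) *
                    RtoC (cos (2 * PI * INR (S n) * x)))%C.

Definition f_sin (a : nat -> C) (alpha : R) (x : R) : C :=
  CSeries (fun n => a (S n) / RtoC (Rpower (INR (S n)) alpha) *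
                    RtoC (sin (2 * PI * INR (S n) * x)))%C.

(** * Pointwise Hölder exponent *)

(** The neighbourhood of [x0] is punctured, as [Rpower 0 s] is a junk value. *)
Definition Cs (s x0 : R) (g : R -> C) : Prop :=
  (forall x, @continuous R_UniformSpace C_UniformSpace g x) /\
  exists (d : nat) (p : nat -> C) (K : R),
    INR d <= s /\
    locally' x0 (fun x =>
      Cmod (g x - @sum_n C_AbelianMonoid
                    (fun k => p k * RtoC ((x - x0) ^ k))%C d)%C
      <= K * Rpower (Rabs (x - x0)) s).

Definition holder_exponent (g : R -> C) (x0 : R) : Rbar :=
  Lub_Rbar (fun s => 0 <= s /\ Cs s x0 g).

(** * Hausdorff dimension of subsets of the line *)

(** The disjunct [d = 0] only matters for the empty set. *)
Definition diam (U : R -> Prop) : Rbar :=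
  Lub_Rbar (fun d => d = 0 \/ exists x y, U x /\ U y /\ d = Rabs (x - y)).

(** [t ^ s] for [t >= 0] and [s > 0], with [0 ^ s = 0] (whereas
    [Rpower 0 s = 1]). *)
Definition pospow (t s : R) : R := if Rle_dec t 0 then 0 else Rpower t s.

Definition hausdorff_premeasure (s delta : R) (A : R -> Prop) : Rbar :=
  Rbar_glb (fun v => exists U : nat -> R -> Prop,
    (forall x, A x -> exists n, U n x) /\
    (forall n, Rbar_le (diam (U n)) delta) /\
    v = Lim_seq (sum_n (fun n => pospow (real (diam (U n))) s))).

Definition hausdorff_measure (s : R) (A : R -> Prop) : Rbar :=
  Rbar_lub (fun v => exists delta, 0 < delta /\
                                   v = hausdorff_premeasure s delta A).

(** Discarding [s = 0] does not change the infimum. *)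
Definition hausdorff_dim (A : R -> Prop) : Rbar :=
  Glb_Rbar (fun s => 0 < s /\ hausdorff_measure s A = Finite 0).

(** * Spectrum of singularities *)

Definition level_set (g : R -> C) (delta : Rbar) (x : R) : Prop :=
  0 <= x <= 1 /\ holder_exponent g x = delta.

Definition spectrum (g : R -> C) (delta : Rbar) : Rbar :=
  if excluded_middle_informative (exists x, level_set g delta x)
  then hausdorff_dim (level_set g delta)
  else m_infty.

(** Neighbourhoods in the order topology of the extended line (Coquelicot's
    [Rbar_locally] is a filter on [R]). *)
Definition Rbar_nbhd (l : Rbar) (V : Rbar -> Prop) : Prop :=
  match l with
  | Finite x => exists eps : posreal, forall y : Rbar,
      Rbar_lt (x - eps) y -> Rbar_lt y (x + eps) -> V y
  | p_infty => exists M : R, forall y : Rbar, Rbar_lt M y -> V y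
  | m_infty => exists M : R, forall y : Rbar, Rbar_lt y M -> V y
  end.

Definition discrete (S : Rbar -> Prop) : Prop :=
  forall l, S l -> Rbar_nbhd l (fun y => S y -> y = l).

Definition multifractal (g : R -> C) : Prop :=
  ~ discrete (fun d => exists delta : Rbar, spectrum g delta = d).

(* Main.v *)
Require Import Defs.
From Stdlib Require Import Reals ZArith Lra Lia Classical ClassicalEpsilon.
From Stdlib Require Cantor.
From Coquelicot Require Import Coquelicot.

(** The pointwise Hölder exponent of each of the three series is [alpha - r / 2] at
    every irrational point.  Hence all level sets but one consist of rational
    points, are countable and have dimension 0, so that the spectrum takes at most
    three values (minus infinity, 0 and the dimension of the remaining level set),
    and a finite set is discrete ([not_multifractal]).

    The exponent is governed by the size of [f] near the real line.  The function
    [y ^ (r / 2) * |f|] is invariant under the group, and only finitely many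
    translates of it by [SL2Z] are distinct, since the group contains a principal
    congruence group.  The expansions at the cusps therefore provide uniform
    constants.  As [SL2Z] moves every point above height 1/2, one obtains
    [|f(x + i y)| <= M y ^ (- r / 2)] everywhere ([cusp_form_bound]).  Conversely,
    on a sufficiently high horizontal line no translate vanishes, and the images
    of this line yield, for every irrational [x0], points of a fixed cone tending
    to [x0] at which [|f|] is of order [y ^ (- r / 2)] ([cusp_form_large]).

    Regularity: pairing [f] at height [1 / N] with the Dirichlet kernel bounds the
    partial sums of [sum a_n e(n x)] by [N ^ rho] for every [rho > r / 2]
    ([cusp_form_partial_sums]).  Summation by parts then gives uniform convergence
    of the series with coefficients [a_n / n ^ alpha] and its membership in
    [C ^ s (x0)] for every [s < alpha - r / 2] and every [x0]
    ([frac_series_regular]).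

    Irregularity: [f] is recovered from its fractional integral by integration
    against the kernel [sum n ^ alpha e(n z)], of size [|1 - e(z)| ^ (- alpha - 1)]
    ([power_kernel_bound]).  If the fractional integral were in [C ^ s (x0)], then
    [f] would be [O(y ^ (s - alpha))] in the cones over [x0]
    ([regularity_bounds_form]), which contradicts the lower bound above unless
    [s <= alpha - r / 2].  Only the Fourier coefficients with positive index enter,
    and up to a constant factor these are the same for the real and the imaginary
    part of the series; this settles the cosine and the sine series. *)

Open Scope R_scope.

(** * Finite sums *)

Fixpoint csum (u : nat -> C) (n : nat) : C :=
  match n with
  | O => RtoC 0
  | S n => Cplus (csum u n) (u n)
  end.

Fixpoint rsum (u : nat -> R) (n : nat) : R :=
  match n with
  | O => 0
  | S n => rsum u n + u n
  end.

Lemma csum_S u n : csum u (S n) = (csum u n + u n)%C.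
Proof. reflexivity. Qed.

Lemma csum_ext u v n : (forall i, (i < n)%nat -> u i = v i) -> csum u n = csum v n.
Proof.
  induction n as [|n IH]; intros H; simpl; [reflexivity|].
  rewrite IH, H; auto with arith.
Qed.

Lemma rsum_ext u v n : (forall i, (i < n)%nat -> u i = v i) -> rsum u n = rsum v n.
Proof.
  induction n as [|n IH]; intros H; simpl; [reflexivity|].
  rewrite IH, H; auto with arith.
Qed.

Lemma csum_mult_l c u n : csum (fun i => c * u i)%C n = (c * csum u n)%C.
Proof. induction n as [|n IH]; simpl; [ring|rewrite IH; ring]. Qed.

Lemma rsum_mult_l c u n : rsum (fun i => c * u i) n = c * rsum u n.
Proof. induction n as [|n IH]; simpl; [ring|rewrite IH; ring]. Qed.

Lemma rsum_le u v n : (forall i, (i < n)%nat -> u i <= v i) -> rsum u n <= rsum v n.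
Proof.
  induction n as [|n IH]; intros H; simpl; [lra|].
  apply Rplus_le_compat; auto with arith.
Qed.

Lemma rsum_pos u n : (forall i, (i < n)%nat -> 0 <= u i) -> 0 <= rsum u n.
Proof.
  induction n as [|n IH]; intros H; simpl; [lra|].
  apply Rplus_le_le_0_compat; auto with arith.
Qed.

Lemma rsum_const x n : rsum (fun _ => x) n = INR n * x.
Proof. induction n as [|n IH]; [simpl; ring|]. rewrite S_INR. simpl rsum. rewrite IH. ring. Qed.

Lemma Cmod_csum u n : Cmod (csum u n) <= rsum (fun i => Cmod (u i)) n.
Proof.
  induction n as [|n IH]; simpl; [rewrite Cmod_0; lra|].
  eapply Rle_trans; [apply Cmod_triangle|lra].
Qed.

Lemma csum_split u m n :
  csum u (m + n) = (csum u m + csum (fun i => u (m + i)%nat) n)%C.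
Proof.
  induction n as [|n IH]; simpl.
  - rewrite Nat.add_0_r; ring.
  - rewrite Nat.add_succ_r; simpl. rewrite IH; ring.
Qed.

Lemma rsum_telescope u n : rsum (fun i => u (S i) - u i) n = u n - u O.
Proof. induction n as [|n IH]; simpl; [ring|rewrite IH; ring]. Qed.

Lemma csum_sum_n u n :
  @sum_n C_AbelianMonoid u n = csum u (S n).
Proof.
  induction n as [|n IH].
  - rewrite sum_O. symmetry. apply Cplus_0_l.
  - rewrite sum_Sn, IH. reflexivity.
Qed.

Lemma rsum_sum_n u n : sum_n u n = rsum u (S n).
Proof.
  induction n as [|n IH].
  - rewrite sum_O. symmetry. apply Rplus_0_l.
  - rewrite sum_Sn, IH. reflexivity.
Qed.

Lemma Re_csum u n : Re (csum u n) = rsum (fun i => Re (u i)) n.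
Proof. induction n as [|n IH]; simpl; [reflexivity|rewrite <- IH; reflexivity]. Qed.

Lemma Im_csum u n : Im (csum u n) = rsum (fun i => Im (u i)) n.
Proof. induction n as [|n IH]; simpl; [reflexivity|rewrite <- IH; reflexivity]. Qed.

Lemma csum_geometric w n :
  ((1 - w) * csum (fun i => w ^ i) n = 1 - w ^ n)%C.
Proof.
  induction n as [|n IH]; simpl csum; [simpl; ring|].
  rewrite Cmult_plus_distr_l, IH, Cpow_S. ring.
Qed.

Lemma rsum_geometric_le q n : 0 <= q < 1 -> rsum (fun i => q ^ i) n <= / (1 - q).
Proof.
  intros Hq.
  assert (H : (1 - q) * rsum (fun i => q ^ i) n = 1 - q ^ n).
  { induction n as [|n IH]; simpl; [ring|]. rewrite Rmult_plus_distr_l, IH; ring. }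
  apply (Rmult_le_reg_l (1 - q)); [lra|]. rewrite H, Rinv_r by lra.
  assert (0 <= q ^ n) by (apply pow_le; lra). lra.
Qed.

Lemma abel_summation (tau : nat -> C) (w : nat -> R) n :
  csum (fun i => tau i * RtoC (w i))%C (S n) =
  (csum tau (S n) * RtoC (w n)
   - csum (fun i => csum tau (S i) * RtoC (w (S i) - w i)) n)%C.
Proof.
  induction n as [|n IH].
  - simpl. ring.
  - change (csum (fun i => tau i * RtoC (w i))%C (S (S n)))
      with (csum (fun i => tau i * RtoC (w i))%C (S n) + tau (S n) * RtoC (w (S n)))%C.
    rewrite IH.
    change (csum (fun i => csum tau (S i) * RtoC (w (S i) - w i))%C (S n))
      with (csum (fun i => csum tau (S i) * RtoC (w (S i) - w i)) n
            + csum tau (S n) * RtoC (w (S n) - w n))%C.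
    change (csum tau (S (S n))) with (csum tau (S n) + tau (S n))%C.
    rewrite RtoC_minus. ring.
Qed.

(** Summation by parts: a weight of bounded variation is removed by bounding the
    partial sums of what remains. *)
Lemma abel_bound (tau : nat -> C) (w B : nat -> R) n :
  (forall k, (k <= n)%nat -> Cmod (csum tau (S k)) <= B k) ->
  Cmod (csum (fun i => tau i * RtoC (w i))%C (S n)) <=
  B n * Rabs (w n) + rsum (fun i => B i * Rabs (w (S i) - w i)) n.
Proof.
  intros HB. rewrite abel_summation.
  unfold Cminus. eapply Rle_trans; [apply Cmod_triangle|].
  rewrite Cmod_opp, Cmod_mult, Cmod_R.
  apply Rplus_le_compat.
  - apply Rmult_le_compat_r; [apply Rabs_pos|auto].
  - eapply Rle_trans; [apply Cmod_csum|]. apply rsum_le. intros i Hi.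
    rewrite Cmod_mult, Cmod_R. apply Rmult_le_compat_r; [apply Rabs_pos|auto with arith].
Qed.

(** * The exponential *)

Lemma C_ext (z w : C) : Re z = Re w -> Im z = Im w -> z = w.
Proof. destruct z, w; simpl; intros -> ->; reflexivity. Qed.

Lemma Re_plus z w : Re (z + w)%C = Re z + Re w. Proof. reflexivity. Qed.
Lemma Im_plus z w : Im (z + w)%C = Im z + Im w. Proof. reflexivity. Qed.
Lemma Re_minus z w : Re (z - w)%C = Re z - Re w. Proof. reflexivity. Qed.
Lemma Im_minus z w : Im (z - w)%C = Im z - Im w. Proof. reflexivity. Qed.

Lemma im_le_Cmod z : Rabs (Im z) <= Cmod z.
Proof. eapply Rle_trans; [apply Rmax_r|apply Rmax_Cmod]. Qed.

Lemma Cmod_le_Re_Im z : Cmod z <= Rabs (Re z) + Rabs (Im z).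
Proof.
  replace z with (RtoC (Re z) + RtoC (Im z) * Ci)%C at 1
    by (apply C_ext; simpl; ring).
  eapply Rle_trans; [apply Cmod_triangle|].
  rewrite Cmod_mult, Cmod_Ci, !Cmod_R. lra.
Qed.

Lemma Cmod_minus_sym z w : Cmod (z - w) = Cmod (w - z).
Proof. rewrite <- Cmod_opp. f_equal. ring. Qed.

Lemma Cmod_triangle_inv z w : Cmod z - Cmod w <= Cmod (z + w).
Proof.
  assert (H := Cmod_triangle (z + w) (- w)). rewrite Cmod_opp in H.
  replace (z + w + - w)%C with z in H by ring. lra.
Qed.

Lemma e_polar z :
  e z = (exp (- (2 * PI * Im z)) * cos (2 * PI * Re z),
         exp (- (2 * PI * Im z)) * sin (2 * PI * Re z)).
Proof.
  unfold e, Cexp.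
  assert (H1 : Re (RtoC (2 * PI) * Ci * z)%C = - (2 * PI * Im z)).
  { destruct z; simpl; ring. }
  assert (H2 : Im (RtoC (2 * PI) * Ci * z)%C = 2 * PI * Re z).
  { destruct z; simpl; ring. }
  now rewrite H1, H2.
Qed.

Lemma e_plus z w : e (z + w) = (e z * e w)%C.
Proof.
  rewrite !e_polar, Re_plus, Im_plus.
  replace (- (2 * PI * (Im z + Im w))) with (- (2 * PI * Im z) + - (2 * PI * Im w)) by ring.
  rewrite !Rmult_plus_distr_l, exp_plus, cos_plus, sin_plus.
  apply C_ext; simpl; ring.
Qed.

Lemma e_0 : e (RtoC 0) = RtoC 1.
Proof.
  rewrite e_polar. simpl. rewrite !Rmult_0_r, Ropp_0, exp_0, cos_0, sin_0.
  apply C_ext; simpl; ring.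
Qed.

Lemma Cmod_polar E t : 0 < E -> Cmod (E * cos t, E * sin t) = E.
Proof.
  intros HE. unfold Cmod. simpl fst; simpl snd.
  replace ((E * cos t) ^ 2 + (E * sin t) ^ 2) with (E ^ 2); [rewrite sqrt_pow2; lra|].
  assert (H := sin2_cos2 t). unfold Rsqr in H.
  replace ((E * cos t) ^ 2 + (E * sin t) ^ 2)
    with (E ^ 2 * (sin t * sin t + cos t * cos t)) by ring.
  rewrite H; ring.
Qed.

Lemma Cmod_e z : Cmod (e z) = exp (- (2 * PI * Im z)).
Proof. rewrite e_polar. apply Cmod_polar, exp_pos. Qed.

Lemma Cmod_e_R x : Cmod (e (RtoC x)) = 1.
Proof. rewrite Cmod_e. simpl. rewrite Rmult_0_r, Ropp_0. apply exp_0. Qed.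

Lemma e_INR n z : e (RtoC (INR n) * z)%C = (e z ^ n)%C.
Proof.
  induction n as [|n IH].
  - simpl. rewrite Cmult_0_l. apply e_0.
  - rewrite S_INR, RtoC_plus, Cpow_S, <- IH, <- e_plus. f_equal. ring.
Qed.

Lemma e_R x : e (RtoC x) = (cos (2 * PI * x), sin (2 * PI * x)).
Proof.
  rewrite e_polar. simpl. rewrite Rmult_0_r, Ropp_0, exp_0, !Rmult_1_l. reflexivity.
Qed.

Lemma e_conj x : e (RtoC (- x)) = Cconj (e (RtoC x)).
Proof.
  rewrite !e_R. unfold Cconj. simpl.
  rewrite <- Ropp_mult_distr_r, cos_neg, sin_neg. reflexivity.
Qed.

(** * Real powers *)

Lemma Rpower_pos x a : 0 < Rpower x a.
Proof. apply exp_pos. Qed.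

Lemma exp_le x y : x <= y -> exp x <= exp y.
Proof. intros [H|H]; [left; now apply exp_increasing|rewrite H; lra]. Qed.

Lemma Rpower_minus x a b : Rpower x (a - b) = Rpower x a / Rpower x b.
Proof. unfold Rminus. rewrite Rpower_plus, Rpower_Ropp. reflexivity. Qed.

Lemma Rpower_succ x a : 0 < x -> Rpower x (a + 1) = Rpower x a * x.
Proof. intros Hx. rewrite Rpower_plus, Rpower_1; auto. Qed.

Lemma Rpower_inv_l x a : 0 < x -> Rpower (/ x) a = Rpower x (- a).
Proof.
  intros Hx. unfold Rpower. rewrite ln_Rinv by auto. f_equal. ring.
Qed.

Lemma Rpower_antitone x y a : 0 < x <= y -> a <= 0 -> Rpower y a <= Rpower x a.
Proof.
  intros [Hx Hxy] Ha. unfold Rpower. apply exp_le.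
  assert (ln x <= ln y) by (apply ln_le; auto). nra.
Qed.

Lemma Rpower_exponent_antitone x a b : 0 < x <= 1 -> a <= b -> Rpower x b <= Rpower x a.
Proof.
  intros [Hx Hx1] Hab. unfold Rpower. apply exp_le.
  assert (H : ln x <= ln 1) by (now apply ln_le). rewrite ln_1 in H. nra.
Qed.

Lemma Rpower_comparable D x y a :
  1 <= D -> 0 < x -> 0 < y -> y <= D * x -> x <= D * y ->
  Rpower y a <= Rpower D (Rabs a) * Rpower x a.
Proof.
  intros HD Hx Hy H1 H2. unfold Rpower. rewrite <- exp_plus. apply exp_le.
  assert (Hl1 : ln y <= ln D + ln x) by (rewrite <- ln_mult by lra; apply ln_le; auto).
  assert (Hl2 : ln x <= ln D + ln y) by (rewrite <- ln_mult by lra; apply ln_le; auto).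
  destruct (Rle_dec 0 a).
  - rewrite Rabs_right by lra. nra.
  - rewrite Rabs_left by lra. nra.
Qed.

Lemma is_derive_Rpower a t : 0 < t ->
  is_derive (fun x => Rpower x a) t (a * Rpower t (a - 1)).
Proof. intros Ht. apply is_derive_Reals. now apply derivable_pt_lim_power. Qed.

Lemma continuous_Rpower a t : 0 < t -> continuous (fun x => Rpower x a) t.
Proof.
  intros Ht. apply (ex_derive_continuous (fun x => Rpower x a)).
  eexists. now apply is_derive_Rpower.
Qed.

Lemma MVT_derive (f df : R -> R) (a b : R) : a <= b ->
  (forall x, a <= x <= b -> is_derive f x (df x)) ->
  exists c, a <= c <= b /\ f b - f a = df c * (b - a).
Proof.
  intros Hab Hd.
  destruct (MVT_gen f a b df) as [c Hc].
  - intros x Hx. rewrite Rmin_left, Rmax_right in Hx by lra. apply Hd. lra.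
  - intros x Hx. rewrite Rmin_left, Rmax_right in Hx by lra.
    apply derivable_continuous_pt. exists (df x). apply is_derive_Reals, Hd, Hx.
  - rewrite Rmin_left, Rmax_right in Hc by lra. exists c. exact Hc.
Qed.

Fixpoint forward_diff (k : nat) (q : R -> R) (t : R) : R :=
  match k with
  | O => q t
  | S k => forward_diff k q (t + 1) - forward_diff k q t
  end.

Lemma is_derive_forward_diff k a t : 0 < t ->
  is_derive (forward_diff k (fun x => Rpower x a)) t
            (a * forward_diff k (fun x => Rpower x (a - 1)) t).
Proof.
  revert t. induction k as [|k IH]; intros t Ht; simpl.
  - now apply is_derive_Rpower.
  - rewrite Rmult_minus_distr_l.
    apply (is_derive_minus (fun t => forward_diff k (fun x => Rpower x a) (t + 1)) (forward_diff k (fun x => Rpower x a))); [|now apply IH].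
    evar_last.
    + apply (is_derive_comp (forward_diff k (fun x => Rpower x a)) (fun t => t + 1)).
      * apply IH. lra.
      * auto_derive; [exact I|reflexivity].
    + unfold scal. simpl. unfold mult. simpl. ring.
Qed.

Lemma Rpower_near t x a : 1 <= t -> t <= x <= t + 1 ->
  Rpower x a <= Rpower 2 (Rabs a) * Rpower t a /\
  Rpower t a <= Rpower 2 (Rabs a) * Rpower x a.
Proof. intros; split; apply Rpower_comparable; lra. Qed.

(** By the mean value theorem a difference of [t ^ a] is a value of
    [a * t ^ (a - 1)], so each one lowers the exponent by 1. *)
Lemma forward_diff_power_bound k : forall a, exists K, 0 <= K /\
  forall t, 1 <= t ->
    Rabs (forward_diff k (fun x => Rpower x a) t) <= K * Rpower t (a - INR k).
Proof.
  induction k as [|k IH]; intros a.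
  - exists 1. split; [lra|]. intros t Ht. simpl. rewrite Rminus_0_r, Rmult_1_l.
    rewrite Rabs_right; [lra|]. left. apply Rpower_pos.
  - destruct (IH (a - 1)) as [K [HK0 HK]].
    set (E := a - INR (S k)).
    exists (Rabs a * K * Rpower 2 (Rabs E)). split.
    { repeat apply Rmult_le_pos; auto using Rabs_pos. left; apply Rpower_pos. }
    intros t Ht. simpl.
    destruct (MVT_derive (forward_diff k (fun x => Rpower x a))
       (fun t => a * forward_diff k (fun x => Rpower x (a - 1)) t) t (t + 1)) as [c [Hc ->]].
    { lra. } { intros x Hx. apply is_derive_forward_diff. lra. }
    replace (t + 1 - t) with 1 by ring. rewrite Rmult_1_r, Rabs_mult.
    rewrite !Rmult_assoc. apply Rmult_le_compat_l; [apply Rabs_pos|].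
    eapply Rle_trans; [apply HK; lra|].
    replace (a - 1 - INR k) with E by (unfold E; rewrite S_INR; ring).
    apply Rmult_le_compat_l; [auto|]. apply (proj1 (Rpower_near t c E ltac:(lra) Hc)).
Qed.

Lemma power_increment_bound a : exists K, 0 <= K /\ forall t, 1 <= t ->
  Rabs (Rpower (t + 1) a - Rpower t a) <= K * Rpower t (a - 1).
Proof. destruct (forward_diff_power_bound 1 a) as [K [H0 H]]. exists K. split; [auto|]. apply H. Qed.

(** Comparing [t ^ (g - 1)] with an increment of [t ^ g / g] makes power sums
    telescope. *)
Lemma power_le_increment g t : g <> 0 -> 1 <= t ->
  Rpower t (g - 1) <=
  Rpower 2 (Rabs (g - 1)) * ((Rpower (t + 1) g - Rpower t g) / g).
Proof.
  intros Hg Ht.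
  destruct (MVT_derive (fun x => Rpower x g)
    (fun t => g * Rpower t (g - 1)) t (t + 1)) as [c [Hc ->]].
  { lra. } { intros x Hx. apply is_derive_Rpower. lra. }
  replace (g * Rpower c (g - 1) * (t + 1 - t) / g) with (Rpower c (g - 1)) by (field; auto).
  apply (proj2 (Rpower_near t c (g - 1) Ht Hc)).
Qed.

Lemma power_sum_telescope g m n : g <> 0 -> (1 <= m)%nat ->
  rsum (fun i => Rpower (INR (m + i)) (g - 1)) n <=
  Rpower 2 (Rabs (g - 1)) * ((Rpower (INR (m + n)) g - Rpower (INR m) g) / g).
Proof.
  intros Hg Hm. set (D := Rpower 2 _).
  eapply Rle_trans.
  - apply rsum_le. intros i _. apply power_le_increment; [auto|].
    apply (le_INR 1). lia.
  - fold D. rewrite rsum_mult_l.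
    apply Rmult_le_compat_l; [left; apply Rpower_pos|]. right.
    induction n as [|n IH]; simpl rsum.
    + rewrite Nat.add_0_r. field. auto.
    + rewrite IH, Nat.add_succ_r, S_INR. field. auto.
Qed.

Lemma power_sum_neg g : g < 0 -> exists K, 0 <= K /\ forall m n, (1 <= m)%nat ->
  rsum (fun i => Rpower (INR (m + i)) (g - 1)) n <= K * Rpower (INR m) g.
Proof.
  intros Hg. set (D := Rpower 2 (Rabs (g - 1))).
  assert (HD : 0 < D) by apply Rpower_pos.
  assert (Hi : 0 < / - g) by (apply Rinv_0_lt_compat; lra).
  exists (D * / - g). split; [nra|]. intros m n Hm.
  eapply Rle_trans; [apply power_sum_telescope; [lra|auto]|].
  fold D. rewrite Rmult_assoc. apply Rmult_le_compat_l; [lra|].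
  replace ((Rpower (INR (m + n)) g - Rpower (INR m) g) / g)
    with (/ - g * (Rpower (INR m) g - Rpower (INR (m + n)) g)) by (field; lra).
  apply Rmult_le_compat_l; [lra|].
  assert (H := Rpower_pos (INR (m + n)) g). lra.
Qed.

Lemma power_sum_pos g : 0 < g -> exists K, 0 <= K /\ forall m n, (1 <= m)%nat ->
  rsum (fun i => Rpower (INR (m + i)) (g - 1)) n <= K * Rpower (INR (m + n)) g.
Proof.
  intros Hg. set (D := Rpower 2 (Rabs (g - 1))).
  assert (HD : 0 < D) by apply Rpower_pos.
  assert (Hi : 0 < / g) by (apply Rinv_0_lt_compat; lra).
  exists (D * / g). split; [nra|]. intros m n Hm.
  eapply Rle_trans; [apply power_sum_telescope; [lra|auto]|].
  fold D. rewrite Rmult_assoc. apply Rmult_le_compat_l; [lra|].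
  unfold Rdiv. rewrite Rmult_comm. apply Rmult_le_compat_l; [lra|].
  assert (H := Rpower_pos (INR m) g). lra.
Qed.

Lemma ln_le_linear c t : 0 < c -> 0 < t -> ln t <= c * t - 1 - ln c.
Proof.
  intros Hc Ht. assert (Hct : 0 < c * t) by nra.
  assert (H : 1 + ln (c * t) <= c * t).
  { rewrite <- (exp_ln (c * t)) at 2 by auto. apply exp_ineq1_le. }
  rewrite ln_mult in H by auto. lra.
Qed.

Lemma power_exp_bounded a c : 0 < c -> exists K, 0 < K /\
  forall t, 1/2 <= t -> Rpower t a * exp (- (c * t)) <= K.
Proof.
  intros Hc.
  assert (H : exists b, 0 < b /\ a <= b).
  { exists (Rabs a + 1). assert (H := Rle_abs a). assert (H2 := Rabs_pos a). lra. }
  destruct H as [b [Hb Hab]].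
  assert (Hcb : 0 < c / b) by (apply Rdiv_lt_0_compat; lra).
  exists (exp (b * (- 1 - ln (c / b)) + (a - b) * ln (1/2))). split; [apply exp_pos|].
  intros t Ht. unfold Rpower. rewrite <- exp_plus. apply exp_le.
  assert (H1 : ln t <= c / b * t - 1 - ln (c / b)) by (apply ln_le_linear; lra).
  assert (H2 : ln (1/2) <= ln t) by (apply ln_le; lra).
  assert (H3 : b * ln t <= b * (c / b * t - 1 - ln (c / b))) by (apply Rmult_le_compat_l; lra).
  replace (b * (c / b * t - 1 - ln (c / b))) with (c * t + b * (- 1 - ln (c / b))) in H3
    by (field; lra).
  nra.
Qed.

Lemma power_small K a eps : 0 < a -> 0 < eps ->
  exists d, 0 < d /\ forall y, 0 < y < d -> K * Rpower y a <= eps.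
Proof.
  intros Ha He. assert (HK := Rabs_pos K). set (eps' := eps / (Rabs K + 1)).
  assert (He' : 0 < eps') by (apply Rdiv_lt_0_compat; lra).
  exists (Rpower eps' (/ a)). split; [apply Rpower_pos|]. intros y [Hy Hy2].
  assert (H : Rpower y a < eps').
  { replace eps' with (Rpower (Rpower eps' (/ a)) a).
    - apply Rlt_Rpower_l; auto.
    - rewrite Rpower_mult, Rinv_l, Rpower_1; lra. }
  assert (E : (Rabs K + 1) * eps' = eps) by (unfold eps'; field; lra).
  assert (P := Rpower_pos y a). assert (HK2 := Rle_abs K). nra.
Qed.

Lemma power_decay K a eps : 0 < a -> 0 < eps ->
  exists N, (1 <= N)%nat /\ forall n, (N <= n)%nat -> K * Rpower (INR n) (- a) <= eps.
Proof.
  intros Ha He. destruct (power_small K a eps Ha He) as [d [Hd H]].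
  destruct (INR_unbounded (/ d)) as [N HN]. exists (S N). split; [lia|]. intros n Hn.
  assert (Hn1 : 1 <= INR n) by (apply (le_INR 1); lia).
  assert (HNn : INR N <= INR n) by (apply le_INR; lia).
  rewrite <- Rpower_inv_l by lra. apply H. split; [apply Rinv_0_lt_compat; lra|].
  rewrite <- (Rinv_inv d). apply Rinv_lt_contravar; [|lra].
  apply Rmult_lt_0_compat; [now apply Rinv_0_lt_compat|lra].
Qed.

Lemma power_exp_lim a c : 0 < c -> forall eps, 0 < eps -> exists N : nat, (1 <= N)%nat /\
  forall n, (N <= n)%nat -> Rpower (INR n) a * exp (- (c * INR n)) <= eps.
Proof.
  intros Hc eps He. destruct (power_exp_bounded (a + 1) c Hc) as [K [HK H]].
  destruct (INR_unbounded (K / eps)) as [N HN].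
  exists (S N). split; [lia|]. intros n Hn.
  assert (Hn1 : 1 <= INR n) by (apply (le_INR 1); lia).
  assert (HnN : INR N <= INR n) by (apply le_INR; lia).
  specialize (H (INR n)). rewrite Rpower_succ in H by lra.
  specialize (H ltac:(lra)).
  set (X := Rpower (INR n) a * exp (- (c * INR n))).
  assert (HX : 0 < X) by (apply Rmult_lt_0_compat; [apply Rpower_pos|apply exp_pos]).
  replace (Rpower (INR n) a * INR n * exp (- (c * INR n))) with (X * INR n) in H
    by (unfold X; ring).
  assert (H2 : K / eps < INR n) by lra.
  apply (Rmult_lt_compat_r eps) in H2; [|auto].
  unfold Rdiv in H2. rewrite Rmult_assoc, Rinv_l, Rmult_1_r in H2 by lra.
  assert (X * INR n < INR n * eps) by lra. nra.
Qed.

Ltac as_real_equation := match goal with |- ?a = ?b => change (@eq R a b) end.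

(** * Complex functions of a real variable *)

Definition Ccont (h : R -> C) : Prop :=
  (forall x, continuous (fun t => Re (h t)) x) /\
  (forall x, continuous (fun t => Im (h t)) x).

Definition Cderive (h h' : R -> C) : Prop := forall t,
  is_derive (fun t => Re (h t)) t (Re (h' t)) /\
  is_derive (fun t => Im (h t)) t (Im (h' t)).

Lemma Ccont_ext h1 h2 : (forall t, h1 t = h2 t) -> Ccont h1 -> Ccont h2.
Proof.
  intros H [H1 H2]. split; intros x.
  - apply (continuous_ext (fun t => Re (h1 t))); [intros t; now rewrite H|auto].
  - apply (continuous_ext (fun t => Im (h1 t))); [intros t; now rewrite H|auto].
Qed.

Lemma Ccont_const c : Ccont (fun _ => c).
Proof. split; intros x; apply continuous_const. Qed.

Lemma Ccont_plus h1 h2 : Ccont h1 -> Ccont h2 -> Ccont (fun t => h1 t + h2 t)%C.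
Proof.
  intros [H1 H2] [H3 H4]. split; intros x; simpl.
  - apply (continuous_plus (fun t => Re (h1 t)) (fun t => Re (h2 t))); auto.
  - apply (continuous_plus (fun t => Im (h1 t)) (fun t => Im (h2 t))); auto.
Qed.

Lemma Ccont_mult h1 h2 : Ccont h1 -> Ccont h2 -> Ccont (fun t => h1 t * h2 t)%C.
Proof.
  intros [H1 H2] [H3 H4]. split; intros x; simpl.
  - apply (continuous_minus (fun t => Re (h1 t) * Re (h2 t)) (fun t => Im (h1 t) * Im (h2 t)));
      [apply (continuous_mult (fun t => Re (h1 t)) (fun t => Re (h2 t)))
      |apply (continuous_mult (fun t => Im (h1 t)) (fun t => Im (h2 t)))]; auto.
  - apply (continuous_plus (fun t => Re (h1 t) * Im (h2 t)) (fun t => Im (h1 t) * Re (h2 t)));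
      [apply (continuous_mult (fun t => Re (h1 t)) (fun t => Im (h2 t)))
      |apply (continuous_mult (fun t => Im (h1 t)) (fun t => Re (h2 t)))]; auto.
Qed.

Lemma Ccont_scal c h : Ccont h -> Ccont (fun t => c * h t)%C.
Proof. intros H. apply Ccont_mult; [apply Ccont_const|auto]. Qed.

Lemma Ccont_opp h : Ccont h -> Ccont (fun t => - h t)%C.
Proof.
  intros H. apply (Ccont_ext (fun t => RtoC (-1) * h t)%C).
  - intros t. change (RtoC (-1)) with (RtoC (- (1))). rewrite RtoC_opp. ring.
  - now apply Ccont_scal.
Qed.

Lemma Ccont_minus h1 h2 : Ccont h1 -> Ccont h2 -> Ccont (fun t => h1 t - h2 t)%C.
Proof. intros H1 H2. apply Ccont_plus; [auto|now apply Ccont_opp]. Qed.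

Lemma Ccont_Cderive h h' : Cderive h h' -> Ccont h.
Proof.
  intros H. split; intros x.
  - apply (ex_derive_continuous (fun t => Re (h t))). eexists. apply H.
  - apply (ex_derive_continuous (fun t => Im (h t))). eexists. apply H.
Qed.

Lemma Ccont_csum (u : nat -> R -> C) n :
  (forall i, Ccont (u i)) -> Ccont (fun t => csum (fun i => u i t) n).
Proof.
  intros H. induction n as [|n IH]; simpl; [apply Ccont_const|now apply Ccont_plus].
Qed.

Lemma Ccont_shift h x : Ccont h -> Ccont (fun t => h (x + t)).
Proof.
  intros [H1 H2]. assert (Hs : forall t, continuous (fun t => x + t) t).
  { intros t. apply (continuous_plus (fun _ => x) (fun t => t));
      [apply continuous_const|apply continuous_id]. }
  split; intros t.
  - apply (continuous_comp (fun t => x + t) (fun t => Re (h t))); auto.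
  - apply (continuous_comp (fun t => x + t) (fun t => Im (h t))); auto.
Qed.

Lemma Ccont_RtoC_Re h : Ccont h -> Ccont (fun t => RtoC (Re (h t))).
Proof. intros [H1 H2]. split; intros x; simpl; [auto|apply continuous_const]. Qed.

Lemma Ccont_continuous h : Ccont h ->
  forall x, @continuous R_UniformSpace C_UniformSpace h x.
Proof.
  intros [H1 H2] x. apply filterlim_locally. intros eps.
  assert (H1' := proj1 (filterlim_locally _ _) (H1 x) eps).
  assert (H2' := proj1 (filterlim_locally _ _) (H2 x) eps).
  generalize (filter_and _ _ H1' H2'). apply filter_imp.
  intros t [Ha Hb]. split; assumption.
Qed.

Lemma continuous_Ccont h :
  (forall x, @continuous R_UniformSpace C_UniformSpace h x) -> Ccont h.
Proof.
  intros H. split; intros x; apply filterlim_locally; intros eps;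
  generalize (proj1 (filterlim_locally _ _) (H x) eps); apply filter_imp;
  intros t [Ha Hb]; assumption.
Qed.

Lemma Ccont_eps h x : Ccont h -> forall eps, 0 < eps -> exists d, 0 < d /\
  forall t, Rabs (t - x) < d -> Cmod (h t - h x) <= eps.
Proof.
  intros [H1 H2] eps He.
  assert (He2 : 0 < eps / 2) by lra.
  assert (H1' := proj1 (filterlim_locally _ _) (H1 x) (mkposreal _ He2)).
  assert (H2' := proj1 (filterlim_locally _ _) (H2 x) (mkposreal _ He2)).
  destruct (filter_and _ _ H1' H2') as [d Hd].
  exists d. split; [apply cond_pos|]. intros t Ht. destruct (Hd t Ht) as [Ha Hb].
  eapply Rle_trans; [apply Cmod_le_Re_Im|]. rewrite Re_minus, Im_minus.
  unfold ball in Ha, Hb. simpl in Ha, Hb. unfold AbsRing_ball, abs, minus, plus, opp in Ha, Hb.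
  simpl in Ha, Hb. unfold Rminus. lra.
Qed.

Lemma Ccont_uniform_limit h :
  (forall eps, 0 < eps -> exists g, Ccont g /\ forall t, Cmod (h t - g t) <= eps) ->
  Ccont h.
Proof.
  intros H.
  assert (K : forall x eps, 0 < eps -> exists d : posreal,
    forall t, Rabs (t - x) < d -> Cmod (h t - h x) < eps).
  { intros x eps He. destruct (H (eps / 4)) as [g [Hg Hgh]]; [lra|].
    destruct (Ccont_eps g x Hg (eps / 4)) as [d [Hd Hgd]]; [lra|].
    exists (mkposreal d Hd). simpl. intros t Ht.
    replace (h t - h x)%C with ((h t - g t) + (- (h x - g x)) + (g t - g x))%C by ring.
    assert (H1 := Cmod_triangle (h t - g t + - (h x - g x))%C (g t - g x)%C).
    assert (H2 := Cmod_triangle (h t - g t)%C (- (h x - g x))%C).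
    rewrite Cmod_opp in H2.
    specialize (Hgd t Ht). assert (H3 := Hgh t). assert (H4 := Hgh x). lra. }
  split; intros x; apply filterlim_locally; intros eps;
    destruct (K x eps (cond_pos eps)) as [d Hd]; exists d; intros t Ht;
    (eapply Rle_lt_trans; [|apply (Hd t Ht)]).
  - apply (re_le_Cmod (h t - h x)%C).
  - apply (im_le_Cmod (h t - h x)%C).
Qed.

Lemma Cderive_const c : Cderive (fun _ => c) (fun _ => RtoC 0).
Proof. intros t. split; apply @is_derive_const. Qed.

Lemma Cderive_ext h1 h2 h1' h2' : (forall t, h1 t = h2 t) -> (forall t, h1' t = h2' t) ->
  Cderive h1 h1' -> Cderive h2 h2'.
Proof.
  intros H H' D t. destruct (D t) as [D1 D2]. rewrite <- H'. split.
  - apply (is_derive_ext (fun t => Re (h1 t))); [intros s; now rewrite H|auto].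
  - apply (is_derive_ext (fun t => Im (h1 t))); [intros s; now rewrite H|auto].
Qed.

Lemma Cderive_plus h1 h2 h1' h2' : Cderive h1 h1' -> Cderive h2 h2' ->
  Cderive (fun t => h1 t + h2 t)%C (fun t => h1' t + h2' t)%C.
Proof.
  intros D1 D2 t. destruct (D1 t), (D2 t). split.
  - apply (is_derive_plus (fun t => Re (h1 t)) (fun t => Re (h2 t))); auto.
  - apply (is_derive_plus (fun t => Im (h1 t)) (fun t => Im (h2 t))); auto.
Qed.

Lemma is_derive_Rmult (f g : R -> R) x df dg : is_derive f x df -> is_derive g x dg ->
  is_derive (fun t => f t * g t) x (df * g x + f x * dg).
Proof.
  intros H1 H2. apply (is_derive_mult f g); auto. intros; apply Rmult_comm.
Qed.

Lemma Cderive_mult h1 h2 h1' h2' : Cderive h1 h1' -> Cderive h2 h2' ->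
  Cderive (fun t => h1 t * h2 t)%C (fun t => h1' t * h2 t + h1 t * h2' t)%C.
Proof.
  intros D1 D2 t. destruct (D1 t), (D2 t). split; simpl.
  - evar_last.
    + apply (is_derive_minus (fun t => Re (h1 t) * Re (h2 t)) (fun t => Im (h1 t) * Im (h2 t)));
        apply is_derive_Rmult; eassumption.
    + unfold minus, plus, opp; simpl. unfold Re, Im. ring.
  - evar_last.
    + apply (is_derive_plus (fun t => Re (h1 t) * Im (h2 t)) (fun t => Im (h1 t) * Re (h2 t)));
        apply is_derive_Rmult; eassumption.
    + unfold plus; simpl. unfold Re, Im. ring.
Qed.

Lemma Cderive_scal c h h' : Cderive h h' ->
  Cderive (fun t => c * h t)%C (fun t => c * h' t)%C.
Proof.
  intros D. eapply Cderive_ext; [| |apply (Cderive_mult (fun _ => c) h)].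
  - reflexivity.
  - 2: apply Cderive_const. 2: exact D. intros t. simpl. ring.
Qed.

Lemma Cderive_minus h1 h2 h1' h2' : Cderive h1 h1' -> Cderive h2 h2' ->
  Cderive (fun t => h1 t - h2 t)%C (fun t => h1' t - h2' t)%C.
Proof.
  intros D1 D2. apply (Cderive_ext (fun t => h1 t + RtoC (-1) * h2 t)%C _
    (fun t => h1' t + RtoC (-1) * h2' t)%C).
  - intros t. change (RtoC (-1)) with (RtoC (- (1))). rewrite RtoC_opp. ring.
  - intros t. change (RtoC (-1)) with (RtoC (- (1))). rewrite RtoC_opp. ring.
  - apply Cderive_plus; [auto|now apply Cderive_scal].
Qed.

Lemma Cderive_id : Cderive (fun t => RtoC t) (fun _ => RtoC 1).
Proof. intros t. split; simpl; [apply @is_derive_id|apply @is_derive_const]. Qed.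

Lemma Cderive_csum (u u' : nat -> R -> C) n : (forall i, Cderive (u i) (u' i)) ->
  Cderive (fun t => csum (fun i => u i t) n) (fun t => csum (fun i => u' i t) n).
Proof.
  intros H. induction n as [|n IH]; simpl; [apply Cderive_const|now apply Cderive_plus].
Qed.

Lemma Cderive_e k : Cderive (fun t => e (RtoC (k * t)))
  (fun t => RtoC (2 * PI * k) * Ci * e (RtoC (k * t)))%C.
Proof.
  intros t. split.
  - apply (is_derive_ext (fun t => cos (2 * PI * (k * t)))).
    { intros s. rewrite e_R. reflexivity. }
    rewrite e_R. simpl. auto_derive; [exact I|ring].
  - apply (is_derive_ext (fun t => sin (2 * PI * (k * t)))).
    { intros s. rewrite e_R. reflexivity. }
    rewrite e_R. simpl. auto_derive; [exact I|ring].
Qed.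

Lemma Ccont_e k : Ccont (fun t => e (RtoC (k * t))).
Proof. eapply Ccont_Cderive, Cderive_e. Qed.

Lemma Cderive_pow h h' n : Cderive h h' ->
  Cderive (fun t => h t ^ S n)%C (fun t => RtoC (INR (S n)) * h t ^ n * h' t)%C.
Proof.
  intros D. induction n as [|n IH].
  - apply (Cderive_ext h _ h'); [intros t; simpl; ring|intros t; simpl; ring|auto].
  - eapply Cderive_ext; [| |apply (Cderive_mult _ _ _ _ D IH)].
    + intros t. reflexivity.
    + intros t. cbv beta. rewrite (S_INR (S n)), RtoC_plus, (Cpow_S _ n). ring.
Qed.

Lemma is_derive_mean_value (f df : R -> R) a b D :
  (forall t, Rmin a b <= t <= Rmax a b -> is_derive f t (df t)) ->
  (forall t, Rmin a b <= t <= Rmax a b -> Rabs (df t) <= D) ->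
  Rabs (f b - f a) <= D * Rabs (b - a).
Proof.
  intros Hd HD. destruct (MVT_gen f a b df) as [c [Hc ->]].
  - intros x Hx. apply Hd. lra.
  - intros x Hx. apply derivable_continuous_pt. exists (df x).
    apply is_derive_Reals, Hd, Hx.
  - rewrite Rabs_mult. apply Rmult_le_compat_r; [apply Rabs_pos|auto].
Qed.

Lemma Cderive_mean_value h h' a b D : Cderive h h' ->
  (forall t, Rmin a b <= t <= Rmax a b -> Cmod (h' t) <= D) ->
  Cmod (h b - h a) <= 2 * D * Rabs (b - a).
Proof.
  intros Hd HD. eapply Rle_trans; [apply Cmod_le_Re_Im|].
  rewrite Re_minus, Im_minus.
  assert (H1 : Rabs (Re (h b) - Re (h a)) <= D * Rabs (b - a)).
  { apply (is_derive_mean_value (fun t => Re (h t)) (fun t => Re (h' t))).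
    - intros t _. apply Hd.
    - intros t Ht. eapply Rle_trans; [apply re_le_Cmod|auto]. }
  assert (H2 : Rabs (Im (h b) - Im (h a)) <= D * Rabs (b - a)).
  { apply (is_derive_mean_value (fun t => Im (h t)) (fun t => Im (h' t))).
    - intros t _. apply Hd.
    - intros t Ht. eapply Rle_trans; [apply im_le_Cmod|auto]. }
  lra.
Qed.

(** * Integration over one period *)

(** The period is centred at 0, where the kernels paired with [h] peak. *)
Definition Cint (h : R -> C) : C :=
  (RInt (fun t => Re (h t)) (-1/2) (1/2), RInt (fun t => Im (h t)) (-1/2) (1/2)).

Lemma ex_RInt_cont (f : R -> R) a b : (forall x, continuous f x) -> ex_RInt f a b.
Proof. intros H. apply (ex_RInt_continuous (V := R_CompleteNormedModule)). auto. Qed.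

Lemma Cint_ext h1 h2 : (forall t, h1 t = h2 t) -> Cint h1 = Cint h2.
Proof.
  intros H. unfold Cint. f_equal; apply RInt_ext; intros t _; now rewrite H.
Qed.

Lemma Cint_plus h1 h2 : Ccont h1 -> Ccont h2 ->
  Cint (fun t => h1 t + h2 t)%C = (Cint h1 + Cint h2)%C.
Proof.
  intros [H1 H2] [H3 H4]. apply C_ext; simpl.
  - apply (RInt_plus (fun t => Re (h1 t)) (fun t => Re (h2 t))); now apply ex_RInt_cont.
  - apply (RInt_plus (fun t => Im (h1 t)) (fun t => Im (h2 t))); now apply ex_RInt_cont.
Qed.

Lemma RInt_lin (f g : R -> R) a b p q : (forall x, continuous f x) -> (forall x, continuous g x) ->
  RInt (fun t => p * f t + q * g t) a b = p * RInt f a b + q * RInt g a b.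
Proof.
  intros Hf Hg.
  assert (Hf' := ex_RInt_cont f a b Hf). assert (Hg' := ex_RInt_cont g a b Hg).
  rewrite (RInt_plus (fun t => p * f t) (fun t => q * g t)).
  - apply (f_equal2 Rplus); [apply (RInt_scal f a b p)|apply (RInt_scal g a b q)]; auto.
  - apply (ex_RInt_scal f a b p); auto.
  - apply (ex_RInt_scal g a b q); auto.
Qed.

Lemma Cint_scal c h : Ccont h -> Cint (fun t => c * h t)%C = (c * Cint h)%C.
Proof.
  intros [H1 H2]. apply C_ext; simpl.
  - rewrite (RInt_ext _ (fun t => Re c * Re (h t) + (- Im c) * Im (h t))).
    + rewrite RInt_lin by auto. unfold Re, Im. ring.
    + intros t _. unfold Re, Im. simpl. as_real_equation. ring.
  - rewrite (RInt_ext _ (fun t => Re c * Im (h t) + Im c * Re (h t))).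
    + rewrite RInt_lin by auto. unfold Re, Im. ring.
    + intros t _. unfold Re, Im. simpl. as_real_equation. ring.
Qed.

Lemma Cint_0 : Cint (fun _ => RtoC 0) = RtoC 0.
Proof.
  apply C_ext; simpl; (rewrite RInt_const; unfold scal; simpl; unfold mult; simpl; ring).
Qed.

Lemma Cint_csum (u : nat -> R -> C) n : (forall i, Ccont (u i)) ->
  Cint (fun t => csum (fun i => u i t) n) = csum (fun i => Cint (u i)) n.
Proof.
  intros H. induction n as [|n IH]; simpl.
  - apply Cint_0.
  - rewrite Cint_plus, IH; auto. now apply Ccont_csum.
Qed.

Lemma Cint_bound h (phi : R -> R) : Ccont h -> (forall x, continuous phi x) ->
  (forall u, -1/2 < u < 1/2 -> Cmod (h u) <= phi u) ->
  Cmod (Cint h) <= 2 * RInt phi (-1/2) (1/2).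
Proof.
  intros [H1 H2] Hphi H.
  assert (K : forall f : R -> R, (forall x, continuous f x) ->
     (forall u, -1/2 < u < 1/2 -> Rabs (f u) <= phi u) ->
     Rabs (RInt f (-1/2) (1/2)) <= RInt phi (-1/2) (1/2)).
  { intros f Hf Hb. eapply Rle_trans; [apply abs_RInt_le; [lra|now apply ex_RInt_cont]|].
    apply RInt_le; [lra| |now apply ex_RInt_cont|auto].
    apply ex_RInt_cont. intros x. apply (continuous_comp f Rabs); [auto|].
    apply (continuous_Rabs (f x)). }
  eapply Rle_trans; [apply Cmod_le_Re_Im|].
  assert (K1 : Rabs (Re (Cint h)) <= RInt phi (-1/2) (1/2)).
  { apply K; [auto|]. intros u Hu. eapply Rle_trans; [apply re_le_Cmod|auto]. }
  assert (K2 : Rabs (Im (Cint h)) <= RInt phi (-1/2) (1/2)).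
  { apply K; [auto|]. intros u Hu. eapply Rle_trans; [apply im_le_Cmod|auto]. }
  lra.
Qed.

Lemma Cint_bound_const h B : Ccont h -> (forall u, -1/2 < u < 1/2 -> Cmod (h u) <= B) ->
  Cmod (Cint h) <= 2 * B.
Proof.
  intros Hh H. eapply Rle_trans.
  - apply (Cint_bound h (fun _ => B)); [auto|intros; apply continuous_const|auto].
  - rewrite RInt_const. unfold scal; simpl; unfold mult; simpl. lra.
Qed.

Lemma continuous_Rabs_plus y x : continuous (fun u => Rabs u + y) x.
Proof.
  apply (continuous_plus Rabs (fun _ => y)); [apply continuous_Rabs|apply continuous_const].
Qed.

Lemma continuous_power_kernel g y x : 0 < y -> continuous (fun u => Rpower (Rabs u + y) g) x.
Proof.
  intros Hy. apply (continuous_comp (fun u => Rabs u + y) (fun t => Rpower t g)).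
  - apply continuous_Rabs_plus.
  - apply continuous_Rpower. assert (H := Rabs_pos x). lra.
Qed.

Lemma RInt_power_kernel g y : 0 < g -> 0 < y ->
  RInt (fun u => Rpower (Rabs u + y) (- g - 1)) (-1/2) (1/2) <= 2 / g * Rpower y (- g).
Proof.
  intros Hg Hy. set (phi := fun u => _).
  assert (Hphi : forall x, continuous phi x) by (intros; now apply continuous_power_kernel).
  assert (H1 : is_RInt phi 0 (1/2) (Rpower (1/2 + y) (- g) / - g - Rpower (0 + y) (- g) / - g)).
  { apply (is_RInt_ext (fun u => Rpower (u + y) (- g - 1))).
    { intros u Hu. rewrite Rmin_left, Rmax_right in Hu by lra.
      unfold phi. rewrite Rabs_right by lra. reflexivity. }
    apply (is_RInt_derive (fun u => Rpower (u + y) (- g) / - g)).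
    - intros x Hx. rewrite Rmin_left, Rmax_right in Hx by lra.
      apply (is_derive_ext (fun u => / - g * Rpower (u + y) (- g))).
      { intros t. unfold Rdiv. apply Rmult_comm. }
      evar_last.
      + apply is_derive_scal. apply (is_derive_comp (fun t => Rpower t (- g)) (fun u => u + y)).
        * apply is_derive_Rpower. lra.
        * auto_derive; [exact I|reflexivity].
      + unfold scal; simpl; unfold mult; simpl. field. lra.
    - intros x Hx. rewrite Rmin_left, Rmax_right in Hx by lra.
      apply (continuous_comp (fun u => u + y) (fun t => Rpower t (- g - 1))).
      + apply (continuous_plus (fun u => u) (fun _ => y)); [apply continuous_id|apply continuous_const].
      + apply continuous_Rpower. lra. }
  assert (H2 : is_RInt phi (-1/2) 0 (Rpower (y - 0) (- g) / g - Rpower (y - - 1/2) (- g) / g)).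
  { apply (is_RInt_ext (fun u => Rpower (y - u) (- g - 1))).
    { intros u Hu. rewrite Rmin_left, Rmax_right in Hu by lra.
      unfold phi. rewrite Rabs_left by lra. f_equal. ring. }
    apply (is_RInt_derive (fun u => Rpower (y - u) (- g) / g)).
    - intros x Hx. rewrite Rmin_left, Rmax_right in Hx by lra.
      apply (is_derive_ext (fun u => / g * Rpower (y - u) (- g))).
      { intros t. unfold Rdiv. apply Rmult_comm. }
      evar_last.
      + apply is_derive_scal. apply (is_derive_comp (fun t => Rpower t (- g)) (fun u => y - u)).
        * apply is_derive_Rpower. lra.
        * auto_derive; [exact I|reflexivity].
      + unfold scal; simpl; unfold mult; simpl. field. lra.
    - intros x Hx. rewrite Rmin_left, Rmax_right in Hx by lra.
      apply (continuous_comp (fun u => y - u) (fun t => Rpower t (- g - 1))).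
      + apply (continuous_minus (fun _ => y) (fun u => u)); [apply continuous_const|apply continuous_id].
      + apply continuous_Rpower. lra. }
  rewrite <- (RInt_Chasles phi (-1/2) 0 (1/2)) by (now apply ex_RInt_cont).
  rewrite (is_RInt_unique _ _ _ _ H1), (is_RInt_unique _ _ _ _ H2).
  unfold plus; simpl. rewrite Rplus_0_l, Rminus_0_r.
  assert (P1 := Rpower_pos (1/2 + y) (- g)). assert (P2 := Rpower_pos (y - -1/2) (- g)).
  assert (Hi : 0 < / g) by (apply Rinv_0_lt_compat; lra).
  replace (2 / g * Rpower y (- g))
   with (Rpower y (- g) / g - Rpower (y - -1/2) (- g) / g +
         (Rpower (1/2 + y) (- g) / - g - Rpower y (- g) / - g)
         + / g * (Rpower (y - -1/2) (- g) + Rpower (1/2 + y) (- g))) by (field; lra).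
  assert (0 < / g * (Rpower (y - -1/2) (- g) + Rpower (1/2 + y) (- g))).
  { apply Rmult_lt_0_compat; lra. }
  lra.
Qed.

(** A kernel of size [(|u| + y) ^ (- g - 1)] has its mass, of order [y ^ (- g)],
    near [|u| <= y]. *)
Lemma Cint_power_bound h A B g y : Ccont h -> 0 < g -> 0 < y -> 0 <= A ->
  (forall u, -1/2 < u < 1/2 -> Cmod (h u) <= A * Rpower (Rabs u + y) (- g - 1) + B) ->
  Cmod (Cint h) <= 4 * A / g * Rpower y (- g) + 2 * B.
Proof.
  intros Hh Hg Hy HA H.
  set (phi := fun u => Rpower (Rabs u + y) (- g - 1)).
  assert (Hphi : forall x, continuous phi x) by (intros; now apply continuous_power_kernel).
  eapply Rle_trans.
  - apply (Cint_bound h (fun u => A * phi u + B * 1)); [auto| |].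
    + intros x. apply (continuous_plus (fun u => A * phi u) (fun _ => B * 1)).
      * apply (continuous_mult (fun _ => A) phi); [apply continuous_const|auto].
      * apply continuous_const.
    + intros u Hu. rewrite Rmult_1_r. now apply H.
  - rewrite (RInt_lin phi (fun _ => 1)); [|auto|intros; apply continuous_const].
    rewrite RInt_const. unfold scal; simpl; unfold mult; simpl.
    assert (K := RInt_power_kernel g y Hg Hy). fold phi in K.
    apply (Rmult_le_compat_l A) in K; [|auto].
    replace (4 * A / g * Rpower y (- g)) with (2 * (A * (2 / g * Rpower y (- g)))) by (field; lra).
    lra.
Qed.

Lemma Cint_e (k : Z) : k <> 0%Z -> Cint (fun t => e (RtoC (IZR k * t))) = RtoC 0.
Proof.
  intros Hk. assert (Hk' : IZR k <> 0) by now apply not_0_IZR.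
  assert (HPI := PI_RGT_0).
  assert (Hs : sin (PI * IZR k) = 0).
  { apply sin_eq_0_1. exists k. ring. }
  assert (Hn : 2 * PI * IZR k <> 0).
  { apply Rmult_integral_contrapositive_currified; [lra|auto]. }
  apply C_ext.
  - change (RInt (fun t => Re (e (RtoC (IZR k * t)))) (-1/2) (1/2) = 0).
    apply is_RInt_unique.
    apply (is_RInt_ext (fun t => cos (2 * PI * (IZR k * t)))).
    { intros t _. rewrite e_R. reflexivity. }
    evar_last.
    + apply (is_RInt_derive (fun t => sin (2 * PI * (IZR k * t)) / (2 * PI * IZR k))).
      * intros x _. auto_derive; [exact I|]. field. split; auto. lra.
      * intros x _. apply (ex_derive_continuous (fun t => cos (2 * PI * (IZR k * t)))).
        auto_derive. exact I.
    + unfold minus, plus, opp; simpl.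
      replace (2 * PI * (IZR k * (1 / 2))) with (PI * IZR k) by field.
      replace (2 * PI * (IZR k * (-1 / 2))) with (- (PI * IZR k)) by field.
      rewrite sin_neg, Hs. field. split; auto. lra.
  - change (RInt (fun t => Im (e (RtoC (IZR k * t)))) (-1/2) (1/2) = 0).
    apply is_RInt_unique.
    apply (is_RInt_ext (fun t => sin (2 * PI * (IZR k * t)))).
    { intros t _. rewrite e_R. reflexivity. }
    evar_last.
    + apply (is_RInt_derive (fun t => - cos (2 * PI * (IZR k * t)) / (2 * PI * IZR k))).
      * intros x _. auto_derive; [exact I|]. field. split; auto. lra.
      * intros x _. apply (ex_derive_continuous (fun t => sin (2 * PI * (IZR k * t)))).
        auto_derive. exact I.
    + unfold minus, plus, opp; simpl.
      replace (2 * PI * (IZR k * (1 / 2))) with (PI * IZR k) by field.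
      replace (2 * PI * (IZR k * (-1 / 2))) with (- (PI * IZR k)) by field.
      rewrite cos_neg. ring.
Qed.

Lemma Cint_1 : Cint (fun _ => RtoC 1) = RtoC 1.
Proof.
  apply C_ext; simpl; (rewrite RInt_const; unfold scal; simpl; unfold mult; simpl; field).
Qed.

(** * Uniformly convergent Fourier series with positive frequencies *)

(** The index [i] carries the frequency [i + 1]. *)
Definition fourier_sum (c : nat -> C) (M : nat) (t : R) : C :=
  csum (fun i => c i * e (RtoC (INR (S i) * t)))%C M.

Definition uniform_fourier (c : nat -> C) (h : R -> C) : Prop :=
  forall eps, 0 < eps -> exists M0, forall M t, (M0 <= M)%nat ->
    Cmod (h t - fourier_sum c M t) <= eps.

Lemma Ccont_fourier_sum c M : Ccont (fourier_sum c M).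
Proof.
  apply (Ccont_csum (fun i t => c i * e (RtoC (INR (S i) * t)))%C).
  intros i. apply Ccont_scal, Ccont_e.
Qed.

Lemma uniform_fourier_cont c h : uniform_fourier c h -> Ccont h.
Proof.
  intros H. apply Ccont_uniform_limit. intros eps He.
  destruct (H eps He) as [M0 HM]. exists (fourier_sum c M0).
  split; [apply Ccont_fourier_sum|]. intros t. apply HM. lia.
Qed.

Lemma Cint_fourier_sum c M (k : Z) :
  Cint (fun t => fourier_sum c M t * e (RtoC (IZR k * t)))%C =
  csum (fun i => if Z.eqb (Z.of_nat (S i) + k) 0 then c i else RtoC 0) M.
Proof.
  rewrite (Cint_ext _ (fun t => csum (fun i => c i * e (RtoC (IZR (Z.of_nat (S i) + k) * t)))%C M)).
  - rewrite (Cint_csum (fun i t => c i * e (RtoC (IZR (Z.of_nat (S i) + k) * t)))%C).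
    + apply csum_ext. intros i _. rewrite Cint_scal by apply Ccont_e.
      destruct (Z.eqb_spec (Z.of_nat (S i) + k) 0) as [E|E].
      * rewrite E. rewrite (Cint_ext _ (fun _ => RtoC 1)).
        -- rewrite Cint_1. ring.
        -- intros t. rewrite Rmult_0_l. apply e_0.
      * rewrite Cint_e by auto. ring.
    + intros i. apply Ccont_scal, Ccont_e.
  - intros t. unfold fourier_sum. rewrite Cmult_comm, <- csum_mult_l.
    apply csum_ext. intros i _. rewrite plus_IZR, <- INR_IZR_INZ, Rmult_plus_distr_r, RtoC_plus, e_plus.
    ring.
Qed.

Lemma Cmod_eq_0_eps z : (forall eps, 0 < eps -> Cmod z <= eps) -> z = RtoC 0.
Proof.
  intros H. apply Cmod_eq_0. apply Rle_antisym; [|apply Cmod_ge_0].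
  apply le_epsilon. intros eps He. rewrite Rplus_0_l. auto.
Qed.

Lemma uniform_fourier_coef_aux c h (k : Z) l : uniform_fourier c h ->
  (exists M1, forall M, (M1 <= M)%nat ->
    csum (fun i => if Z.eqb (Z.of_nat (S i) + k) 0 then c i else RtoC 0) M = l) ->
  Cint (fun t => h t * e (RtoC (IZR k * t)))%C = l.
Proof.
  intros H [M1 HM1]. apply Ceq_minus, Cmod_eq_0_eps. intros eps He.
  destruct (H (eps / 2)) as [M0 HM0]; [lra|].
  set (M := max M0 M1). rewrite <- (HM1 M) by lia.
  rewrite <- Cint_fourier_sum.
  assert (Hh := uniform_fourier_cont _ _ H).
  assert (Hc1 : Ccont (fun t => h t * e (RtoC (IZR k * t)))%C)
    by (apply Ccont_mult; [auto|apply Ccont_e]).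
  assert (Hc2 : Ccont (fun t => fourier_sum c M t * e (RtoC (IZR k * t)))%C)
    by (apply Ccont_mult; [apply Ccont_fourier_sum|apply Ccont_e]).
  replace (Cint (fun t => h t * e (RtoC (IZR k * t))) -
           Cint (fun t => fourier_sum c M t * e (RtoC (IZR k * t))))%C
    with (Cint (fun t => h t * e (RtoC (IZR k * t)) +
                RtoC (-1) * (fourier_sum c M t * e (RtoC (IZR k * t))))%C).
  - replace eps with (2 * (eps / 2)) by field. apply Cint_bound_const.
    + apply Ccont_plus; [auto|now apply Ccont_scal].
    + intros u _. change (RtoC (-1)) with (RtoC (- (1))). rewrite RtoC_opp.
      replace (h u * e (RtoC (IZR k * u)) + - (1) * (fourier_sum c M u * e (RtoC (IZR k * u))))%C
        with ((h u - fourier_sum c M u) * e (RtoC (IZR k * u)))%C by ring.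
      rewrite Cmod_mult, Cmod_e_R, Rmult_1_r. apply HM0. lia.
  - rewrite Cint_plus, Cint_scal; auto; [|now apply Ccont_scal].
    change (RtoC (-1)) with (RtoC (- (1))). rewrite RtoC_opp. ring.
Qed.

Lemma uniform_fourier_coef c h i : uniform_fourier c h ->
  Cint (fun t => h t * e (RtoC (- INR (S i) * t)))%C = c i.
Proof.
  intros H. rewrite <- (uniform_fourier_coef_aux c h (- Z.of_nat (S i)) (c i) H).
  - apply Cint_ext. intros t. rewrite opp_IZR, <- INR_IZR_INZ. reflexivity.
  - exists (S i). intros M HM. induction HM as [|M HM IH].
    + rewrite csum_S, (csum_ext _ (fun _ => RtoC 0 * RtoC 0)%C).
      * rewrite csum_mult_l, Z.add_opp_diag_r. simpl. ring.
      * intros m Hm. destruct (Z.eqb_spec (Z.of_nat (S m) + - Z.of_nat (S i)) 0); [lia|ring].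
    + rewrite csum_S, IH.
      destruct (Z.eqb_spec (Z.of_nat (S M) + - Z.of_nat (S i)) 0); [lia|ring].
Qed.

Lemma uniform_fourier_coef_pos c h n : uniform_fourier c h ->
  Cint (fun t => h t * e (RtoC (INR n * t)))%C = RtoC 0.
Proof.
  intros H. rewrite <- (uniform_fourier_coef_aux c h (Z.of_nat n) (RtoC 0) H).
  - apply Cint_ext. intros t. rewrite <- INR_IZR_INZ. reflexivity.
  - exists O. intros M _. rewrite (csum_ext _ (fun _ => RtoC 0 * RtoC 0)%C).
    + rewrite csum_mult_l. ring.
    + intros m Hm. destruct (Z.eqb_spec (Z.of_nat (S m) + Z.of_nat n) 0); [lia|ring].
Qed.

(** * Rational approximation *)

(** Neighbouring Farey fractions around [x]: consecutive ones have determinant 1,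
    which later makes them columns of a matrix in [SL2Z]. *)
Lemma farey_neighbours x (Q : nat) : exists p q p' q' : Z,
  (1 <= q <= Z.of_nat (S Q))%Z /\ (1 <= q' <= Z.of_nat (S Q))%Z /\
  (p' * q - p * q' = 1)%Z /\ (Z.of_nat (S Q) + 1 <= q + q')%Z /\
  IZR p <= IZR q * x /\ IZR q' * x <= IZR p'.
Proof.
  induction Q as [|Q IH].
  - exists (Int_part x), 1%Z, (Int_part x + 1)%Z, 1%Z.
    destruct (base_Int_part x) as [H1 H2]. rewrite plus_IZR.
    repeat split; try lia; lra.
  - destruct IH as (p & q & p' & q' & Hq & Hq' & Hdet & Hsum & Hl & Hr).
    destruct (Z_le_gt_dec (Z.of_nat (S (S Q)) + 1) (q + q')) as [H|H].
    + exists p, q, p', q'. repeat split; try lia; assumption.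
    + assert (Hs : (q + q' = Z.of_nat (S (S Q)))%Z) by lia.
      destruct (Rle_dec (IZR (p + p')) (IZR (q + q') * x)) as [H1|H1].
      * exists (p + p')%Z, (q + q')%Z, p', q'. repeat split; try lia; assumption.
      * exists p, q, (p + p')%Z, (q + q')%Z. repeat split; try lia; lra.
Qed.

(** With [p / q <= x <= p' / q'] neighbours, [q' (q x - p) + q (p' - q' x) = 1], so
    one of the two differences is at most [1 / (q + q')].  The other fraction
    provides the second column of the matrix. *)
Lemma dirichlet x (Q : nat) : (1 <= Q)%nat -> exists p q b d : Z,
  (1 <= q <= Z.of_nat Q)%Z /\ SL2Z (mkM2Z p b q d) /\
  Rabs (IZR q * x - IZR p) <= / (INR Q + 1).
Proof.
  intros HQ. destruct Q as [|Q]; [lia|].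
  destruct (farey_neighbours x Q) as (p & q & p' & q' & Hq & Hq' & Hdet & Hsum & Hl & Hr).
  apply IZR_le in Hsum. rewrite !plus_IZR, <- INR_IZR_INZ in Hsum.
  set (D := INR (S Q) + 1) in *.
  assert (HD : 1 <= D) by (unfold D; assert (H := pos_INR (S Q)); lra).
  assert (Hk : IZR q' * (IZR q * x - IZR p) + IZR q * (IZR p' - IZR q' * x) = 1).
  { apply (f_equal IZR) in Hdet. rewrite minus_IZR, !mult_IZR in Hdet. rewrite <- Hdet. ring. }
  assert (Hq1 : 1 <= IZR q) by (apply IZR_le; lia).
  assert (Hq1' : 1 <= IZR q') by (apply IZR_le; lia).
  assert (HDi : D * / D = 1) by (apply Rinv_r; lra).
  destruct (Rle_dec (IZR q * x - IZR p) (/ D)) as [H|H].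
  - exists p, q, (- p')%Z, (- q')%Z. split; [lia|]. split; [unfold SL2Z; simpl; lia|].
    rewrite Rabs_right by lra. exact H.
  - exists p', q', p, q. split; [lia|]. split; [unfold SL2Z; simpl; lia|].
    rewrite Rabs_left1 by lra. apply Rnot_lt_le. intros H2.
    apply Rnot_le_lt in H.
    assert (Hi : 0 < / D) by (apply Rinv_0_lt_compat; lra).
    assert (K1 : IZR q' * / D < IZR q' * (IZR q * x - IZR p)) by (apply Rmult_lt_compat_l; lra).
    assert (K2 : IZR q * / D < IZR q * (IZR p' - IZR q' * x)) by (apply Rmult_lt_compat_l; lra).
    assert (K3 : D * / D <= (IZR q + IZR q') * / D) by (apply Rmult_le_compat_r; lra).
    lra.
Qed.

Definition irrational (x : R) : Prop :=
  forall p q : Z, (0 < q)%Z -> IZR q * x <> IZR p.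

(** Forces the denominators of good approximations to an irrational number to
    infinity. *)
Lemma irrational_small_denominators x : irrational x -> forall K : nat,
  exists d, 0 < d /\ forall p q : Z, (1 <= q <= Z.of_nat K)%Z -> d < Rabs (IZR q * x - IZR p).
Proof.
  intros Hx K. induction K as [|K [d [Hd IH]]].
  - exists 1. split; [lra|]. intros p q Hq. lia.
  - set (q0 := Z.of_nat (S K)). set (y := IZR q0 * x).
    destruct (base_Int_part y) as [H1 H2].
    assert (H1' : IZR (Int_part y) < y).
    { destruct H1 as [H1|H1]; [exact H1|]. exfalso. apply (Hx (Int_part y) q0); [lia|]. now symmetry. }
    set (d0 := Rmin (y - IZR (Int_part y)) (IZR (Int_part y) + 1 - y)).
    assert (Hd0 : 0 < d0) by (apply Rmin_glb_lt; lra).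
    assert (Hm1 := Rmin_l (y - IZR (Int_part y)) (IZR (Int_part y) + 1 - y)).
    assert (Hm2 := Rmin_r (y - IZR (Int_part y)) (IZR (Int_part y) + 1 - y)).
    fold d0 in Hm1, Hm2.
    exists (Rmin d (d0 / 2)). split; [apply Rmin_glb_lt; lra|]. intros p q Hq.
    destruct (Z.eq_dec q q0) as [->|Hne].
    + eapply Rle_lt_trans; [apply Rmin_r|]. fold y.
      destruct (Z_le_gt_dec p (Int_part y)) as [Hp|Hp].
      * apply IZR_le in Hp. rewrite Rabs_right by lra. lra.
      * assert (Hp' : (Int_part y + 1 <= p)%Z) by lia. apply IZR_le in Hp'.
        rewrite plus_IZR in Hp'. rewrite Rabs_left by lra. lra.
    + eapply Rle_lt_trans; [apply Rmin_l|]. apply IH. lia.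
Qed.

(** * The action of the modular group *)

Lemma j_neq_0 g z : SL2Z g -> upper_half_plane z -> j g z <> RtoC 0.
Proof.
  unfold SL2Z, upper_half_plane, j. intros Hg Hz E.
  assert (E1 := f_equal Im E). assert (E2 := f_equal Re E). simpl in E1, E2.
  change (snd z) with (Im z) in *. change (fst z) with (Re z) in *.
  assert (Hc : IZR (m21 g) = 0) by nra.
  apply eq_IZR in Hc. rewrite Hc in *. 
  assert (Hd : IZR (m22 g) = 0) by (simpl in E2; lra). apply eq_IZR in Hd.
  rewrite Hd in Hg. lia.
Qed.

Lemma Im_div z w : w <> RtoC 0 -> Im (z / w)%C = Im (z * Cconj w)%C / Cmod w ^ 2.
Proof.
  intros Hw. assert (Hm : Cmod w ^ 2 <> 0).
  { apply pow_nonzero. apply Cmod_gt_0 in Hw. lra. }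
  rewrite Cmod2_alt in *. destruct z, w; simpl in *. field. simpl in Hm. lra.
Qed.

Lemma Im_moebius g z : SL2Z g -> upper_half_plane z ->
  Im (moebius g z) = Im z / Cmod (j g z) ^ 2.
Proof.
  intros Hg Hz. unfold moebius. fold (j g z).
  rewrite Im_div by (now apply j_neq_0). f_equal.
  unfold SL2Z in Hg. apply (f_equal IZR) in Hg. rewrite minus_IZR, !mult_IZR in Hg.
  unfold j. destruct z as [x y]; simpl.
  transitivity ((IZR (m11 g) * IZR (m22 g) - IZR (m12 g) * IZR (m21 g)) * y); [ring|].
  rewrite Hg. ring.
Qed.

Lemma upper_moebius g z : SL2Z g -> upper_half_plane z -> upper_half_plane (moebius g z).
Proof.
  intros Hg Hz. unfold upper_half_plane. rewrite Im_moebius by auto.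
  apply Rdiv_lt_0_compat; [exact Hz|]. apply pow_lt. apply Cmod_gt_0. now apply j_neq_0.
Qed.

Lemma SL2Z_mul g h : SL2Z g -> SL2Z h -> SL2Z (M2Z_mul g h).
Proof.
  unfold SL2Z. intros Hg Hh. simpl.
  transitivity ((m11 g * m22 g - m12 g * m21 g) * (m11 h * m22 h - m12 h * m21 h))%Z; [ring|].
  rewrite Hg, Hh. reflexivity.
Qed.

Lemma SL2Z_inv g : SL2Z g -> SL2Z (M2Z_inv g).
Proof. unfold SL2Z. intros Hg. simpl. rewrite <- Hg. ring. Qed.

Lemma moebius_mul g h z : SL2Z g -> SL2Z h -> upper_half_plane z ->
  moebius (M2Z_mul g h) z = moebius g (moebius h z).
Proof.
  intros Hg Hh Hz.
  assert (H1 := j_neq_0 h z Hh Hz).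
  assert (H2 := j_neq_0 g _ Hg (upper_moebius h z Hh Hz)).
  assert (H3 := j_neq_0 _ z (SL2Z_mul g h Hg Hh) Hz).
  unfold moebius, j in *. simpl in *. rewrite !plus_IZR, !mult_IZR, !RtoC_plus, !RtoC_mult in *.
  field. repeat split; auto.
  intros E. apply H3. rewrite <- E. ring.
Qed.

Lemma moebius_inv_r g z : SL2Z g -> upper_half_plane z -> moebius g (moebius (M2Z_inv g) z) = z.
Proof.
  intros Hg Hz. rewrite <- moebius_mul by (auto using SL2Z_inv).
  unfold moebius, SL2Z in *. simpl.
  replace (m11 g * m22 g + m12 g * - m21 g)%Z with 1%Z by lia.
  replace (m11 g * - m12 g + m12 g * m11 g)%Z with 0%Z by lia.
  replace (m21 g * m22 g + m22 g * - m21 g)%Z with 0%Z by lia.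
  replace (m21 g * - m12 g + m22 g * m11 g)%Z with 1%Z by lia.
  field.
Qed.

Lemma Cmod_Crpow z a : Cmod (Crpow z a) = Rpower (Cmod z) a.
Proof. apply Cmod_polar, Rpower_pos. Qed.

(** The Petersson size of [f]: multiplying by the power of the height makes the
    modulus invariant under the group of [f]. *)
Definition petersson (r : R) (f : C -> C) (z : C) : R :=
  Rpower (Im z) (r / 2) * Cmod (f z).

Lemma Rpower_Im_moebius r g z : SL2Z g -> upper_half_plane z ->
  Rpower (Im (moebius g z)) (r / 2) = Rpower (Im z) (r / 2) * Rpower (Cmod (j g z)) (- r).
Proof.
  intros Hg Hz. rewrite Im_moebius by auto.
  assert (Hj : 0 < Cmod (j g z)) by (apply Cmod_gt_0; now apply j_neq_0).
  unfold Rdiv at 1. rewrite <- Rpower_mult_distr; [|exact Hz|].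
  - f_equal. rewrite Rpower_inv_l by (now apply pow_lt).
    rewrite <- Rpower_pow, Rpower_mult by auto. f_equal. simpl. field.
  - apply Rinv_0_lt_compat. now apply pow_lt.
Qed.

Lemma petersson_slash r f s w : SL2Z s -> upper_half_plane w ->
  petersson r f (moebius s w) = Rpower (Im w) (r / 2) * Cmod (slash r f s w).
Proof.
  intros Hs Hw. unfold petersson, slash.
  rewrite Rpower_Im_moebius, Cmod_mult, Cmod_Crpow by auto. ring.
Qed.

Lemma petersson_invariant G r f g z : subgroup_SL2Z G -> modular_form G r f ->
  G g -> upper_half_plane z -> petersson r f (moebius g z) = petersson r f z.
Proof.
  intros [HG _] [_ [[m [[Hm _] Hf]] _]] Hg Hz. unfold petersson.
  assert (Hs := HG g Hg).
  rewrite Rpower_Im_moebius, Hf, !Cmod_mult, Cmod_Crpow, Hm, Rpower_Ropp by auto.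
  field. assert (H := Rpower_pos (Cmod (j g z)) r). lra.
Qed.

(** * Uniformity over the cusps *)

Definition congruent (N : Z) (s t : M2Z) : Prop :=
  (N | m11 s - m11 t)%Z /\ (N | m12 s - m12 t)%Z /\
  (N | m21 s - m21 t)%Z /\ (N | m22 s - m22 t)%Z.

Lemma congruent_principal N s t : SL2Z s -> SL2Z t -> congruent N s t ->
  principal_congruence N (M2Z_mul s (M2Z_inv t)).
Proof.
  intros Hs Ht (H1 & H2 & H3 & H4). split; [apply SL2Z_mul; auto using SL2Z_inv|].
  unfold SL2Z in *. simpl.
  destruct H1 as [k1 H1], H2 as [k2 H2], H3 as [k3 H3], H4 as [k4 H4].
  assert (E1 : m11 s = (m11 t + k1 * N)%Z) by lia.
  assert (E2 : m12 s = (m12 t + k2 * N)%Z) by lia.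
  assert (E3 : m21 s = (m21 t + k3 * N)%Z) by lia.
  assert (E4 : m22 s = (m22 t + k4 * N)%Z) by lia.
  rewrite E1, E2, E3, E4. repeat split.
  - exists (k1 * m22 t - k2 * m21 t)%Z. rewrite <- Ht. ring.
  - exists (k2 * m11 t - k1 * m12 t)%Z. ring.
  - exists (k3 * m22 t - k4 * m21 t)%Z. ring.
  - exists (k4 * m11 t - k3 * m12 t)%Z. rewrite <- Ht. ring.
Qed.

(** Matrices congruent modulo [N] differ by a factor in the principal congruence
    group, which lies in the group of [f]. *)
Lemma petersson_congruent G r f N s t w : subgroup_SL2Z G ->
  (forall g, principal_congruence N g -> G g) -> modular_form G r f ->
  SL2Z s -> SL2Z t -> congruent N s t -> upper_half_plane w ->
  petersson r f (moebius s w) = petersson r f (moebius t w).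
Proof.
  intros HG HN Hf Hs Ht Hst Hw.
  rewrite <- (petersson_invariant G r f (M2Z_mul s (M2Z_inv t)) (moebius t w)); auto.
  - f_equal. rewrite moebius_mul; auto using SL2Z_inv, upper_moebius. f_equal.
    rewrite <- moebius_mul; auto using SL2Z_inv.
    unfold moebius. simpl. unfold SL2Z in Ht.
    replace (m22 t * m11 t + - m12 t * m21 t)%Z with 1%Z by lia.
    replace (m22 t * m12 t + - m12 t * m22 t)%Z with 0%Z by lia.
    replace (- m21 t * m11 t + m11 t * m21 t)%Z with 0%Z by lia.
    replace (- m21 t * m12 t + m11 t * m22 t)%Z with 1%Z by lia.
    field.
  - apply HN. now apply congruent_principal.
  - now apply upper_moebius.
Qed.

Lemma finite_uniform (N : Z) (P : Z -> R -> Prop) :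
  (forall i, (0 <= i < N)%Z -> exists B, forall B', B <= B' -> P i B') ->
  exists B, forall B', B <= B' -> forall i, (0 <= i < N)%Z -> P i B'.
Proof.
  intros H. destruct (Z_le_gt_dec 0 N) as [HN|HN].
  2: { exists 0. intros; lia. }
  revert P H. pattern N. apply natlike_ind; [| |exact HN].
  - intros P _. exists 0. intros; lia.
  - intros n Hn IH P H. destruct (IH P) as [B1 HB1].
    { intros i Hi. apply H. lia. }
    destruct (H n) as [B2 HB2]; [lia|].
    exists (Rmax B1 B2). intros B' HB' i Hi.
    assert (K1 := Rmax_l B1 B2). assert (K2 := Rmax_r B1 B2).
    destruct (Z.eq_dec i n) as [->|Hne].
    + apply HB2. lra.
    + apply HB1; [lra|lia].
Qed.

(** The residue classes modulo [N] are finite in number, so constants found one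
    matrix at a time have a common upper bound.  Asking for every larger [B']
    makes the property monotone in the constant. *)
Lemma class_uniform (N : Z) (P : M2Z -> R -> Prop) : (0 < N)%Z ->
  (forall s t B, SL2Z s -> SL2Z t -> congruent N s t -> P s B -> P t B) ->
  (forall s, SL2Z s -> exists B, forall B', B <= B' -> P s B') ->
  exists B, forall B', B <= B' -> forall s, SL2Z s -> P s B'.
Proof.
  intros HN Hc H.
  assert (K : exists B, forall B', B <= B' ->
    forall a, (0 <= a < N)%Z -> forall b, (0 <= b < N)%Z ->
    forall c, (0 <= c < N)%Z -> forall d, (0 <= d < N)%Z ->
    forall s, SL2Z s -> (m11 s mod N = a -> m12 s mod N = b ->
       m21 s mod N = c -> m22 s mod N = d -> P s B')%Z).
  { do 4 (apply finite_uniform; intros ? _).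
    match goal with |- exists _, forall _, _ -> forall s, _ -> (_ = ?a -> _ = ?b -> _ = ?c -> _ = ?d -> _)%Z =>
      rename a into a0, b into b0, c into c0, d into d0 end.
    destruct (classic (exists s, SL2Z s /\
      (m11 s mod N = a0 /\ m12 s mod N = b0 /\ m21 s mod N = c0 /\ m22 s mod N = d0)%Z))
      as [[s0 [Hs0 E0]]|Hno].
    - destruct (H s0 Hs0) as [B HB]. exists B. intros B' HB' s Hs E1 E2 E3 E4.
      apply (Hc s0 s); auto. destruct E0 as (F1 & F2 & F3 & F4).
      assert (D : forall u v, (u mod N = v mod N)%Z -> (N | u - v)%Z).
      { intros u v E. apply Z.mod_divide; [lia|]. rewrite Zminus_mod, E, Z.sub_diag. reflexivity. }
      repeat split; apply D; congruence.
    - exists 0. intros B' _ s Hs E1 E2 E3 E4. exfalso. apply Hno. exists s. auto. }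
  destruct K as [B HB]. exists B. intros B' HB' s Hs.
  apply (HB B' HB' (m11 s mod N)%Z) with (b := (m12 s mod N)%Z) (c := (m21 s mod N)%Z)
    (d := (m22 s mod N)%Z); auto; apply Z.mod_pos_bound; auto.
Qed.

(** * Expansions at the cusps *)

Definition Clim (u : nat -> C) (l : C) : Prop :=
  forall eps, 0 < eps -> exists N, forall n, (N <= n)%nat -> Cmod (u n - l) <= eps.

Lemma is_series_Clim u l :
  @is_series C_AbsRing C_NormedModule u l -> Clim (csum u) l.
Proof.
  intros H eps He. assert (He2 : 0 < eps / 2) by lra.
  assert (K := proj1 (filterlim_locally _ _) H (mkposreal _ He2)).
  destruct K as [N HN]. exists (S N). intros n Hn. destruct n as [|n]; [lia|].
  destruct (HN n) as [Ha Hb]; [lia|].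
  change (sum_n u n) with (@sum_n C_AbelianMonoid u n) in Ha, Hb.
  rewrite csum_sum_n in Ha, Hb.
  eapply Rle_trans; [apply Cmod_le_Re_Im|]. rewrite Re_minus, Im_minus.
  unfold ball in Ha, Hb. simpl in Ha, Hb. unfold AbsRing_ball, abs, minus, plus, opp in Ha, Hb.
  simpl in Ha, Hb. simpl csum. unfold Re, Im, Rminus in *. simpl. lra.
Qed.

Lemma Clim_terms_bounded u l : Clim (csum u) l -> exists B, 0 < B /\ forall n, Cmod (u n) <= B.
Proof.
  intros H. destruct (H 1 ltac:(lra)) as [N HN].
  assert (K : forall m, exists B, 0 < B /\ forall n, (n < m)%nat -> Cmod (u n) <= B).
  { intros m. induction m as [|m [B [HB IH]]].
    - exists 1. split; [lra|]. intros; lia.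
    - exists (B + Cmod (u m)). assert (Hm := Cmod_ge_0 (u m)). split; [lra|].
      intros n Hn. destruct (Nat.eq_dec n m) as [->|Hne]; [lra|].
      eapply Rle_trans; [apply IH; lia|lra]. }
  destruct (K N) as [B [HB HBN]]. exists (B + 2). split; [lra|]. intros n.
  destruct (le_lt_dec N n) as [Hn|Hn].
  - assert (H1 := HN n Hn). assert (H2 := HN (S n) ltac:(lia)).
    replace (u n) with ((csum u (S n) - l) + - (csum u n - l))%C by (rewrite csum_S; ring).
    eapply Rle_trans; [apply Cmod_triangle|]. rewrite Cmod_opp. lra.
  - specialize (HBN n Hn). lra.
Qed.

Lemma Clim_le u l a B N : Clim u l -> (forall n, (N <= n)%nat -> Cmod (u n - a) <= B) ->
  Cmod (l - a) <= B.
Proof.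
  intros H HB. apply le_epsilon. intros eps He. destruct (H eps He) as [N' HN'].
  set (n := max N N'). specialize (HB n ltac:(lia)). specialize (HN' n ltac:(lia)).
  replace (l - a)%C with ((u n - a) + - (u n - l))%C by ring.
  eapply Rle_trans; [apply Cmod_triangle|]. rewrite Cmod_opp. lra.
Qed.

(** Convergence at height [t1] bounds the terms there; higher up they carry an
    additional geometric factor. *)
Lemma expansion_tail (c : nat -> C) (kappa h t1 : R) (S : C -> C) :
  0 < h -> 0 < t1 ->
  (forall z, upper_half_plane z ->
     Clim (csum (fun n => c n * e (RtoC ((INR n + kappa) / h) * z))%C) (S z)) ->
  exists B, 0 < B /\
   (forall n, Cmod (c n) * exp (- (2 * PI * ((INR n + kappa) / h) * t1)) <= B) /\
   forall z n0, t1 < Im z ->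
    Cmod (S z - csum (fun n => c n * e (RtoC ((INR n + kappa) / h) * z))%C n0)
    <= B * exp (- (2 * PI * ((INR n0 + kappa) / h) * (Im z - t1)))
         / (1 - exp (- (2 * PI / h * (Im z - t1)))).
Proof.
  intros Hh Ht1 HS.
  assert (HPI := PI_RGT_0).
  destruct (Clim_terms_bounded _ _ (HS (0, t1) Ht1)) as [B [HB HBn]].
  assert (HI : forall a z, Im (RtoC a * z)%C = a * Im z) by (intros; apply im_scal_l).
  assert (HBn' : forall n, Cmod (c n) * exp (- (2 * PI * ((INR n + kappa) / h) * t1)) <= B).
  { intros n. specialize (HBn n). rewrite Cmod_mult, Cmod_e, HI in HBn. simpl in HBn.
    rewrite <- Rmult_assoc in HBn. exact HBn. }
  exists B. split; [auto|]. split; [auto|]. intros z n0 Hz.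
  assert (Hz' : upper_half_plane z) by (unfold upper_half_plane; lra).
  set (t := Im z) in *. set (q := exp (- (2 * PI / h * (t - t1)))).
  assert (Hq : 0 <= q < 1).
  { unfold q. split; [left; apply exp_pos|]. rewrite <- exp_0. apply exp_increasing.
    assert (0 < 2 * PI / h * (t - t1)); [|lra].
    apply Rmult_lt_0_compat; [apply Rdiv_lt_0_compat; lra|lra]. }
  apply (Clim_le _ _ _ _ n0 (HS z Hz')). intros n Hn.
  replace n with (n0 + (n - n0))%nat by lia. rewrite csum_split.
  replace (csum (fun n1 => c n1 * e (RtoC ((INR n1 + kappa) / h) * z))%C n0 +
    csum (fun i => c (n0 + i)%nat * e (RtoC ((INR (n0 + i) + kappa) / h) * z))%C (n - n0) -
    csum (fun n1 => c n1 * e (RtoC ((INR n1 + kappa) / h) * z))%C n0)%C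
  with (csum (fun i => c (n0 + i)%nat * e (RtoC ((INR (n0 + i) + kappa) / h) * z))%C (n - n0)) by ring.
  eapply Rle_trans; [apply Cmod_csum|].
  set (E := exp (- (2 * PI * ((INR n0 + kappa) / h) * (t - t1)))).
  assert (HE : 0 < E) by apply exp_pos.
  eapply Rle_trans.
  - apply (rsum_le _ (fun i => (B * E) * q ^ i)). intros i _.
    rewrite Cmod_mult, Cmod_e, HI. fold t.
    replace (- (2 * PI * ((INR (n0 + i) + kappa) / h * t))) with
      (- (2 * PI * ((INR (n0 + i) + kappa) / h) * t1) +
        (- (2 * PI * ((INR n0 + kappa) / h) * (t - t1)) + INR i * - (2 * PI / h * (t - t1))))
      by (rewrite plus_INR; field; lra).
    rewrite exp_plus, (exp_plus (- (2 * PI * ((INR n0 + kappa) / h) * (t - t1)))). fold E.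
    replace (exp (INR i * - (2 * PI / h * (t - t1)))) with (q ^ i).
    + rewrite <- Rmult_assoc, Rmult_assoc, (Rmult_assoc B E). rewrite <- (Rmult_assoc (Cmod _)).
      rewrite Rmult_assoc. rewrite <- Rmult_assoc.
      apply Rmult_le_compat_r; [|apply HBn'].
      apply Rmult_le_pos; [lra|]. apply pow_le. lra.
    + unfold q. rewrite <- Rpower_pow by apply exp_pos. unfold Rpower. rewrite ln_exp. reflexivity.
  - rewrite rsum_mult_l. unfold Rdiv. apply Rmult_le_compat_l; [nra|].
    now apply rsum_geometric_le.
Qed.

Lemma upper_half_point w : 1/2 <= Im w -> upper_half_plane w.
Proof. unfold upper_half_plane. lra. Qed.

Lemma exp_neg_lt_1 x : 0 < x -> exp (- x) < 1.
Proof. intros H. rewrite <- exp_0. apply exp_increasing. lra. Qed.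

Lemma exp_neg_le_inv x : 0 < x -> exp (- x) <= / x.
Proof.
  intros H. rewrite exp_Ropp. apply Rinv_le_contravar; [auto|].
  assert (K := exp_ineq1_le x). lra.
Qed.

Lemma cusp_expansion G r f s : holomorphic_at_cusp G r f s ->
  exists (h kappa : R) (c : nat -> C), 0 < h /\ 0 <= kappa /\
    forall z, upper_half_plane z ->
     Clim (csum (fun n => c n * e (RtoC ((INR n + kappa) / h) * z))%C) (slash r f s z).
Proof.
  intros (h & kappa & c & Hh & _ & Hk & H). exists (IZR h), kappa, c.
  split; [now apply IZR_lt|]. split; [lra|]. intros z Hz. apply is_series_Clim. now apply H.
Qed.

(** Terms with positive exponents decay exponentially, and an exponent 0 occurs at
    most in the constant term, which is the value at the cusp and so vanishes. *)
Lemma slash_exponential_decay G r f s :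
  holomorphic_at_cusp G r f s -> vanishes_at_cusp r f s ->
  exists K mu, 0 < K /\ 0 < mu /\
    forall w, 1/2 <= Im w -> Cmod (slash r f s w) <= K * exp (- (mu * Im w)).
Proof.
  intros Hs Hv. destruct (cusp_expansion _ _ _ _ Hs) as (h & kappa & c & Hh & Hk & HS).
  assert (HPI := PI_RGT_0).
  destruct (expansion_tail c kappa h (1/4) _ Hh ltac:(lra) HS) as (B & HB & _ & HT).
  set (q0 := exp (- (2 * PI / h * (1/4)))).
  assert (Hh2 : 0 < 2 * PI / h) by (apply Rdiv_lt_0_compat; lra).
  assert (Hq0 : q0 < 1) by (apply exp_neg_lt_1; nra).
  assert (Hden : forall w, 1/2 <= Im w ->
    / (1 - exp (- (2 * PI / h * (Im w - 1/4)))) <= / (1 - q0)).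
  { intros w Hw. apply Rinv_le_contravar; [lra|].
    assert (exp (- (2 * PI / h * (Im w - 1/4))) <= q0); [|lra].
    apply exp_le. nra. }
  assert (HT' : forall w n0, 1/2 <= Im w ->
    Cmod (slash r f s w - csum (fun n => c n * e (RtoC ((INR n + kappa) / h) * w))%C n0)
    <= B / (1 - q0) * exp (2 * PI * ((INR n0 + kappa) / h) * (1/4)) *
       exp (- (2 * PI * ((INR n0 + kappa) / h) * Im w))).
  { intros w n0 Hw. eapply Rle_trans; [apply HT; lra|].
    unfold Rdiv at 1. eapply Rle_trans.
    - apply Rmult_le_compat_l; [|apply Hden; auto].
      apply Rmult_le_pos; [lra|left; apply exp_pos].
    - right. unfold Rdiv. rewrite (Rmult_assoc (B * _)), <- exp_plus.
      replace (2 * PI * ((INR n0 + kappa) * / h) * (1 * / 4) + - (2 * PI * ((INR n0 + kappa) * / h) * Im w))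
        with (- (2 * PI * ((INR n0 + kappa) * / h) * (Im w - 1 * / 4))) by ring.
      ring. }
  assert (Hq1 : 0 < / (1 - q0)) by (apply Rinv_0_lt_compat; lra).
  destruct (Rle_lt_or_eq_dec _ _ Hk) as [Hk'|Hk'].
  - exists (B / (1 - q0) * exp (2 * PI * (kappa / h) * (1/4))), (2 * PI * (kappa / h)).
    split; [|split].
    + repeat apply Rmult_lt_0_compat; auto. apply exp_pos.
    + assert (0 < kappa / h) by (now apply Rdiv_lt_0_compat). nra.
    + intros w Hw. specialize (HT' w O Hw). simpl in HT'. rewrite Rplus_0_l in HT'.
      replace (slash r f s w - 0)%C with (slash r f s w) in HT' by ring. exact HT'.
  - subst kappa.
    set (K := B / (1 - q0) * exp (2 * PI * (1 / h) * (1/4))).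
    set (mu := 2 * PI * (1 / h)).
    assert (HK : 0 < K) by (repeat apply Rmult_lt_0_compat; auto; apply exp_pos).
    assert (Hmu : 0 < mu) by (unfold mu; assert (0 < 1 / h) by (apply Rdiv_lt_0_compat; lra); nra).
    assert (H1 : forall w, 1/2 <= Im w ->
      Cmod (slash r f s w - c O) <= K * exp (- (mu * Im w))).
    { intros w Hw. specialize (HT' w 1%nat Hw). simpl csum in HT'.
      simpl INR in HT'. rewrite !Rplus_0_r in HT'.
      replace (0 / h) with 0 in HT' by (unfold Rdiv; ring). rewrite Cmult_0_l, e_0 in HT'.
      replace (slash r f s w - (0 + c 0%nat * 1))%C with (slash r f s w - c O)%C in HT' by ring.
      exact HT'. }
    assert (Hc0 : c O = RtoC 0).
    { apply Cmod_eq_0_eps. intros eps He. assert (He2 : 0 < eps / 2) by lra.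
      destruct (Hv (mkposreal _ He2)) as [Y HY]. simpl in HY.
      set (t := Rmax 1 (Rmax (Y + 1) (2 * K / (eps * mu)))).
      assert (T1 := Rmax_l 1 (Rmax (Y + 1) (2 * K / (eps * mu)))).
      assert (T2 := Rmax_r 1 (Rmax (Y + 1) (2 * K / (eps * mu)))).
      assert (T3 := Rmax_l (Y + 1) (2 * K / (eps * mu))).
      assert (T4 := Rmax_r (Y + 1) (2 * K / (eps * mu))). fold t in T1, T2.
      specialize (H1 (0, t)). specialize (HY (0, t)). simpl in H1, HY.
      specialize (H1 ltac:(lra)). specialize (HY ltac:(unfold upper_half_plane; simpl; lra) ltac:(lra)).
      assert (Hmt : 0 < mu * t) by nra.
      assert (H2 : K * exp (- (mu * t)) <= eps / 2).
      { eapply Rle_trans; [apply Rmult_le_compat_l; [lra|apply exp_neg_le_inv; auto]|].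
        apply (Rmult_le_reg_r (mu * t)); [auto|]. rewrite Rmult_assoc, Rinv_l by lra.
        assert (H3 : 2 * K / (eps * mu) <= t) by lra.
        apply (Rmult_le_compat_r (eps * mu)) in H3; [|nra].
        unfold Rdiv in H3. rewrite Rmult_assoc, Rinv_l in H3 by nra. nra. }
      replace (c O) with (slash r f s (0, t) + - (slash r f s (0, t) - c O))%C by ring.
      eapply Rle_trans; [apply Cmod_triangle|]. rewrite Cmod_opp. lra. }
    exists K, mu. split; [auto|]. split; [auto|]. intros w Hw. specialize (H1 w Hw).
    rewrite Hc0 in H1. replace (slash r f s w - 0)%C with (slash r f s w) in H1 by ring. exact H1.
Qed.

Lemma petersson_bounded_at_cusp G r f s : cusp_form G r f -> SL2Z s ->
  exists B, forall w, 1/2 <= Im w -> petersson r f (moebius s w) <= B.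
Proof.
  intros [[_ [_ Hcusp]] Hv] Hs.
  destruct (slash_exponential_decay G r f s (Hcusp s Hs) (Hv s Hs)) as (K & mu & HK & Hmu & H).
  destruct (power_exp_bounded (r / 2) mu Hmu) as [B [HB HBt]].
  exists (K * B). intros w Hw.
  rewrite petersson_slash by (auto using upper_half_point).
  eapply Rle_trans; [apply Rmult_le_compat_l; [left; apply Rpower_pos|apply H; auto]|].
  specialize (HBt (Im w) Hw). apply (Rmult_le_compat_l K) in HBt; [|lra].
  eapply Rle_trans; [|exact HBt]. right. ring.
Qed.

Lemma least_nat (P : nat -> Prop) : (exists n, P n) ->
  exists n, P n /\ forall m, (m < n)%nat -> ~ P m.
Proof.
  intros [n Hn]. revert Hn. induction n as [n IH] using (well_founded_induction Wf_nat.lt_wf).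
  intros Hn. destruct (classic (exists m, (m < n)%nat /\ P m)) as [[m [Hm HPm]]|Hno].
  - exact (IH m Hm HPm).
  - exists n. split; [auto|]. intros m Hm HPm. apply Hno. eauto.
Qed.

(** High up in a cusp the leading term of the expansion dominates, so that there
    are no zeros beyond some height. *)
Lemma petersson_nonzero_at_cusp G r f s : cusp_form G r f -> SL2Z s ->
  (exists z, upper_half_plane z /\ f z <> RtoC 0) ->
  exists T0, forall T, T0 <= T ->
    0 < T /\ exists c, 0 < c /\ forall w, Im w = T -> c <= petersson r f (moebius s w).
Proof.
  intros [[_ [_ Hcusp]] Hv] Hs [z0 [Hz0 Hf0]].
  destruct (cusp_expansion _ _ _ _ (Hcusp s Hs)) as (h & kappa & c & Hh & Hk & HS).
  assert (HPI := PI_RGT_0).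
  destruct (expansion_tail c kappa h 1 _ Hh ltac:(lra) HS) as (B & HB & _ & HT).
  destruct (least_nat (fun n => c n <> RtoC 0)) as [n0 [Hn0 Hmin]].
  { apply NNPP. intros Hno. apply Hf0.
    assert (Hc : forall n, c n = RtoC 0).
    { intros n. apply NNPP. intros Hn. apply Hno. eauto. }
    set (w := moebius (M2Z_inv s) z0).
    assert (Hw : upper_half_plane w) by (apply upper_moebius; auto using SL2Z_inv).
    assert (Hsl : slash r f s w = RtoC 0).
    { apply Cmod_eq_0_eps. intros eps He. destruct (HS w Hw eps He) as [N HN].
      specialize (HN N (le_n N)). rewrite (csum_ext _ (fun _ => RtoC 0 * RtoC 0)%C) in HN.
      - rewrite csum_mult_l in HN. rewrite Cmod_minus_sym in HN.
        replace (slash r f s w - 0 * csum (fun _ => RtoC 0) N)%C with (slash r f s w) in HN by ring.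
        exact HN.
      - intros i _. rewrite Hc. ring. }
    unfold slash in Hsl. unfold w in Hsl at 2. rewrite moebius_inv_r in Hsl by auto.
    apply Cmod_eq_0. apply (f_equal Cmod) in Hsl.
    rewrite Cmod_mult, Cmod_Crpow, Cmod_0 in Hsl.
    apply Rmult_integral in Hsl. destruct Hsl as [Hsl|Hsl]; [|auto].
    assert (K := Rpower_pos (Cmod (j s w)) (- r)). lra. }
  set (lam := (INR n0 + kappa) / h).
  set (A := Cmod (c n0) * exp (- (2 * PI * lam * 1))).
  assert (HA : 0 < A).
  { apply Rmult_lt_0_compat; [now apply Cmod_gt_0|apply exp_pos]. }
  set (X := 2 + 4 * B / A).
  assert (HX : 2 <= X) by (unfold X; assert (0 < 4 * B / A) by (apply Rdiv_lt_0_compat; lra); lra).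
  exists (1 + h / (2 * PI) * X). intros T HTT.
  assert (Hh2 : 0 < h / (2 * PI)) by (apply Rdiv_lt_0_compat; lra).
  assert (HT1 : 1 < T) by nra.
  split; [lra|].
  set (q := exp (- (2 * PI / h * (T - 1)))).
  assert (Hqx : X <= 2 * PI / h * (T - 1)).
  { assert (K : h / (2 * PI) * X <= T - 1) by lra.
    apply (Rmult_le_compat_l (2 * PI / h)) in K; [|left; apply Rdiv_lt_0_compat; lra].
    replace (2 * PI / h * (h / (2 * PI) * X)) with X in K by (field; lra). exact K. }
  assert (Hq : q <= / X).
  { eapply Rle_trans; [apply exp_neg_le_inv; lra|]. apply Rinv_le_contravar; lra. }
  assert (Hqpos : 0 < q) by apply exp_pos.
  assert (HqX : q * X <= 1).
  { apply (Rmult_le_compat_r X) in Hq; [|lra]. rewrite Rinv_l in Hq by lra. exact Hq. }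
  assert (Hq2 : q <= 1/2) by nra.
  assert (HBq : B * q * 4 <= A).
  { assert (K : q * (4 * B / A) <= 1) by (unfold X in HqX; nra).
    apply (Rmult_le_compat_r A) in K; [|lra].
    replace (q * (4 * B / A) * A) with (B * q * 4) in K by (field; lra). lra. }
  set (E := exp (- (2 * PI * lam * (T - 1)))).
  assert (HE : 0 < E) by apply exp_pos.
  exists (Rpower T (r / 2) * (E * (A / 2))). split.
  { apply Rmult_lt_0_compat; [apply Rpower_pos|]. apply Rmult_lt_0_compat; lra. }
  intros w Hw. assert (Hwu : upper_half_plane w) by (unfold upper_half_plane; lra).
  rewrite petersson_slash, Hw by auto.
  apply Rmult_le_compat_l; [left; apply Rpower_pos|].
  specialize (HT w (S n0)). rewrite Hw in HT. specialize (HT HT1). fold q in HT.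
  rewrite csum_S in HT.
  rewrite (csum_ext _ (fun _ => RtoC 0 * RtoC 0)%C) in HT.
  2: { intros i Hi. assert (Hci : c i = RtoC 0) by (apply NNPP, Hmin, Hi). rewrite Hci. ring. }
  rewrite csum_mult_l in HT. fold lam in HT.
  set (L := (c n0 * e (RtoC lam * w))%C) in *.
  assert (HL : Cmod L = E * A).
  { unfold L. rewrite Cmod_mult, Cmod_e, im_scal_l, Hw. unfold E, A.
    rewrite Rmult_comm, Rmult_assoc, (Rmult_comm _ (exp _)), <- !Rmult_assoc, <- exp_plus.
    rewrite Rmult_comm. rewrite (Rmult_comm (exp _)). f_equal. f_equal. ring. }
  assert (HR : B * exp (- (2 * PI * ((INR (S n0) + kappa) / h) * (T - 1))) / (1 - q) <= E * (A / 2)).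
  { replace (exp (- (2 * PI * ((INR (S n0) + kappa) / h) * (T - 1)))) with (E * q).
    - unfold Rdiv at 1. assert (Hi : / (1 - q) <= 2).
      { replace 2 with (/ (1/2)) by field. apply Rinv_le_contravar; lra. }
      eapply Rle_trans; [apply Rmult_le_compat_l; [|exact Hi]|].
      + apply Rmult_le_pos; [lra|]. apply Rmult_le_pos; lra.
      + replace (B * (E * q) * 2) with (E * (B * q * 2)) by ring.
        apply Rmult_le_compat_l; lra.
    - unfold E, q, lam. rewrite <- exp_plus. f_equal. rewrite S_INR. field. lra. }
  assert (K := Cmod_triangle_inv L (slash r f s w - L)%C).
  replace (L + (slash r f s w - L))%C with (slash r f s w) in K by ring.
  replace (slash r f s w - (0 * csum (fun _ => RtoC 0) n0 + L))%C
    with (slash r f s w - L)%C in HT by ring.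
  lra.
Qed.

Lemma petersson_bounded_high G r f : congruence_group G -> cusp_form G r f ->
  exists B, 0 < B /\ forall s w, SL2Z s -> 1/2 <= Im w -> petersson r f (moebius s w) <= B.
Proof.
  intros [HG [N [HN HGN]]] Hf.
  destruct (class_uniform N (fun s B => forall w, 1/2 <= Im w -> petersson r f (moebius s w) <= B) HN)
    as [B HB].
  - intros s t B Hs Ht Hst H w Hw.
    rewrite <- (petersson_congruent G r f N s t w); auto using upper_half_point. apply Hf.
  - intros s Hs. destruct (petersson_bounded_at_cusp G r f s Hf Hs) as [B HB].
    exists B. intros B' HB' w Hw. specialize (HB w Hw). lra.
  - exists (Rmax B 1). split; [eapply Rlt_le_trans; [|apply Rmax_r]; lra|].
    intros s w Hs Hw. apply (HB (Rmax B 1)); auto. apply Rmax_l.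
Qed.

Lemma petersson_nonzero_on_horocycles G r f : congruence_group G -> cusp_form G r f ->
  (exists z, upper_half_plane z /\ f z <> RtoC 0) ->
  exists T c, 0 < T /\ 0 < c /\
    forall s w, SL2Z s -> Im w = T -> c <= petersson r f (moebius s w).
Proof.
  intros [HG [N [HN HGN]]] Hf Hf0.
  destruct (class_uniform N (fun s T => 0 < T /\ exists c, 0 < c /\
     forall w, Im w = T -> c <= petersson r f (moebius s w)) HN) as [T HT].
  - intros s t B Hs Ht Hst [HB [c [Hc H]]]. split; [auto|]. exists c. split; [auto|]. intros w Hw.
    rewrite <- (petersson_congruent G r f N s t w); auto. apply Hf.
    unfold upper_half_plane. lra.
  - intros s Hs. exact (petersson_nonzero_at_cusp G r f s Hf Hs Hf0).
  - specialize (HT T (Rle_refl T)).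
    assert (HT0 : 0 < T) by (apply (HT M2Z_one); reflexivity).
    (* with the height [T] fixed, the lower bound is written [exp (- B)] so as to
       be monotone in [B] *)
    destruct (class_uniform N (fun s B => forall w, Im w = T -> exp (- B) <= petersson r f (moebius s w)) HN)
      as [B HB].
    + intros s t B Hs Ht Hst H w Hw.
      rewrite <- (petersson_congruent G r f N s t w); auto. apply Hf.
      unfold upper_half_plane. lra.
    + intros s Hs. destruct (HT s Hs) as [_ [c [Hc H]]]. exists (- ln c). intros B' HB' w Hw.
      eapply Rle_trans; [|apply H; auto]. rewrite <- (exp_ln c) by auto. apply exp_le. lra.
    + exists T, (exp (- B)). repeat split; auto. { apply exp_pos. }
      intros s w Hs Hw. apply (HB B); auto. lra.
Qed.

(** * Size of a cusp form near the real line *)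

(** Every point is carried by [SL2Z] above height 1/2: a good rational
    approximation to the real part supplies the matrix. *)
Lemma cusp_form_bound G r f : congruence_group G -> cusp_form G r f ->
  exists M, 0 < M /\ forall x y, 0 < y -> Cmod (f (x, y)) <= M * Rpower y (- (r / 2)).
Proof.
  intros HG Hf. destruct (petersson_bounded_high G r f HG Hf) as [B [HB H]].
  exists B. split; [auto|]. intros x y Hy.
  assert (K : petersson r f (x, y) <= B).
  { assert (Hex : exists s, SL2Z s /\ 1/2 <= Im (moebius (M2Z_inv s) (x, y))).
    2: { destruct Hex as [s [Hs Him]]. rewrite <- (moebius_inv_r s (x, y)); auto. }
    destruct (Rle_lt_dec 1 y) as [H1|H1].
    - exists M2Z_one. split; [reflexivity|].
      rewrite Im_moebius; [|reflexivity|exact Hy].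
      unfold j. simpl. rewrite Cmult_0_l, Cplus_0_l, Cmod_1. simpl. lra.
    - destruct (nfloor_ex (/ sqrt y)) as [Q [HQ1 HQ2]].
      { left. apply Rinv_0_lt_compat. now apply sqrt_lt_R0. }
      assert (Hsy : 0 < sqrt y) by now apply sqrt_lt_R0.
      assert (Hsq : sqrt y * sqrt y = y) by (apply sqrt_sqrt; lra).
      assert (Hsy1 : sqrt y < 1) by nra.
      assert (HQ : (1 <= Q)%nat).
      { destruct Q; [|lia]. simpl in HQ2. rewrite Rplus_0_l in HQ2.
        assert (1 < / sqrt y) by (rewrite <- Rinv_1; apply Rinv_lt_contravar; lra). lra. }
      destruct (dirichlet x Q HQ) as (p & q & b & d & Hq & Hs & Hpq).
      exists (mkM2Z p b q d). split; [auto|].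
      rewrite Im_moebius; [|now apply SL2Z_inv|exact Hy].
      rewrite Cmod2_alt. unfold j. simpl Im. simpl Re. rewrite !opp_IZR.
      set (u := IZR q * x - IZR p) in *.
      replace (- IZR q * x - 0 * y + IZR p) with (- u) by (unfold u; ring).
      replace (- IZR q * y + 0 * x + 0) with (- (IZR q * y)) by ring.
      assert (Hu : u ^ 2 <= y).
      { assert (Hu1 : Rabs u <= sqrt y).
        { eapply Rle_trans; [exact Hpq|]. rewrite <- (Rinv_inv (sqrt y)).
          apply Rinv_le_contravar; [now apply Rinv_0_lt_compat|lra]. }
        rewrite <- (pow2_abs u). assert (K := Rabs_pos u). nra. }
      assert (Hv : (IZR q * y) ^ 2 <= y).
      { assert (Hq1 : 0 <= IZR q) by (apply IZR_le; lia).
        assert (Hq2 : IZR q <= / sqrt y).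
        { eapply Rle_trans; [|exact HQ1]. rewrite INR_IZR_INZ. apply IZR_le; lia. }
        assert (Hq3 : IZR q * y <= sqrt y).
        { rewrite <- Hsq at 1. rewrite <- Rmult_assoc.
          apply (Rmult_le_compat_r (sqrt y)) in Hq2; [|lra]. rewrite Rinv_l in Hq2 by lra. nra. }
        assert (0 <= IZR q * y) by nra. nra. }
      assert (Hq1 : 1 <= IZR q) by (apply IZR_le; lia).
      assert (Hqy : 0 < (IZR q * y) ^ 2) by (apply pow_lt; nra).
      assert (Hu2 : 0 <= u ^ 2) by apply pow2_ge_0.
      replace ((- u) ^ 2 + (- (IZR q * y)) ^ 2) with (u ^ 2 + (IZR q * y) ^ 2) by ring.
      set (den := u ^ 2 + (IZR q * y) ^ 2) in *.
      apply (Rmult_le_reg_r den); [unfold den; lra|].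
      unfold Rdiv. rewrite (Rmult_assoc y), Rinv_l by (unfold den; lra). unfold den. lra. }
  unfold petersson in K. simpl in K. rewrite Rpower_Ropp.
  assert (Hp := Rpower_pos y (r / 2)).
  apply (Rmult_le_reg_l (Rpower y (r / 2))); [auto|].
  rewrite <- Rmult_assoc, (Rmult_comm _ B), Rmult_assoc, Rinv_r by lra. lra.
Qed.

(** The bound of [cusp_form_bound] is sharp over irrational points.  A matrix
    with first column [(p, q)] sends a point at height [T] to
    [p / q + i / (T q ^ 2)], which lies in a fixed cone over [x0] as soon as
    [|x0 - p / q| <= 1 / q ^ 2]. *)
Lemma cusp_form_large G r f : congruence_group G -> cusp_form G r f ->
  (exists z, upper_half_plane z /\ f z <> RtoC 0) ->
  exists T c, 0 < T /\ 0 < c /\ forall x0, irrational x0 -> forall eta, 0 < eta ->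
    exists x y, 0 < y < eta /\ Rabs (x - x0) <= T * y /\
      c * Rpower y (- (r / 2)) <= Cmod (f (x, y)).
Proof.
  intros HG Hf Hf0.
  destruct (petersson_nonzero_on_horocycles G r f HG Hf Hf0) as (T & c & HT & Hc & H).
  exists T, c. split; [auto|]. split; [auto|]. intros x0 Hx0 eta Heta.
  destruct (INR_unbounded (/ (T * eta))) as [K HK].
  destruct (irrational_small_denominators x0 Hx0 K) as [d0 [Hd0 Hsmall]].
  destruct (INR_unbounded (/ d0)) as [Q HQ].
  destruct (dirichlet x0 (S Q)) as (p & q & b & d & Hq & Hs & Hpq); [lia|].
  set (D := INR (S Q) + 1) in *.
  assert (HDQ : INR Q < D) by (unfold D; rewrite S_INR; lra).
  assert (HD : 1 <= D) by (unfold D; assert (W := pos_INR (S Q)); lra).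
  assert (HqK : (Z.of_nat K < q)%Z).
  { destruct (Z_lt_le_dec (Z.of_nat K) q) as [L|L]; [auto|]. exfalso.
    specialize (Hsmall p q ltac:(lia)).
    assert (/ D < d0).
    { rewrite <- (Rinv_inv d0). apply Rinv_lt_contravar; [|lra].
      apply Rmult_lt_0_compat; [now apply Rinv_0_lt_compat|lra]. }
    lra. }
  assert (Hq1 : 1 <= IZR q) by (apply IZR_le; lia).
  assert (HqK' : / (T * eta) < IZR q).
  { apply IZR_lt in HqK. rewrite <- INR_IZR_INZ in HqK. lra. }
  set (w := (- IZR d / IZR q, T) : C).
  assert (Hw : upper_half_plane w) by exact HT.
  assert (Hmw : moebius (mkM2Z p b q d) w = (IZR p / IZR q, / (T * IZR q ^ 2))).
  { unfold moebius. simpl m11; simpl m12; simpl m21; simpl m22.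
    assert (Hdet : IZR p * IZR d - IZR b * IZR q = 1).
    { unfold SL2Z in Hs. simpl in Hs. rewrite <- !mult_IZR, <- minus_IZR. now rewrite Hs. }
    assert (Hden : (RtoC (IZR q) * w + RtoC (IZR d))%C = (0, IZR q * T)).
    { apply C_ext; unfold w; simpl; field; lra. }
    rewrite Hden.
    assert (Hnz : ((0, IZR q * T) : C) <> RtoC 0).
    { intros E. apply (f_equal Im) in E. simpl in E. nra. }
    assert (Hn : (RtoC (IZR p) * w + RtoC (IZR b))%C =
      (((IZR p / IZR q)%R, (/ (T * IZR q ^ 2))%R) * (0%R, (IZR q * T)%R))%C).
    { apply C_ext; unfold w; simpl.
      - replace (IZR b) with ((IZR p * IZR d - 1) / IZR q) by (rewrite <- Hdet; field; lra).
        field. lra.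
      - field. lra. }
    rewrite Hn. unfold Cdiv. rewrite <- Cmult_assoc, Cinv_r by auto. ring. }
  set (y := / (T * IZR q ^ 2)).
  assert (HTq : 0 < T * IZR q ^ 2) by (apply Rmult_lt_0_compat; [auto|apply pow_lt; lra]).
  assert (Hy : 0 < y) by (now apply Rinv_0_lt_compat).
  exists (IZR p / IZR q), y. split; [|split].
  - split; [auto|]. unfold y. rewrite <- (Rinv_inv eta). apply Rinv_lt_contravar.
    + apply Rmult_lt_0_compat; [now apply Rinv_0_lt_compat|auto].
    + apply (Rmult_lt_compat_l T) in HqK'; [|auto].
      replace (T * / (T * eta)) with (/ eta) in HqK' by (field; lra). nra.
  - replace (IZR p / IZR q - x0) with (- ((IZR q * x0 - IZR p) / IZR q)) by (field; lra).
    rewrite Rabs_Ropp. unfold Rdiv. rewrite Rabs_mult, (Rabs_right (/ _)).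
    2: { apply Rle_ge. left. apply Rinv_0_lt_compat. lra. }
    replace (T * y) with (/ IZR q * / IZR q) by (unfold y; field; lra).
    apply Rmult_le_compat_r; [left; apply Rinv_0_lt_compat; lra|].
    eapply Rle_trans; [exact Hpq|]. apply Rinv_le_contravar; [lra|].
    assert (IZR q <= INR (S Q)) by (rewrite INR_IZR_INZ; apply IZR_le; lia).
    unfold D. lra.
  - specialize (H (mkM2Z p b q d) w Hs eq_refl). rewrite Hmw in H.
    fold y in H. unfold petersson in H. simpl Im in H. rewrite Rpower_Ropp.
    assert (Hp := Rpower_pos y (r / 2)).
    apply (Rmult_le_reg_l (Rpower y (r / 2))); [auto|].
    rewrite <- Rmult_assoc, (Rmult_comm _ c), Rmult_assoc, Rinv_r by lra. lra.
Qed.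

(** * Partial sums of the Fourier series *)

Lemma sin_PI_lower v : Rabs v <= 3/4 -> Rabs v / 2 <= Rabs (sin (PI * v)).
Proof.
  assert (HPI := PI_RGT_0). assert (HPI3 : 3 < PI) by (assert (K := PI2_3_2); lra).
  assert (Hpos : forall v, 0 <= v <= 3/4 -> v / 2 <= sin (PI * v)).
  { clear v. intros v Hv. destruct (Rle_dec v (1/3)) as [H|H].
    - destruct (MVT_derive sin cos 0 (PI * v)) as [c [Hc Hs]].
      + nra.
      + intros x _. apply is_derive_Reals, derivable_pt_lim_sin.
      + rewrite sin_0, !Rminus_0_r in Hs. rewrite Hs.
        assert (Hcos : 1/2 <= cos c).
        { rewrite <- cos_PI3. apply cos_decr_1; nra. }
        assert (v <= cos c * (PI * v)); [|lra].
        assert (1 <= cos c * PI) by nra. nra.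
    - assert (Hh : 1/2 <= sin (PI * v)); [|lra].
      replace (1/2) with (sin (PI / 6)) by (apply sin_PI6).
      destruct (Rle_dec v (1/2)) as [H2|H2].
      + apply sin_incr_1; nra.
      + rewrite <- (sin_PI_x (PI * v)). apply sin_incr_1; nra. }
  intros Hv. destruct (Rle_dec 0 v) as [H|H].
  - rewrite (Rabs_right v) in * by lra. specialize (Hpos v ltac:(lra)).
    rewrite Rabs_right; lra.
  - rewrite (Rabs_left v) in * by lra. specialize (Hpos (- v) ltac:(lra)).
    replace (PI * - v) with (- (PI * v)) in Hpos by ring. rewrite sin_neg in Hpos.
    rewrite Rabs_left1; lra.
Qed.

(** With [rho = |e(v + i y)|] one has
    [|1 - e(v + i y)| ^ 2 = (1 - rho) ^ 2 + 4 rho sin (PI v) ^ 2]; the first square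
    controls [y], the second [v].  The range [|v| <= 3/4] exceeds half a period in
    order to leave room for a small translation. *)
Lemma one_minus_e_lower : exists c, 0 < c <= 1/2 /\ forall v y,
  Rabs v <= 3/4 -> 0 <= y <= 1 -> c * (Rabs v + y) <= Cmod (1 - e (v, y))%C.
Proof.
  assert (HPI := PI_RGT_0). assert (HPI3 : 3 < PI) by (assert (K := PI2_3_2); lra).
  exists (exp (- PI) / 2). assert (He := exp_pos (- PI)).
  assert (He1 : exp (- PI) < 1) by now apply exp_neg_lt_1.
  assert (He2 : exp (- PI) <= 1/2).
  { eapply Rle_trans; [apply exp_neg_le_inv; auto|].
    replace (1/2) with (/ 2) by field. apply Rinv_le_contravar; lra. }
  split; [lra|]. intros v y Hv Hy.
  set (rho := exp (- (2 * PI * y))).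
  assert (H1 : y / 2 <= Cmod (1 - e (v, y))%C).
  { assert (K := Cmod_triangle_inv 1 (- e (v, y))%C). rewrite Cmod_opp, Cmod_1, Cmod_e in K.
    simpl Im in K. fold rho in K.
    replace (1 + - e (v, y))%C with (1 - e (v, y))%C in K by ring.
    assert (Hr : rho <= / (1 + 2 * PI * y)).
    { unfold rho. rewrite exp_Ropp. apply Rinv_le_contravar; [nra|]. apply exp_ineq1_le. }
    assert (Hr2 : rho * (1 + 2 * PI * y) <= 1).
    { apply (Rmult_le_compat_r (1 + 2 * PI * y)) in Hr; [|nra]. rewrite Rinv_l in Hr by nra. auto. }
    assert (Hpy : PI * y <= 4) by (assert (K4 := PI_4); nra).
    assert (0 < rho) by apply exp_pos.
    assert (y / 2 <= 1 - rho); [|lra].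
    assert (1 - y / 2 >= rho); [|lra]. apply Rle_ge.
    apply (Rmult_le_reg_r (1 + 2 * PI * y)); [nra|].
    eapply Rle_trans; [exact Hr2|]. nra. }
  assert (H2 : exp (- PI) * Rabs v <= Cmod (1 - e (v, y))%C).
  { set (s := exp (- (PI * y))).
    assert (Hs : rho = s * s) by (unfold rho, s; rewrite <- exp_plus; f_equal; ring).
    assert (Hs1 : exp (- PI) <= s) by (apply exp_le; nra).
    eapply Rle_trans with (2 * s * Rabs (sin (PI * v))).
    - assert (K := sin_PI_lower v Hv). assert (K2 := Rabs_pos v). nra.
    - apply Rsqr_incr_0_var; [|apply Cmod_ge_0].
      unfold Rsqr. replace (Cmod (1 - e (v, y))%C * Cmod (1 - e (v, y))%C)
        with (Cmod (1 - e (v, y))%C ^ 2) by ring.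
      rewrite Cmod2_alt, e_polar. simpl Re. simpl Im. fold rho.
      set (sn := sin (PI * v)). replace (2 * PI * v) with (2 * (PI * v)) by ring.
      rewrite cos_2a_sin, sin_2a. fold sn. set (cn := cos (PI * v)).
      assert (Hsc : sn * sn + cn * cn = 1) by (apply (sin2_cos2 (PI * v))).
      replace (2 * s * Rabs sn * (2 * s * Rabs sn)) with (4 * (s * s) * (Rabs sn * Rabs sn)) by ring.
      rewrite <- Rabs_mult, (Rabs_right (sn * sn)) by nra. rewrite <- Hs.
      replace ((1 + - (rho * (1 - 2 * sn * sn))) ^ 2 + (0 + - (rho * (2 * sn * cn))) ^ 2)
        with ((1 - rho) ^ 2 + 4 * rho * (sn * sn) + 4 * rho ^ 2 * (sn * sn) * (sn * sn + cn * cn - 1))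
        by ring.
      rewrite Hsc. assert (0 <= (1 - rho) ^ 2) by apply pow2_ge_0. nra. }
  assert (exp (- PI) * y <= y / 2) by nra.
  lra.
Qed.

Definition dirichlet_kernel (n : nat) (t : R) : C :=
  csum (fun i => e (RtoC (- INR (S i) * t))) n.

(** The trivial bound [n] and the bound [2 / |1 - e(- t)|] for a geometric sum,
    merged into a single continuous majorant. *)
Lemma dirichlet_kernel_bound : exists K, 0 < K /\ forall N n t, (1 <= N)%nat -> (n <= N)%nat ->
  Rabs t <= 1/2 -> Cmod (dirichlet_kernel n t) <= K / (Rabs t + / INR N).
Proof.
  destruct one_minus_e_lower as [c [Hc H]]. exists (4 / c). split; [apply Rdiv_lt_0_compat; lra|].
  intros N n t HN Hn Ht. set (y := / INR N).
  assert (HN1 : 1 <= INR N) by (apply (le_INR 1); lia).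
  assert (Hy : 0 < y) by (apply Rinv_0_lt_compat; lra).
  assert (Hty := Rabs_pos t).
  apply (Rmult_le_reg_r (Rabs t + y)); [lra|].
  replace (4 / c / (Rabs t + y) * (Rabs t + y)) with (4 / c) by (field; lra).
  assert (H4c : 4 <= 4 / c).
  { apply (Rmult_le_reg_r c); [lra|]. unfold Rdiv. rewrite Rmult_assoc, Rinv_l by lra. lra. }
  destruct (Rle_dec (Rabs t) y) as [Hle|Hgt].
  - assert (H1 : Cmod (dirichlet_kernel n t) <= INR N).
    { eapply Rle_trans; [apply Cmod_csum|]. eapply Rle_trans.
      - apply (rsum_le _ (fun _ => 1)). intros i _. rewrite Cmod_e_R. lra.
      - rewrite rsum_const, Rmult_1_r. now apply le_INR. }
    assert (Hyn : INR N * y = 1) by (apply Rinv_r; lra).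
    assert (INR N * Rabs t <= 1) by nra.
    assert (K0 := Cmod_ge_0 (dirichlet_kernel n t)). nra.
  - set (w := e (RtoC (- t))).
    assert (HD : ((1 - w) * dirichlet_kernel n t = w * (1 - w ^ n))%C).
    { unfold dirichlet_kernel. rewrite (csum_ext _ (fun i => w * w ^ i)%C).
      - rewrite csum_mult_l, Cmult_assoc, (Cmult_comm (1 - w)), <- Cmult_assoc.
        f_equal. apply csum_geometric.
      - intros i _. rewrite <- Cpow_S. unfold w. rewrite <- e_INR, <- RtoC_mult.
        f_equal. f_equal. ring. }
    apply (f_equal Cmod) in HD. rewrite !Cmod_mult in HD.
    assert (Hw : Cmod w = 1) by apply Cmod_e_R. rewrite Hw in HD.
    assert (H2 : Cmod (1 - w ^ n)%C <= 2).
    { unfold Cminus. eapply Rle_trans; [apply Cmod_triangle|].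
      rewrite Cmod_opp, Cmod_1, Cmod_pow, Hw, pow1. lra. }
    assert (H3 : c * (Rabs t + 0) <= Cmod (1 - w)%C).
    { rewrite <- (Rabs_Ropp t). apply H; [rewrite Rabs_Ropp; lra|lra]. }
    assert (K0 := Cmod_ge_0 (dirichlet_kernel n t)).
    set (X := Cmod (dirichlet_kernel n t)) in *.
    assert (H5 : c * Rabs t * X <= 2) by nra.
    apply (Rmult_le_reg_l c); [lra|]. replace (c * (4 / c)) with 4 by (field; lra). nra.
Qed.

Definition fourier_expansion (A : nat -> C) (f : C -> C) : Prop :=
  forall z, upper_half_plane z ->
    Clim (csum (fun i => A i * e (RtoC (INR (S i)) * z))%C) (f z).

Lemma uniform_fourier_horizontal A f x y : fourier_expansion A f -> 0 < y ->
  uniform_fourier (fun i => A i * e (RtoC (INR (S i)) * (x, y)))%C (fun t => f (x + t, y)).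
Proof.
  intros HA Hy eps He. assert (HPI := PI_RGT_0).
  destruct (expansion_tail A 1 1 (y / 2) f Rlt_0_1 ltac:(lra)) as (B & HB & _ & HT).
  { intros z Hz eps' He'. destruct (HA z Hz eps' He') as [N HN]. exists N. intros n Hn.
    rewrite (csum_ext _ (fun i => A i * e (RtoC (INR (S i)) * z))%C); [auto|].
    intros i _. rewrite Rdiv_1_r, S_INR. reflexivity. }
  set (q := exp (- (2 * PI / 1 * (y - y / 2)))).
  assert (Hq : q < 1) by (apply exp_neg_lt_1; nra).
  destruct (power_exp_lim 0 (PI * y) ltac:(nra) (eps * (1 - q) / B)) as [N [HN1 HN]].
  { apply Rdiv_lt_0_compat; [nra|auto]. }
  exists N. intros M t HM.
  specialize (HT (x + t, y) M ltac:(simpl; lra)). simpl Im in HT. fold q in HT.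
  unfold fourier_sum.
  rewrite (csum_ext _ (fun n => A n * e (RtoC ((INR n + 1) / 1) * ((x + t)%R, y)))%C).
  - eapply Rle_trans; [exact HT|]. specialize (HN M HM).
    rewrite Rpower_O, Rmult_1_l in HN by (apply (lt_INR 0); lia).
    apply (Rmult_le_reg_r (1 - q)); [lra|]. unfold Rdiv. rewrite (Rmult_assoc (B * _)), Rinv_l, Rmult_1_r by lra.
    apply Rle_trans with (B * exp (- (PI * y * INR M))).
    + apply Rmult_le_compat_l; [lra|]. apply exp_le. assert (0 <= INR M) by apply pos_INR. nra.
    + apply (Rmult_le_compat_l B) in HN; [|lra].
      replace (B * (eps * (1 - q) / B)) with (eps * (1 - q)) in HN by (field; lra). exact HN.
  - intros i _. rewrite Rdiv_1_r, <- S_INR, <- Cmult_assoc, <- e_plus. f_equal. f_equal.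
    apply C_ext; simpl; ring.
Qed.

Definition partial_sums_bounded (A : nat -> C) (rho : R) : Prop :=
  exists K, 0 < K /\ forall N x, (1 <= N)%nat ->
    Cmod (fourier_sum A N x) <= K * Rpower (INR N) rho.

(** Partial sums of order [N] are read off at height [1/N] with the Dirichlet
    kernel; the damping factors [exp (- 2 PI n / N)], monotone and bounded below for
    [n <= N], are removed by summation by parts. *)
Lemma cusp_form_partial_sums A f M r rho :
  fourier_expansion A f -> 0 < M ->
  (forall x y, 0 < y -> Cmod (f (x, y)) <= M * Rpower y (- (r / 2))) ->
  r / 2 < rho -> partial_sums_bounded A rho.
Proof.
  intros HA HM Hf Hrho. set (eps := rho - r / 2). assert (Heps : 0 < eps) by (unfold eps; lra).
  assert (HPI := PI_RGT_0).
  destruct dirichlet_kernel_bound as [K [HK HD]].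
  set (A1 := M * K * Rpower 2 eps).
  assert (HA1 : 0 < A1) by (repeat apply Rmult_lt_0_compat; auto; apply Rpower_pos).
  set (B := 4 * A1 / eps).
  assert (HB : 0 < B) by (apply Rdiv_lt_0_compat; lra).
  exists (B * (2 * exp (2 * PI))). split.
  { apply Rmult_lt_0_compat; [auto|]. assert (Q := exp_pos (2 * PI)). lra. }
  intros N x HN. set (y := / INR N).
  assert (HN1 : 1 <= INR N) by (apply (le_INR 1); lia).
  assert (Hy : 0 < y) by (apply Rinv_0_lt_compat; lra).
  assert (Hy1 : y <= 1) by (rewrite <- Rinv_1; apply Rinv_le_contravar; lra).
  assert (HNy : INR N * y = 1) by (apply Rinv_r; lra).
  set (c := fun i => (A i * e (RtoC (INR (S i)) * (x, y)))%C).
  assert (Hh := uniform_fourier_horizontal A f x y HA Hy). fold c in Hh.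
  assert (HT : forall n, (n <= N)%nat -> Cmod (csum c n) <= B * Rpower (INR N) rho).
  { intros n Hn.
    assert (Hc := uniform_fourier_cont _ _ Hh).
    rewrite (csum_ext c (fun i => Cint (fun t => f ((x + t)%R, y) * e (RtoC (- INR (S i) * t)))%C)).
    2: { intros i _. symmetry. now apply uniform_fourier_coef. }
    rewrite <- (Cint_csum (fun i t => f ((x + t)%R, y) * e (RtoC (- INR (S i) * t)))%C).
    2: { intros i. apply Ccont_mult; [auto|apply Ccont_e]. }
    rewrite (Cint_ext _ (fun t => f ((x + t)%R, y) * dirichlet_kernel n t)%C).
    2: { intros t. apply csum_mult_l. }
    assert (Hyr : 0 < Rpower y (- (r / 2))) by apply Rpower_pos.
    eapply Rle_trans; [apply (Cint_power_bound _ (A1 * Rpower y (- (r / 2))) 0 eps y)|].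
    - apply Ccont_mult; [auto|]. apply (Ccont_csum (fun i t => e (RtoC (- INR (S i) * t)))).
      intros i. apply Ccont_e.
    - auto.
    - auto.
    - nra.
    - intros u Hu. assert (Hu1 : Rabs u <= 1/2) by (apply Rabs_le; lra).
      assert (Hu0 := Rabs_pos u). rewrite Rplus_0_r, Cmod_mult.
      assert (H1 := Hf (x + u) y Hy). assert (H2 := HD N n u HN Hn Hu1). fold y in H2.
      assert (H3 : / (Rabs u + y) <= Rpower 2 eps * Rpower (Rabs u + y) (- eps - 1)).
      { rewrite <- (Rpower_1 (Rabs u + y)) at 1 by lra. rewrite <- Rpower_Ropp.
        replace (- (1)) with (eps + (- eps - 1)) by ring.
        rewrite Rpower_plus. apply Rmult_le_compat_r; [left; apply Rpower_pos|].
        apply Rle_Rpower_l; lra. }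
      apply Rle_trans with ((M * Rpower y (- (r / 2))) * (K * (Rpower 2 eps * Rpower (Rabs u + y) (- eps - 1)))).
      + apply Rmult_le_compat; try apply Cmod_ge_0; auto.
        eapply Rle_trans; [exact H2|]. unfold Rdiv. apply Rmult_le_compat_l; lra.
      + right. unfold A1. ring.
    - rewrite Rmult_0_r, Rplus_0_r. right. unfold B.
      replace (Rpower (INR N) rho) with (Rpower y (- (r / 2)) * Rpower y (- eps)).
      + unfold Rdiv. ring.
      + rewrite <- Rpower_plus. unfold y. rewrite Rpower_inv_l by lra. f_equal. unfold eps. ring. }
  set (w := fun i => exp (2 * PI * y * INR (S i))).
  assert (Hw : forall i, w i <= w (S i)).
  { intros i. apply exp_le. rewrite (S_INR (S i)). nra. }
  destruct N as [|m]; [lia|].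
  replace (fourier_sum A (S m) x) with (csum (fun i => c i * RtoC (w i))%C (S m)).
  - eapply Rle_trans; [apply (abel_bound c w (fun _ => B * Rpower (INR (S m)) rho))|].
    + intros k Hk. apply HT. lia.
    + rewrite rsum_mult_l.
      rewrite (rsum_ext _ (fun i => w (S i) - w i)).
      2: { intros i _. apply Rabs_right. specialize (Hw i). lra. }
      rewrite rsum_telescope. rewrite Rabs_right by (apply Rle_ge; left; apply exp_pos).
      assert (W0 : 0 < w O) by apply exp_pos.
      assert (Wm : w m = exp (2 * PI)).
      { unfold w. f_equal. rewrite Rmult_assoc, (Rmult_comm y), HNy. ring. }
      rewrite Wm. assert (P := Rpower_pos (INR (S m)) rho). assert (0 < B * Rpower (INR (S m)) rho) by nra.
      nra.
  - unfold fourier_sum. apply csum_ext. intros i _. unfold c, w.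
    rewrite <- Cmult_assoc. f_equal. rewrite !e_polar. apply C_ext; simpl Re; simpl Im.
    + rewrite !Rmult_0_r, Ropp_0, exp_0. 
      set (n := INR (S i)). change (match i with O => 1 | S _ => INR i + 1 end) with n.
      replace (n * x - 0 * y) with (n * x) by ring.
      replace (n * y + 0 * x) with (n * y) by ring.
      rewrite (Rmult_comm _ (exp (2 * PI * y * n))), <- Rmult_assoc, <- exp_plus.
      replace (2 * PI * y * n + - (2 * PI * (n * y))) with 0 by ring. rewrite exp_0.
      ring.
    + rewrite !Rmult_0_r, Ropp_0, exp_0. 
      set (n := INR (S i)). change (match i with O => 1 | S _ => INR i + 1 end) with n.
      replace (n * x - 0 * y) with (n * x) by ring.
      replace (n * y + 0 * x) with (n * y) by ring. rewrite Rplus_0_l.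
      rewrite (Rmult_comm _ (exp (2 * PI * y * n))), <- Rmult_assoc, <- exp_plus.
      replace (2 * PI * y * n + - (2 * PI * (n * y))) with 0 by ring. rewrite exp_0.
      ring.
Qed.

(** * The weighted series *)

Definition weighted (A : nat -> C) (alpha : R) (i : nat) : C :=
  (A i * RtoC (Rpower (INR (S i)) (- alpha)))%C.

Definition frac_series (A : nat -> C) (alpha x : R) : C :=
  CSeries (fun i => weighted A alpha i * e (RtoC (INR (S i) * x)))%C.

Lemma INR_S_ge_1 i : 1 <= INR (S i).
Proof. apply (le_INR 1). lia. Qed.

Lemma weighted_block A alpha M N x :
  (fourier_sum (weighted A alpha) (M + N) x - fourier_sum (weighted A alpha) M x)%C =
  csum (fun i => A (M + i)%nat * e (RtoC (INR (S (M + i)) * x)) *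
                 RtoC (Rpower (INR (S (M + i))) (- alpha)))%C N.
Proof.
  unfold fourier_sum. rewrite csum_split.
  rewrite (csum_ext (fun i => A (M + i)%nat * e (RtoC (INR (S (M + i)) * x)) *
                 RtoC (Rpower (INR (S (M + i))) (- alpha)))%C
    (fun i => weighted A alpha (M + i) * e (RtoC (INR (S (M + i)) * x)))%C).
  - ring.
  - intros i _. unfold weighted. ring.
Qed.

(** Here and in [weighted_growth] summation by parts leaves the sum of
    [n ^ rho * n ^ (- alpha - 1)], governed by the lower end of the range when
    [rho < alpha] and by the upper end when [alpha < rho]. *)
Lemma weighted_tail A rho alpha : 0 <= rho < alpha -> partial_sums_bounded A rho ->
  exists K, 0 < K /\ forall M N x, (1 <= M)%nat ->
    Cmod (fourier_sum (weighted A alpha) (M + N) x - fourier_sum (weighted A alpha) M x)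
    <= K * Rpower (INR M) (rho - alpha).
Proof.
  intros Hr [K [HK HA]].
  destruct (power_increment_bound (- alpha)) as [K1 [HK1 H1]].
  destruct (power_sum_neg (rho - alpha) ltac:(lra)) as [K2 [HK2 H2]].
  assert (HK12 : 0 <= K1 * K2) by (now apply Rmult_le_pos).
  assert (HKK : 0 < 2 * K * (1 + K1 * K2)) by (apply Rmult_lt_0_compat; lra).
  exists (2 * K * (1 + K1 * K2)). split; [auto|].
  intros M N x HM. rewrite weighted_block.
  assert (HM1 : 1 <= INR M) by (apply (le_INR 1); lia).
  assert (HP := Rpower_pos (INR M) (rho - alpha)).
  destruct N as [|m].
  { simpl csum. rewrite Cmod_0. apply Rmult_le_pos; lra. }
  set (tau := fun i => (A (M + i)%nat * e (RtoC (INR (S (M + i)) * x)))%C).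
  set (w := fun i => Rpower (INR (S (M + i))) (- alpha)).
  set (B := fun k => 2 * K * Rpower (INR (S (M + k))) rho).
  assert (Hdec : forall k, Rpower (INR (S (M + k))) (rho - alpha) <= Rpower (INR M) (rho - alpha)).
  { intros k. apply Rpower_antitone; [|lra]. split; [lra|]. apply le_INR. lia. }
  eapply Rle_trans; [apply (abel_bound tau w B)|].
  - intros k _. assert (E : csum tau (S k) = (fourier_sum A (M + S k) x - fourier_sum A M x)%C).
    { unfold fourier_sum. rewrite csum_split. unfold tau. ring. }
    rewrite E. unfold Cminus. eapply Rle_trans; [apply Cmod_triangle|]. rewrite Cmod_opp.
    assert (Q1 := HA (M + S k)%nat x ltac:(lia)). assert (Q2 := HA M x HM).
    assert (Q3 : Rpower (INR M) rho <= Rpower (INR (M + S k)) rho).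
    { apply Rle_Rpower_l; [lra|]. split; [lra|]. apply le_INR. lia. }
    unfold B. replace (S (M + k)) with (M + S k)%nat by lia. nra.
  - assert (T1 : B m * Rabs (w m) <= 2 * K * Rpower (INR M) (rho - alpha)).
    { unfold B, w. rewrite Rabs_right by (apply Rle_ge; left; apply Rpower_pos).
      rewrite Rmult_assoc, <- Rpower_plus. apply Rmult_le_compat_l; [lra|]. apply Hdec. }
    assert (T2 : rsum (fun i => B i * Rabs (w (S i) - w i)) m
                 <= 2 * K * K1 * (K2 * Rpower (INR M) (rho - alpha))).
    { eapply Rle_trans.
      - apply (rsum_le _ (fun i => 2 * K * K1 * Rpower (INR (S M + i)) (rho - alpha - 1))).
        intros i _. unfold B, w. replace (M + S i)%nat with (S (M + i)) by lia.
        rewrite (S_INR (S (M + i))). specialize (H1 (INR (S (M + i))) (INR_S_ge_1 _)).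
        replace (S M + i)%nat with (S (M + i)) by lia.
        apply Rle_trans with (2 * K * Rpower (INR (S (M + i))) rho *
                              (K1 * Rpower (INR (S (M + i))) (- alpha - 1))).
        + apply Rmult_le_compat_l; [|exact H1].
          apply Rmult_le_pos; [lra|left; apply Rpower_pos].
        + right. replace (rho - alpha - 1) with (rho + (- alpha - 1)) by ring.
          rewrite (Rpower_plus rho). ring.
      - rewrite rsum_mult_l. apply Rmult_le_compat_l; [nra|].
        eapply Rle_trans; [apply (H2 (S M) m); lia|]. apply Rmult_le_compat_l; [auto|].
        specialize (Hdec O). rewrite Nat.add_0_r in Hdec. exact Hdec. }
    lra.
Qed.

Lemma weighted_growth A rho alpha : alpha < rho -> 0 <= rho -> partial_sums_bounded A rho ->
  partial_sums_bounded (weighted A alpha) (rho - alpha).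
Proof.
  intros Hr Hr0 [K [HK HA]].
  destruct (power_increment_bound (- alpha)) as [K1 [HK1 H1]].
  destruct (power_sum_pos (rho - alpha) ltac:(lra)) as [K2 [HK2 H2]].
  assert (HK12 : 0 <= K1 * K2) by (now apply Rmult_le_pos).
  assert (HKK : 0 < K * (1 + K1 * K2)) by (apply Rmult_lt_0_compat; lra).
  exists (K * (1 + K1 * K2)). split; [auto|].
  intros N x HN. destruct N as [|m]; [lia|].
  set (tau := fun i => (A i * e (RtoC (INR (S i) * x)))%C).
  set (w := fun i => Rpower (INR (S i)) (- alpha)).
  set (B := fun k => K * Rpower (INR (S k)) rho).
  replace (fourier_sum (weighted A alpha) (S m) x) with (csum (fun i => tau i * RtoC (w i))%C (S m)).
  2: { apply csum_ext. intros i _. unfold tau, w, weighted. ring. }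
  eapply Rle_trans; [apply (abel_bound tau w B)|].
  - intros k _. apply (HA (S k) x). lia.
  - assert (T1 : B m * Rabs (w m) = K * Rpower (INR (S m)) (rho - alpha)).
    { unfold B, w. rewrite Rabs_right by (apply Rle_ge; left; apply Rpower_pos).
      rewrite Rmult_assoc, <- Rpower_plus. reflexivity. }
    assert (T2 : rsum (fun i => B i * Rabs (w (S i) - w i)) m
                 <= K * K1 * (K2 * Rpower (INR (S m)) (rho - alpha))).
    { eapply Rle_trans.
      - apply (rsum_le _ (fun i => K * K1 * Rpower (INR (1 + i)) (rho - alpha - 1))).
        intros i _. unfold B, w. rewrite (S_INR (S i)).
        specialize (H1 (INR (S i)) (INR_S_ge_1 _)). change (1 + i)%nat with (S i).
        apply Rle_trans with (K * Rpower (INR (S i)) rho *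
                              (K1 * Rpower (INR (S i)) (- alpha - 1))).
        + apply Rmult_le_compat_l; [|exact H1].
          apply Rmult_le_pos; [lra|left; apply Rpower_pos].
        + right. replace (rho - alpha - 1) with (rho + (- alpha - 1)) by ring.
          rewrite (Rpower_plus rho). ring.
      - rewrite rsum_mult_l. apply Rmult_le_compat_l; [nra|]. apply (H2 1%nat m). lia. }
    lra.
Qed.

Lemma ex_series_rsum_cauchy (u : nat -> R) :
  (forall eps, 0 < eps -> exists M0, forall M N, (M0 <= M)%nat ->
     Rabs (rsum u (M + N) - rsum u M) <= eps) ->
  forall eps, 0 < eps -> exists N, forall n, (N <= n)%nat -> Rabs (rsum u n - Series u) <= eps.
Proof.
  intros H.
  assert (Hex : ex_series u).
  { apply ex_lim_seq_cauchy_corr. intros eps.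
    assert (He : 0 < eps / 3) by (assert (K := cond_pos eps); lra).
    destruct (H _ He) as [M0 HM0]. exists M0. intros n m Hn Hm. rewrite !rsum_sum_n.
    assert (Q1 := HM0 M0 (S n - M0)%nat (le_n _)). assert (Q2 := HM0 M0 (S m - M0)%nat (le_n _)).
    replace (M0 + (S n - M0))%nat with (S n) in Q1 by lia.
    replace (M0 + (S m - M0))%nat with (S m) in Q2 by lia.
    apply Rabs_le_between in Q1. apply Rabs_le_between in Q2.
    apply Rabs_def1; assert (K := cond_pos eps); lra. }
  intros eps He. assert (Hs := Series_correct u Hex).
  assert (K := proj1 (filterlim_locally _ _) Hs (mkposreal _ He)).
  destruct K as [N HN]. exists (S N). intros n Hn. destruct n as [|n]; [lia|].
  specialize (HN n ltac:(lia)). unfold ball in HN. simpl in HN.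
  unfold AbsRing_ball, abs, minus, plus, opp in HN. simpl in HN.
  rewrite rsum_sum_n in HN. unfold Rminus. left. exact HN.
Qed.

Lemma CSeries_Clim (u : nat -> C) :
  (forall eps, 0 < eps -> exists M0, forall M N, (M0 <= M)%nat ->
     Cmod (csum u (M + N) - csum u M) <= eps) ->
  Clim (csum u) (CSeries u).
Proof.
  intros H eps He.
  destruct (ex_series_rsum_cauchy (fun n => Re (u n))) with (eps := eps / 2) as [N1 HN1].
  { intros eps' He'. destruct (H eps' He') as [M0 HM0]. exists M0. intros M N HM.
    rewrite <- !Re_csum, <- Re_minus. eapply Rle_trans; [apply re_le_Cmod|auto]. }
  { lra. }
  destruct (ex_series_rsum_cauchy (fun n => Im (u n))) with (eps := eps / 2) as [N2 HN2].
  { intros eps' He'. destruct (H eps' He') as [M0 HM0]. exists M0. intros M N HM.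
    rewrite <- !Im_csum, <- Im_minus. eapply Rle_trans; [apply im_le_Cmod|auto]. }
  { lra. }
  exists (max N1 N2). intros n Hn.
  specialize (HN1 n ltac:(lia)). specialize (HN2 n ltac:(lia)).
  eapply Rle_trans; [apply Cmod_le_Re_Im|].
  rewrite Re_minus, Im_minus, Re_csum, Im_csum. unfold CSeries. simpl Re. simpl Im. lra.
Qed.

Lemma frac_series_rate A rho alpha : 0 <= rho < alpha -> partial_sums_bounded A rho ->
  exists K, 0 < K /\ forall M x, (1 <= M)%nat ->
    Cmod (frac_series A alpha x - fourier_sum (weighted A alpha) M x)
    <= K * Rpower (INR M) (rho - alpha).
Proof.
  intros Hr HA. destruct (weighted_tail A rho alpha Hr HA) as [K [HK H]].
  exists K. split; [auto|]. intros M x HM.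
  assert (HC : Clim (fun n => fourier_sum (weighted A alpha) n x) (frac_series A alpha x)).
  { apply CSeries_Clim. intros eps He.
    destruct (power_decay K (alpha - rho) eps) as [M0 [HM0 HM0b]]; [lra|auto|].
    exists M0. intros M' N HM'. eapply Rle_trans; [apply (H M' N x); lia|].
    replace (rho - alpha) with (- (alpha - rho)) by ring. auto. }
  apply (Clim_le _ _ _ _ M HC). intros n Hn.
  replace n with (M + (n - M))%nat by lia. now apply H.
Qed.

Lemma frac_series_uniform A rho alpha : 0 <= rho < alpha -> partial_sums_bounded A rho ->
  uniform_fourier (weighted A alpha) (frac_series A alpha).
Proof.
  intros Hr HA eps He. destruct (frac_series_rate A rho alpha Hr HA) as [K [HK H]].
  destruct (power_decay K (alpha - rho) eps) as [M0 [HM0 HM0b]]; [lra|auto|].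
  exists M0. intros M x HM. eapply Rle_trans; [apply H; lia|].
  replace (rho - alpha) with (- (alpha - rho)) by ring. auto.
Qed.

Lemma Cderive_fourier_weighted A alpha M :
  Cderive (fourier_sum (weighted A alpha) M)
    (fun x => RtoC (2 * PI) * Ci * fourier_sum (weighted A (alpha - 1)) M x)%C.
Proof.
  eapply Cderive_ext; [reflexivity| |
    apply (Cderive_csum (fun i t => weighted A alpha i * e (RtoC (INR (S i) * t)))%C)].
  2: { intros i. apply Cderive_scal, Cderive_e. }
  intros t. cbv beta. unfold fourier_sum. rewrite <- csum_mult_l. apply csum_ext.
  intros i _. unfold weighted.
  replace (- (alpha - 1)) with (- alpha + 1) by ring.
  assert (Hi := INR_S_ge_1 i). rewrite Rpower_succ by lra. rewrite !RtoC_mult. ring.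
Qed.

Lemma Cmod_2PI_i : Cmod (RtoC (2 * PI) * Ci)%C = 2 * PI.
Proof.
  assert (H := PI_RGT_0). rewrite Cmod_mult, Cmod_Ci, Cmod_R, Rabs_right; lra.
Qed.

(** Below exponent 1: the series is cut at [1 / |h|], the head being controlled
    by its derivative and the tail by its size. *)
Lemma frac_series_holder A rho s : 0 <= rho -> 0 < s < 1 -> partial_sums_bounded A rho ->
  exists K, 0 < K /\ forall x h, 0 < Rabs h <= 1 ->
    Cmod (frac_series A (rho + s) (x + h) - frac_series A (rho + s) x) <= K * Rpower (Rabs h) s.
Proof.
  intros Hr Hs HA. set (alpha := rho + s). assert (HPI := PI_RGT_0).
  destruct (frac_series_rate A rho alpha ltac:(unfold alpha; lra) HA) as [K1 [HK1 H1]].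
  destruct (weighted_growth A rho (alpha - 1) ltac:(unfold alpha; lra) Hr HA) as [K2 [HK2 H2]].
  replace (rho - alpha) with (- s) in H1 by (unfold alpha; ring).
  replace (rho - (alpha - 1)) with (1 - s) in H2 by (unfold alpha; ring).
  exists (2 * K1 * Rpower 2 s + 4 * PI * K2). split.
  { assert (Q := Rpower_pos 2 s). assert (0 < K1 * Rpower 2 s) by nra. nra. }
  intros x h [Hh0 Hh1].
  assert (Hi0 : 0 < / Rabs h) by (now apply Rinv_0_lt_compat).
  assert (Hi1 : 1 <= / Rabs h) by (rewrite <- Rinv_1; apply Rinv_le_contravar; lra).
  destruct (nfloor_ex (/ Rabs h)) as [M [HM1 HM2]]; [lra|].
  assert (HM : (1 <= M)%nat).
  { destruct M; [|lia]. simpl in HM2. lra. }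
  assert (HM3 : 1 <= INR M) by (apply (le_INR 1); lia).
  set (F := frac_series A alpha). set (G := fourier_sum (weighted A alpha) M).
  assert (Htail : forall t, Cmod (F t - G t) <= K1 * Rpower 2 s * Rpower (Rabs h) s).
  { intros t. eapply Rle_trans; [apply H1; auto|]. rewrite Rmult_assoc.
    apply Rmult_le_compat_l; [lra|]. rewrite Rpower_mult_distr by lra.
    rewrite <- Rpower_inv_l by lra. apply Rle_Rpower_l; [lra|].
    split; [apply Rinv_0_lt_compat; lra|].
    rewrite <- (Rinv_inv (2 * Rabs h)). apply Rinv_le_contravar.
    - apply Rinv_0_lt_compat. lra.
    - rewrite Rinv_mult. lra. }
  assert (Hhead : Cmod (G (x + h) - G x) <= 4 * PI * K2 * Rpower (Rabs h) s).
  { eapply Rle_trans.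
    - apply (Cderive_mean_value G _ x (x + h) (2 * PI * (K2 * Rpower (/ Rabs h) (1 - s)))
        (Cderive_fourier_weighted A alpha M)).
      intros t _. rewrite Cmod_mult, Cmod_2PI_i. apply Rmult_le_compat_l; [lra|].
      eapply Rle_trans; [apply H2; auto|]. apply Rmult_le_compat_l; [lra|].
      apply Rle_Rpower_l; lra.
    - replace (x + h - x) with h by ring. right.
      rewrite Rpower_inv_l by auto. replace (- (1 - s)) with (s - 1) by ring.
      rewrite Rpower_minus, Rpower_1 by auto. field. lra. }
  replace (F (x + h)%R - F x)%C
    with ((F (x + h)%R - G (x + h)%R) + (- (F x - G x)) + (G (x + h)%R - G x))%C by ring.
  assert (Q1 := Cmod_triangle (F (x + h)%R - G (x + h)%R + - (F x - G x))%C (G (x + h)%R - G x)%C).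
  assert (Q2 := Cmod_triangle (F (x + h)%R - G (x + h)%R)%C (- (F x - G x))%C).
  rewrite Cmod_opp in Q2. assert (Q3 := Htail (x + h)%R). assert (Q4 := Htail x). lra.
Qed.

Lemma uniform_fourier_Clim c h x : uniform_fourier c h -> Clim (fun M => fourier_sum c M x) (h x).
Proof.
  intros H eps He. destruct (H eps He) as [M0 HM]. exists M0. intros n Hn.
  rewrite Cmod_minus_sym. now apply HM.
Qed.

Lemma derivable_of_uniform (F G : nat -> R -> R) (f g : R -> R) x :
  (forall n t, is_derive (F n) t (G n t)) ->
  (forall t eps, 0 < eps -> exists N, forall n, (N <= n)%nat -> Rabs (F n t - f t) <= eps) ->
  (forall eps, 0 < eps -> exists N, forall n t, (N <= n)%nat -> Rabs (G n t - g t) <= eps) ->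
  is_derive f x (g x).
Proof.
  intros HD HF HG. apply is_derive_Reals.
  apply (CVU_derivable F G f g x (mkposreal 1 Rlt_0_1)).
  - intros eps He. destruct (HG (eps / 2)) as [N HN]; [lra|]. exists N. intros n y Hn _.
    specialize (HN n y Hn). rewrite Rabs_minus_sym. lra.
  - intros t _ eps He. destruct (HF t (eps / 2)) as [N HN]; [lra|]. exists N. intros n Hn.
    unfold Rdist. specialize (HN n Hn). lra.
  - intros n t _. apply is_derive_Reals, HD.
  - unfold Boule. simpl. rewrite Rminus_diag, Rabs_R0. lra.
Qed.

Lemma Cderive_of_uniform (F G : nat -> R -> C) (f g : R -> C) :
  (forall n, Cderive (F n) (G n)) -> (forall t, Clim (fun n => F n t) (f t)) ->
  (forall eps, 0 < eps -> exists N, forall n t, (N <= n)%nat -> Cmod (G n t - g t) <= eps) ->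
  Cderive f g.
Proof.
  intros HD HF HG x. split.
  - apply (derivable_of_uniform (fun n t => Re (F n t)) (fun n t => Re (G n t))
      (fun t => Re (f t)) (fun t => Re (g t))).
    + intros n t. apply (HD n t).
    + intros t eps He. destruct (HF t eps He) as [N HN]. exists N. intros n Hn.
      rewrite <- Re_minus. eapply Rle_trans; [apply re_le_Cmod|auto].
    + intros eps He. destruct (HG eps He) as [N HN]. exists N. intros n t Hn.
      rewrite <- Re_minus. eapply Rle_trans; [apply re_le_Cmod|auto].
  - apply (derivable_of_uniform (fun n t => Im (F n t)) (fun n t => Im (G n t))
      (fun t => Im (f t)) (fun t => Im (g t))).
    + intros n t. apply (HD n t).
    + intros t eps He. destruct (HF t eps He) as [N HN]. exists N. intros n Hn.
      rewrite <- Im_minus. eapply Rle_trans; [apply im_le_Cmod|auto].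
    + intros eps He. destruct (HG eps He) as [N HN]. exists N. intros n t Hn.
      rewrite <- Im_minus. eapply Rle_trans; [apply im_le_Cmod|auto].
Qed.

Lemma Cderive_frac_series A rho alpha : 0 <= rho < alpha - 1 -> partial_sums_bounded A rho ->
  Cderive (frac_series A alpha)
    (fun x => RtoC (2 * PI) * Ci * frac_series A (alpha - 1) x)%C.
Proof.
  intros Hr HA. assert (HPI := PI_RGT_0).
  assert (H1 := frac_series_uniform A rho (alpha - 1) ltac:(lra) HA).
  apply (Cderive_of_uniform _ _ _ _ (Cderive_fourier_weighted A alpha)).
  - intros t. apply (uniform_fourier_Clim _ _ t (frac_series_uniform A rho alpha ltac:(lra) HA)).
  - intros eps He. destruct (H1 (eps / (2 * PI))) as [N HN]; [apply Rdiv_lt_0_compat; lra|].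
    exists N. intros n t Hn. specialize (HN n t Hn). rewrite Cmod_minus_sym in HN.
    replace (RtoC (2 * PI) * Ci * fourier_sum (weighted A (alpha - 1)) n t -
          RtoC (2 * PI) * Ci * frac_series A (alpha - 1) t)%C
      with ((RtoC (2 * PI) * Ci) * (fourier_sum (weighted A (alpha - 1)) n t - frac_series A (alpha - 1)%R t))%C
      by ring.
    rewrite Cmod_mult, Cmod_2PI_i. apply (Rmult_le_compat_l (2 * PI)) in HN; [|lra].
    replace (2 * PI * (eps / (2 * PI))) with eps in HN by (field; lra). exact HN.
Qed.

(** * Regularity at every point *)

Definition taylor (p : nat -> C) (d : nat) (h : R) : C :=
  csum (fun k => p k * RtoC (h ^ k))%C (S d).

(** The condition [p 0 = g x0] extends the estimate to [h = 0], so that expansions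
    can be integrated. *)
Definition holder_expansion (g : R -> C) (x0 s : R) : Prop :=
  exists (d : nat) (p : nat -> C) (K : R), 0 < K /\ INR d <= s /\ p O = g x0 /\
    forall h, 0 < Rabs h < 1 -> Cmod (g (x0 + h) - taylor p d h) <= K * Rpower (Rabs h) s.

Lemma taylor_S p d h :
  taylor p (S d) h = (p O + RtoC h * taylor (fun k => p (S k)) d h)%C.
Proof.
  unfold taylor. change (S (S d)) with (1 + S d)%nat. rewrite csum_split. simpl csum at 1.
  rewrite <- csum_mult_l. f_equal; [ring|]. apply csum_ext. intros i _.
  change (1 + i)%nat with (S i). simpl pow. rewrite RtoC_mult. ring.
Qed.

Lemma taylor_0 p d : taylor p d 0 = p O.
Proof.
  destruct d; [unfold taylor; simpl; ring|]. rewrite taylor_S. ring.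
Qed.

Lemma Cderive_taylor p d :
  Cderive (taylor p (S d)) (taylor (fun k => RtoC (INR (S k)) * p (S k))%C d).
Proof.
  apply (Cderive_ext (fun h => p O + csum (fun k => p (S k) * RtoC h ^ (S k))%C (S d))%C _
     (fun h => RtoC 0 + csum (fun k => p (S k) * (RtoC (INR (S k)) * RtoC h ^ k * RtoC 1))%C (S d))%C).
  - intros h. rewrite taylor_S. unfold taylor. rewrite <- csum_mult_l. f_equal.
    apply csum_ext. intros k _. rewrite RtoC_pow, Cpow_S. ring.
  - intros h. unfold taylor. rewrite Cplus_0_l. apply csum_ext. intros k _. rewrite RtoC_pow. ring.
  - apply Cderive_plus; [apply Cderive_const|].
    apply (Cderive_csum (fun k h => p (S k) * RtoC h ^ S k)%C
       (fun k h => p (S k) * (RtoC (INR (S k)) * RtoC h ^ k * RtoC 1))%C).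
    intros k. apply Cderive_scal, Cderive_pow, Cderive_id.
Qed.

Lemma frac_series_regular_small A sigma0 alpha x0 s : 0 <= sigma0 ->
  (forall rho, sigma0 < rho -> partial_sums_bounded A rho) ->
  0 <= s < 1 -> s < alpha - sigma0 -> holder_expansion (frac_series A alpha) x0 s.
Proof.
  intros H0 HA Hs Hsa.
  set (s' := (s + Rmin 1 (alpha - sigma0)) / 2).
  assert (Hm1 := Rmin_l 1 (alpha - sigma0)). assert (Hm2 := Rmin_r 1 (alpha - sigma0)).
  assert (Hm3 : s < Rmin 1 (alpha - sigma0)) by (apply Rmin_glb_lt; lra).
  assert (Hs' : s < s' < 1 /\ s' < alpha - sigma0) by (unfold s'; lra).
  destruct (frac_series_holder A (alpha - s') s') as [K [HK H]];
    [lra|lra|apply HA; lra|].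
  replace (alpha - s' + s') with alpha in H by ring.
  exists O, (fun _ => frac_series A alpha x0), K.
  split; [auto|]. split; [simpl; lra|]. split; [auto|]. intros h Hh.
  unfold taylor. simpl csum. rewrite Cplus_0_l, Cmult_1_r.
  eapply Rle_trans; [apply H; lra|]. apply Rmult_le_compat_l; [lra|].
  apply Rpower_exponent_antitone; lra.
Qed.

(** Each unit of regularity is gained by integrating the expansion of the
    derivative, again a series of the same kind. *)
Lemma frac_series_regular A sigma0 x0 : 0 <= sigma0 ->
  (forall rho, sigma0 < rho -> partial_sums_bounded A rho) ->
  forall n alpha s, 0 <= s < INR n + 1 -> s < alpha - sigma0 ->
    holder_expansion (frac_series A alpha) x0 s.
Proof.
  intros H0 HA n. assert (HPI := PI_RGT_0). induction n as [|n IH]; intros alpha s Hs Hsa.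
  - apply (frac_series_regular_small A sigma0); auto. simpl in Hs. lra.
  - destruct (Rlt_dec s 1) as [Hs1|Hs1].
    { apply (frac_series_regular_small A sigma0); auto. lra. }
    rewrite S_INR in Hs.
    destruct (IH (alpha - 1) (s - 1)) as (d & p & K & HK & Hd & Hp0 & Hp); [lra|lra|].
    set (rho := (sigma0 + (alpha - s)) / 2).
    assert (HD := Cderive_frac_series A rho alpha ltac:(unfold rho; lra)
      (HA rho ltac:(unfold rho; lra))).
    set (I2 := (RtoC (2 * PI) * Ci)%C) in *.
    set (p' := fun k => match k with O => frac_series A alpha x0
                        | S k => (I2 * p k / RtoC (INR (S k)))%C end).
    assert (Hp' : forall h, taylor (fun k => RtoC (INR (S k)) * p' (S k))%C d h = (I2 * taylor p d h)%C).
    { intros h. unfold taylor. rewrite <- csum_mult_l. apply csum_ext. intros k _. unfold p'.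
      assert (Hk : RtoC (INR (S k)) <> RtoC 0).
      { intros E. apply RtoC_inj in E. assert (Q := INR_S_ge_1 k). lra. }
      field. exact Hk. }
    exists (S d), p', (2 * (2 * PI * K)).
    split; [nra|]. split; [rewrite S_INR; lra|]. split; [reflexivity|]. intros h Hh.
    set (D := fun t => (frac_series A alpha (x0 + t) - taylor p' (S d) t)%C).
    assert (HDD : Cderive D (fun t => I2 * (frac_series A (alpha - 1) (x0 + t) - taylor p d t))%C).
    { apply (Cderive_ext D D (fun t => I2 * frac_series A (alpha - 1) (x0 + t) -
        taylor (fun k => RtoC (INR (S k)) * p' (S k))%C d t)%C).
      - reflexivity.
      - intros t. rewrite Hp'. ring.
      - apply Cderive_minus; [|apply Cderive_taylor].
        intros t. destruct (HD (x0 + t)) as [D1 D2].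
        split; evar_last.
        + apply (is_derive_comp (fun t => Re (frac_series A alpha t)) (fun t => x0 + t)).
          * exact D1.
          * auto_derive; [exact I|reflexivity].
        + unfold scal; simpl; unfold mult; simpl. as_real_equation. ring.
        + apply (is_derive_comp (fun t => Im (frac_series A alpha t)) (fun t => x0 + t)).
          * exact D2.
          * auto_derive; [exact I|reflexivity].
        + unfold scal; simpl; unfold mult; simpl. as_real_equation. ring. }
    assert (E : (frac_series A alpha (x0 + h) - taylor p' (S d) h)%C = (D h - D 0)%C).
    { unfold D. rewrite taylor_0, Rplus_0_r. unfold p' at 3. ring. }
    rewrite E. eapply Rle_trans.
    + apply (Cderive_mean_value D _ 0 h (2 * PI * (K * Rpower (Rabs h) (s - 1))) HDD).
      intros t Ht. rewrite Cmod_mult. unfold I2. rewrite Cmod_2PI_i.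
      apply Rmult_le_compat_l; [lra|].
      destruct (Req_dec t 0) as [->|Ht0].
      * rewrite taylor_0, Rplus_0_r, Hp0.
        replace (frac_series A (alpha - 1) x0 - frac_series A (alpha - 1) x0)%C with (RtoC 0) by ring.
        rewrite Cmod_0. apply Rmult_le_pos; [lra|left; apply Rpower_pos].
      * assert (Hth : Rabs t <= Rabs h).
        { unfold Rmin, Rmax in Ht. destruct (Rle_dec 0 h).
          - rewrite !Rabs_right by lra. lra.
          - rewrite !Rabs_left1 by lra. lra. }
        assert (Ht0' := Rabs_pos_lt t Ht0).
        eapply Rle_trans; [apply Hp; lra|]. apply Rmult_le_compat_l; [lra|].
        apply Rle_Rpower_l; lra.
    + rewrite Rminus_0_r. right.
      rewrite Rpower_minus, Rpower_1 by lra. field. lra.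
Qed.

(** * Trigonometric approximation of polynomials *)

Inductive trig : (R -> C) -> Prop :=
| trig_mono (c : C) (k : nat) : trig (fun u => c * e (RtoC (INR k * u)))%C
| trig_plus h1 h2 : trig h1 -> trig h2 -> trig (fun u => h1 u + h2 u)%C
| trig_ext h1 h2 : (forall u, h1 u = h2 u) -> trig h1 -> trig h2.

Lemma trig_const c : trig (fun _ => c).
Proof.
  apply (trig_ext (fun u => c * e (RtoC (INR 0 * u)))%C); [|constructor].
  intros u. simpl. rewrite Rmult_0_l, e_0. ring.
Qed.

Lemma trig_mult h1 h2 : trig h1 -> trig h2 -> trig (fun u => h1 u * h2 u)%C.
Proof.
  intros H1 H2. induction H1 as [c k|h1 h1' _ IH1 _ IH1'|h1 h1' E _ IH].
  - induction H2 as [c' k'|h2 h2' _ IH2 _ IH2'|h2 h2' E _ IH].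
    + apply (trig_ext (fun u => (c * c') * e (RtoC (INR (k + k') * u)))%C); [|constructor].
      intros u. rewrite plus_INR, Rmult_plus_distr_r, RtoC_plus, e_plus. ring.
    + eapply trig_ext; [|apply (trig_plus _ _ IH2 IH2')]. intros u. simpl. ring.
    + eapply trig_ext; [|apply IH]. intros u. simpl. now rewrite E.
  - eapply trig_ext; [|apply (trig_plus _ _ IH1 IH1')]. intros u. simpl. ring.
  - eapply trig_ext; [|apply IH]. intros u. simpl. now rewrite E.
Qed.

Lemma trig_pow h n : trig h -> trig (fun u => h u ^ n)%C.
Proof.
  intros H. induction n as [|n IH].
  - apply (trig_ext (fun _ => RtoC 1)); [reflexivity|apply trig_const].
  - apply (trig_ext (fun u => h u * h u ^ n)%C); [reflexivity|now apply trig_mult].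
Qed.

Lemma Ccont_trig h : trig h -> Ccont h.
Proof.
  intros H. induction H as [c k|h1 h2 _ IH1 _ IH2|h1 h2 E _ IH].
  - apply Ccont_scal, Ccont_e.
  - now apply Ccont_plus.
  - exact (Ccont_ext _ _ E IH).
Qed.

Lemma trig_e : trig (fun u => e (RtoC u)).
Proof.
  apply (trig_ext (fun u => 1 * e (RtoC (INR 1 * u)))%C); [|constructor].
  intros u. simpl. rewrite Rmult_1_l. ring.
Qed.

Lemma Cderive_one_minus_e :
  Cderive (fun u => 1 - e (RtoC u))%C (fun u => - (RtoC (2 * PI) * Ci) * e (RtoC u))%C.
Proof.
  apply (Cderive_ext (fun u => 1 - e (RtoC (1 * u)))%C _
    (fun u => RtoC 0 - RtoC (2 * PI * 1) * Ci * e (RtoC (1 * u)))%C).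
  - intros u. now rewrite Rmult_1_l.
  - intros u. rewrite Rmult_1_l, Rmult_1_r. ring.
  - apply Cderive_minus; [apply Cderive_const|apply Cderive_e].
Qed.

Lemma two_pi_i_neq_0 : (RtoC (2 * PI) * Ci)%C <> RtoC 0.
Proof. apply Cmod_gt_0. rewrite Cmod_2PI_i. assert (H := PI_RGT_0). lra. Qed.

(** The truncations of the series of [log (1 - (1 - e u)) / (2 PI i)] are
    trigonometric polynomials approximating [u] near 0 to any order. *)
Lemma trig_logarithm D : exists L, trig L /\ L 0 = RtoC 0 /\
  Cderive (fun u => RtoC u - L u)%C (fun u => (1 - e (RtoC u)) ^ D)%C.
Proof.
  induction D as [|D [L [HL [HL0 HD]]]].
  - exists (fun _ => RtoC 0). split; [apply trig_const|]. split; [reflexivity|].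
    apply (Cderive_ext (fun u => RtoC u) _ (fun _ => RtoC 1)).
    + intros u. ring. + intros u. reflexivity. + apply Cderive_id.
  - set (k := (- / (RtoC (INR (S D)) * (RtoC (2 * PI) * Ci)))%C).
    assert (Hk : RtoC (INR (S D)) <> RtoC 0).
    { intros E. apply RtoC_inj in E. assert (Q := INR_S_ge_1 D). lra. }
    assert (Hi := two_pi_i_neq_0).
    exists (fun u => L u + k * (1 - e (RtoC u)) ^ S D)%C. split; [|split].
    + apply trig_plus; [auto|]. apply trig_mult; [apply trig_const|]. apply trig_pow.
      apply (trig_ext (fun u => 1 + RtoC (-1) * e (RtoC u))%C).
      * intros u. change (RtoC (-1)) with (RtoC (- (1))). rewrite RtoC_opp. ring.
      * apply trig_plus; [apply trig_const|]. apply trig_mult; [apply trig_const|apply trig_e].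
    + rewrite HL0, e_0, Cpow_S. ring.
    + apply (Cderive_ext (fun u => (RtoC u - L u) - k * (1 - e (RtoC u)) ^ S D)%C _
       (fun u => (1 - e (RtoC u)) ^ D - k * (RtoC (INR (S D)) * (1 - e (RtoC u)) ^ D *
          (- (RtoC (2 * PI) * Ci) * e (RtoC u))))%C).
      * intros u. ring.
      * intros u. rewrite Cpow_S. unfold k. field. split; [exact Ci_nz|].
        split; [intros E; apply Hi; rewrite E; ring|exact Hk].
      * apply Cderive_minus; [exact HD|]. apply Cderive_scal.
        apply (Cderive_pow (fun u => 1 - e (RtoC u))%C), Cderive_one_minus_e.
Qed.

Lemma Cmod_one_minus_e u : Cmod (1 - e (RtoC u))%C <= 4 * PI * Rabs u.
Proof.
  assert (HPI := PI_RGT_0).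
  replace (1 - e (RtoC u))%C with ((1 - e (RtoC u)) - (1 - e (RtoC 0)))%C by (rewrite e_0; ring).
  eapply Rle_trans; [apply (Cderive_mean_value (fun u => 1 - e (RtoC u))%C _ 0 u (2 * PI)
    Cderive_one_minus_e)|].
  - intros t _. rewrite Cmod_mult, Cmod_opp, Cmod_2PI_i, Cmod_e_R. lra.
  - rewrite Rminus_0_r. lra.
Qed.

(** The derivative [(1 - e u) ^ D] of the error vanishes to order [D] at 0. *)
Lemma trig_identity D : exists L K, trig L /\ 0 < K /\
  forall u, Cmod (RtoC u - L u)%C <= K * Rabs u ^ S D.
Proof.
  destruct (trig_logarithm D) as [L [HL [HL0 HD]]]. assert (HPI := PI_RGT_0).
  exists L, (2 * (4 * PI) ^ D). split; [auto|]. split.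
  { apply Rmult_lt_0_compat; [lra|apply pow_lt; lra]. }
  intros u.
  replace (RtoC u - L u)%C with ((RtoC u - L u) - (RtoC 0 - L 0))%C by (rewrite HL0; ring).
  eapply Rle_trans; [apply (Cderive_mean_value _ _ 0 u ((4 * PI * Rabs u) ^ D) HD)|].
  - intros t Ht. rewrite Cmod_pow. apply pow_incr. split; [apply Cmod_ge_0|].
    eapply Rle_trans; [apply Cmod_one_minus_e|]. apply Rmult_le_compat_l; [lra|].
    unfold Rmin, Rmax in Ht. destruct (Rle_dec 0 u).
    + rewrite !Rabs_right by lra. lra.
    + rewrite !Rabs_left1 by lra. lra.
  - rewrite Rminus_0_r, Rpow_mult_distr. right. change (Rabs u ^ S D) with (Rabs u * Rabs u ^ D). ring.
Qed.

Lemma trig_power D k : exists P K, trig P /\ 0 < K /\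
  forall u, Rabs u <= 1 -> Cmod (RtoC (u ^ k) - P u)%C <= K * Rabs u ^ S D.
Proof.
  destruct (trig_identity D) as [L [K0 [HL [HK0 H0]]]].
  induction k as [|k [P [K [HP [HK H]]]]].
  - exists (fun _ => RtoC 1), 1. split; [apply trig_const|]. split; [lra|]. intros u _.
    simpl. replace (1 - 1)%C with (RtoC 0) by ring. rewrite Cmod_0, Rmult_1_l.
    apply (pow_le _ (S D)), Rabs_pos.
  - exists (fun u => L u * P u)%C, (K0 + (1 + K0) * K). split; [now apply trig_mult|].
    split; [nra|]. intros u Hu. specialize (H u Hu). specialize (H0 u).
    assert (Hu0 := Rabs_pos u).
    assert (Hp0 : 0 <= Rabs u ^ S D) by now apply pow_le.
    assert (Hp1 : Rabs u ^ S D <= 1) by (rewrite <- (pow1 (S D)); apply pow_incr; lra).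
    simpl pow at 1. rewrite RtoC_mult.
    replace (RtoC u * RtoC (u ^ k) - L u * P u)%C
      with ((RtoC u - L u) * RtoC (u ^ k) + L u * (RtoC (u ^ k) - P u))%C by ring.
    eapply Rle_trans; [apply Cmod_triangle|]. rewrite !Cmod_mult.
    assert (Hk1 : Cmod (RtoC (u ^ k)) <= 1).
    { rewrite Cmod_R, <- RPow_abs. rewrite <- (pow1 k). apply pow_incr. lra. }
    assert (HL1 : Cmod (L u) <= 1 + K0).
    { replace (L u) with (RtoC u + - (RtoC u - L u))%C by ring.
      eapply Rle_trans; [apply Cmod_triangle|]. rewrite Cmod_opp, Cmod_R. nra. }
    rewrite Rmult_plus_distr_r. apply Rplus_le_compat.
    + rewrite <- (Rmult_1_r (K0 * _)). apply Rmult_le_compat; auto using Cmod_ge_0.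
    + rewrite Rmult_assoc. apply Rmult_le_compat; auto using Cmod_ge_0.
Qed.

(** Over a period a trigonometric polynomial is orthogonal to all but finitely many
    frequencies, which makes it preferable to the Taylor polynomial. *)
Lemma trig_taylor p d D : exists P K, trig P /\ 0 < K /\
  forall u, Rabs u <= 1 -> Cmod (taylor p d u - P u)%C <= K * Rabs u ^ S D.
Proof.
  unfold taylor. induction (S d) as [|n [P [K [HP [HK H]]]]].
  - exists (fun _ => RtoC 0), 1. split; [apply trig_const|]. split; [lra|]. intros u _.
    simpl csum. replace (0 - 0)%C with (RtoC 0) by ring. rewrite Cmod_0, Rmult_1_l.
    apply pow_le, Rabs_pos.
  - destruct (trig_power D n) as [P1 [K1 [HP1 [HK1 H1]]]].
    exists (fun u => P u + p n * P1 u)%C, (K + Cmod (p n) * K1).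
    assert (Hpn := Cmod_ge_0 (p n)).
    split; [apply trig_plus; [auto|apply trig_mult; [apply trig_const|auto]]|].
    split; [nra|]. intros u Hu. rewrite csum_S.
    replace (csum (fun k => p k * RtoC (u ^ k)) n + p n * RtoC (u ^ n) - (P u + p n * P1 u))%C
      with ((csum (fun k => p k * RtoC (u ^ k)) n - P u) + p n * (RtoC (u ^ n) - P1 u))%C by ring.
    eapply Rle_trans; [apply Cmod_triangle|]. rewrite Cmod_mult, Rmult_plus_distr_r.
    apply Rplus_le_compat; [auto|]. rewrite Rmult_assoc. apply Rmult_le_compat_l; auto.
Qed.

(** * The kernel with coefficients [n ^ alpha] *)

(** Blocks of the kernel [sum n ^ alpha w ^ n] after [k] summations by parts. *)
Definition diff_block (alpha : R) (w : C) (k m n : nat) : C :=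
  csum (fun i => RtoC (forward_diff k (fun t => Rpower t alpha) (INR (m + i))) * w ^ (m + i))%C n.

Lemma diff_block_step alpha w k m n :
  ((1 - w) * diff_block alpha w k m n =
   RtoC (forward_diff k (fun t => Rpower t alpha) (INR m)) * w ^ m
   - RtoC (forward_diff k (fun t => Rpower t alpha) (INR (m + n))) * w ^ (m + n)
   + w * diff_block alpha w (S k) m n)%C.
Proof.
  unfold diff_block. induction n as [|n IH].
  - rewrite Nat.add_0_r. simpl. ring.
  - rewrite !csum_S, !Cmult_plus_distr_l, IH.
    replace (m + S n)%nat with (S (m + n)) by lia.
    rewrite Cpow_S, (S_INR (m + n)). simpl forward_diff. rewrite RtoC_minus. ring.
Qed.

Lemma power_of_cutoff a d m : 0 < d -> 1 <= d * m <= 3 ->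
  Rpower m a <= Rpower 3 (Rabs a) * Rpower d (- a).
Proof.
  intros Hd Hm. assert (Hm0 : 0 < m) by nra. rewrite <- Rpower_inv_l by auto.
  assert (Hi : 0 < / d) by now apply Rinv_0_lt_compat.
  assert (Hdd : d * / d = 1) by (apply Rinv_r; lra).
  apply Rpower_comparable; try lra.
  - apply (Rmult_le_reg_l d); [auto|]. nra.
  - apply (Rmult_le_reg_l d); [auto|]. nra.
Qed.

(** Summation by parts, repeated until the differences are summable.  The block
    starts at the cutoff [m ~ 1 / |1 - w|], where all the boundary terms have
    the same size; the condition on [m + n] makes those at its end negligible. *)
Lemma diff_block_bound alpha (J : nat) : 0 <= alpha -> alpha + 1 < INR J ->
  forall j k, (k + j = J)%nat -> exists K, 0 < K /\ forall w m n,
    Cmod w <= 1 -> 0 < Cmod (1 - w) -> 1 <= Cmod (1 - w) * INR m <= 3 ->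
    Rpower (INR (m + n)) alpha * Cmod w ^ (m + n) <= Rpower (Cmod (1 - w)) (INR J) ->
    Cmod (diff_block alpha w k m n) <= K * Rpower (Cmod (1 - w)) (INR k - alpha - 1).
Proof.
  intros Ha HJ j. induction j as [|j IH]; intros k Hk.
  - assert (E : k = J) by lia. subst k. clear Hk.
    destruct (forward_diff_power_bound J alpha) as [K1 [HK1 H1]].
    destruct (power_sum_neg (alpha - INR J + 1) ltac:(lra)) as [K2 [HK2 H2]].
    set (P := Rpower 3 (Rabs (alpha - INR J + 1))).
    assert (HP : 0 < P) by apply Rpower_pos.
    exists (K1 * K2 * P + 1). split. { assert (0 <= K1 * K2 * P); [|lra]. repeat apply Rmult_le_pos; lra. }
    intros w m n Hw Hd Hm _. set (d := Cmod (1 - w)) in *.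
    assert (Hm0 : (1 <= m)%nat) by (destruct m; [simpl in Hm; lra|lia]).
    assert (Q := Rpower_pos d (INR J - alpha - 1)).
    eapply Rle_trans; [apply Cmod_csum|].
    eapply Rle_trans.
    { apply (rsum_le _ (fun i => K1 * Rpower (INR (m + i)) (alpha - INR J + 1 - 1))).
      intros i _. rewrite Cmod_mult, Cmod_R, Cmod_pow.
      replace (alpha - INR J + 1 - 1) with (alpha - INR J) by ring.
      assert (Hmi : 1 <= INR (m + i)) by (apply (le_INR 1); lia).
      specialize (H1 _ Hmi). rewrite <- Rmult_1_r. apply Rmult_le_compat; auto using Rabs_pos.
      - apply pow_le, Cmod_ge_0.
      - rewrite <- (pow1 (m + i)). apply pow_incr. split; [apply Cmod_ge_0|auto]. }
    rewrite rsum_mult_l. eapply Rle_trans; [apply Rmult_le_compat_l; [auto|apply (H2 m n Hm0)]|].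
    assert (Q2 := power_of_cutoff (alpha - INR J + 1) d (INR m) Hd Hm). fold P in Q2.
    replace (- (alpha - INR J + 1)) with (INR J - alpha - 1) in Q2 by ring.
    rewrite <- Rmult_assoc. apply Rle_trans with (K1 * K2 * (P * Rpower d (INR J - alpha - 1))).
    + apply Rmult_le_compat_l; [now apply Rmult_le_pos|auto].
    + nra.
  - destruct (IH (S k) ltac:(lia)) as [K [HK H]].
    destruct (forward_diff_power_bound k alpha) as [K1 [HK1 H1]].
    set (P := Rpower 3 (Rabs (alpha - INR k))).
    assert (HP : 0 < P) by apply Rpower_pos.
    set (P2 := Rpower 2 (INR J - INR k + alpha)).
    assert (HP2 : 0 < P2) by apply Rpower_pos.
    exists (K1 * P + K1 * P2 + K). split.
    { assert (0 <= K1 * P) by (apply Rmult_le_pos; lra).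
      assert (0 <= K1 * P2) by (apply Rmult_le_pos; lra). lra. }
    intros w m n Hw Hd Hm Hend. specialize (H w m n Hw Hd Hm Hend).
    set (d := Cmod (1 - w)) in *.
    assert (Hd2 : d <= 2).
    { unfold d, Cminus. eapply Rle_trans; [apply Cmod_triangle|]. rewrite Cmod_opp, Cmod_1. lra. }
    assert (Hm0 : (1 <= m)%nat) by (destruct m; [simpl in Hm; lra|lia]).
    assert (Hm1 : 1 <= INR m) by (apply (le_INR 1); lia).
    assert (Hmn : 1 <= INR (m + n)) by (apply (le_INR 1); lia).
    assert (Hwp : forall i, 0 <= Cmod w ^ i <= 1).
    { intros i. split; [apply pow_le, Cmod_ge_0|]. rewrite <- (pow1 i). apply pow_incr.
      split; [apply Cmod_ge_0|auto]. }
    apply (Rmult_le_reg_l d); [auto|].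
    unfold d at 1. rewrite <- Cmod_mult, diff_block_step.
    replace (d * ((K1 * P + K1 * P2 + K) * Rpower d (INR k - alpha - 1)))
      with (K1 * (P * Rpower d (- (alpha - INR k))) + K1 * (P2 * Rpower d (INR k - alpha))
            + K * Rpower d (INR (S k) - alpha - 1)).
    2: { replace (- (alpha - INR k)) with (INR k - alpha - 1 + 1) by ring.
         replace (INR (S k) - alpha - 1) with (INR k - alpha - 1 + 1) by (rewrite S_INR; ring).
         replace (INR k - alpha) with (INR k - alpha - 1 + 1) at 2 by ring.
         rewrite !Rpower_succ by auto. ring. }
    assert (T1 : Cmod (RtoC (forward_diff k (fun t => Rpower t alpha) (INR m)) * w ^ m)
        <= K1 * (P * Rpower d (- (alpha - INR k)))).
    { rewrite Cmod_mult, Cmod_R, Cmod_pow. specialize (H1 _ Hm1). specialize (Hwp m).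
      assert (Q := power_of_cutoff (alpha - INR k) d (INR m) Hd Hm). fold P in Q.
      rewrite <- Rmult_1_r. apply Rmult_le_compat; try apply Rabs_pos; try lra.
      eapply Rle_trans; [exact H1|]. apply Rmult_le_compat_l; auto. }
    assert (T2 : Cmod (RtoC (forward_diff k (fun t => Rpower t alpha) (INR (m + n))) * w ^ (m + n))
        <= K1 * (P2 * Rpower d (INR k - alpha))).
    { rewrite Cmod_mult, Cmod_R, Cmod_pow. specialize (H1 _ Hmn). specialize (Hwp (m + n)%nat).
      apply Rle_trans with (K1 * (Rpower (INR (m + n)) alpha * Cmod w ^ (m + n))).
      - rewrite <- Rmult_assoc. apply Rmult_le_compat_r; [lra|].
        eapply Rle_trans; [exact H1|]. apply Rmult_le_compat_l; [auto|].
        apply Rle_Rpower; [auto|]. assert (W := pos_INR k). lra.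
      - apply Rmult_le_compat_l; [auto|]. eapply Rle_trans; [exact Hend|].
        replace (INR J) with (INR J - INR k + alpha + (INR k - alpha)) by ring.
        rewrite Rpower_plus. apply Rmult_le_compat_r; [left; apply Rpower_pos|].
        unfold P2. replace (INR J - INR k + alpha + (INR k - alpha)) with (INR J) by ring.
        apply Rle_Rpower_l; [|lra]. assert (W : INR k <= INR J) by (apply le_INR; lia). lra. }
    assert (T3 : Cmod (w * diff_block alpha w (S k) m n) <= K * Rpower d (INR (S k) - alpha - 1)).
    { rewrite Cmod_mult. rewrite <- Rmult_1_l. apply Rmult_le_compat; auto using Cmod_ge_0. }
    eapply Rle_trans; [apply Cmod_triangle|]. apply Rplus_le_compat; [|exact T3].
    unfold Cminus. eapply Rle_trans; [apply Cmod_triangle|]. rewrite Cmod_opp. lra.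
Qed.

Definition power_kernel (alpha : R) (M : nat) (w : C) : C :=
  csum (fun i => RtoC (Rpower (INR (S i)) alpha) * w ^ S i)%C M.

(** Below the cutoff [1 / |1 - w|] the terms are bounded by their moduli; beyond it
    their oscillation is used, through [diff_block_bound]. *)
Lemma power_kernel_bound alpha : 0 <= alpha -> exists (J : nat) (K : R), 0 < K /\ forall w M,
  Cmod w <= 1 -> 0 < Cmod (1 - w) -> / Cmod (1 - w) <= INR M ->
  Rpower (INR (S M)) alpha * Cmod w ^ S M <= Rpower (Cmod (1 - w)) (INR J) ->
  Cmod (power_kernel alpha M w) <= K * Rpower (Cmod (1 - w)) (- alpha - 1).
Proof.
  intros Ha. destruct (INR_unbounded (alpha + 1)) as [J HJ].
  destruct (diff_block_bound alpha J Ha HJ J O) as [K [HK H]]; [lia|].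
  set (P := Rpower 3 (Rabs (alpha + 1))). assert (HP : 0 < P) by apply Rpower_pos.
  exists J, (P + K). split; [lra|]. intros w M Hw Hd HM Hend.
  set (d := Cmod (1 - w)) in *.
  assert (Hi : 0 < / d) by now apply Rinv_0_lt_compat.
  assert (Hdd : d * / d = 1) by (apply Rinv_r; lra).
  assert (Hd2 : d <= 2).
  { unfold d, Cminus. eapply Rle_trans; [apply Cmod_triangle|]. rewrite Cmod_opp, Cmod_1. lra. }
  destruct (nfloor_ex (/ d)) as [m0 [Hm1 Hm2]]; [lra|].
  assert (Hm0M : (m0 <= M)%nat) by (apply INR_le; lra).
  assert (Hm : 1 <= d * INR (S m0) <= 3).
  { rewrite S_INR. split; nra. }
  set (n := (M - m0)%nat). assert (HMn : M = (m0 + n)%nat) by (unfold n; lia).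
  assert (HB : Cmod (diff_block alpha w 0 (S m0) n) <= K * Rpower d (- alpha - 1)).
  { replace (- alpha - 1) with (INR 0 - alpha - 1) by (simpl; ring).
    apply H; auto. replace (S m0 + n)%nat with (S M) by lia. exact Hend. }
  unfold power_kernel. rewrite HMn, csum_split.
  replace (csum (fun i => RtoC (Rpower (INR (S (m0 + i))) alpha) * w ^ S (m0 + i))%C n)
    with (diff_block alpha w 0 (S m0) n) by reflexivity.
  eapply Rle_trans; [apply Cmod_triangle|]. rewrite Rmult_plus_distr_r.
  apply Rplus_le_compat; [|exact HB].
  apply Rle_trans with (Rpower (INR (S m0)) (alpha + 1)).
  - eapply Rle_trans; [apply Cmod_csum|].
    assert (Hms := INR_S_ge_1 m0). rewrite Rpower_succ by lra.
    apply Rle_trans with (Rpower (INR (S m0)) alpha * INR m0).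
    + rewrite Rmult_comm, <- rsum_const.
      apply rsum_le. intros i Hi'. rewrite Cmod_mult, Cmod_R, Cmod_pow.
      rewrite Rabs_right by (apply Rle_ge; left; apply Rpower_pos). rewrite <- Rmult_1_r.
      apply Rmult_le_compat.
      * left; apply Rpower_pos.
      * apply pow_le, Cmod_ge_0.
      * apply Rle_Rpower_l; [auto|]. split; [assert (W := INR_S_ge_1 i); lra|]. apply le_INR. lia.
      * rewrite <- (pow1 (S i)). apply pow_incr. split; [apply Cmod_ge_0|auto].
    + apply Rmult_le_compat_l; [left; apply Rpower_pos|]. rewrite S_INR. lra.
  - assert (Q := power_of_cutoff (alpha + 1) d (INR (S m0)) Hd Hm). fold P in Q.
    replace (- (alpha + 1)) with (- alpha - 1) in Q by ring. exact Q.
Qed.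

(** * Pointwise irregularity *)

Lemma power_kernel_e alpha M v y u :
  power_kernel alpha M (e ((v - u)%R, y)) =
  csum (fun i => RtoC (Rpower (INR (S i)) alpha) * e (RtoC (INR (S i)) * (v, y))
                 * e (RtoC (- INR (S i) * u)))%C M.
Proof.
  apply csum_ext. intros i _. rewrite <- e_INR, <- Cmult_assoc, <- e_plus.
  f_equal. f_equal. apply C_ext; simpl; ring.
Qed.

Lemma Ccont_power_kernel alpha M v y :
  Ccont (fun u => power_kernel alpha M (e ((v - u)%R, y))).
Proof.
  eapply Ccont_ext; [intros u; symmetry; apply power_kernel_e|].
  apply (Ccont_csum (fun i u => RtoC (Rpower (INR (S i)) alpha) * e (RtoC (INR (S i)) * (v, y))
                 * e (RtoC (- INR (S i) * u)))%C).
  intros i. apply Ccont_scal, Ccont_e.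
Qed.

Lemma Cint_power_kernel h alpha M v y : Ccont h ->
  Cint (fun u => h u * power_kernel alpha M (e ((v - u)%R, y)))%C =
  csum (fun i => RtoC (Rpower (INR (S i)) alpha) * e (RtoC (INR (S i)) * (v, y)) *
                 Cint (fun u => h u * e (RtoC (- INR (S i) * u))))%C M.
Proof.
  intros Hh.
  rewrite (Cint_ext _ (fun u => csum (fun i => (RtoC (Rpower (INR (S i)) alpha) *
     e (RtoC (INR (S i)) * (v, y))) * (h u * e (RtoC (- INR (S i) * u))))%C M)).
  - rewrite (Cint_csum (fun i u => (RtoC (Rpower (INR (S i)) alpha) *
     e (RtoC (INR (S i)) * (v, y))) * (h u * e (RtoC (- INR (S i) * u))))%C).
    + apply csum_ext. intros i _. apply Cint_scal. apply Ccont_mult; [auto|apply Ccont_e].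
    + intros i. apply Ccont_scal, Ccont_mult; [auto|apply Ccont_e].
  - intros u. rewrite power_kernel_e, <- csum_mult_l. apply csum_ext. intros i _. ring.
Qed.

Lemma csum_single_bound (v : nat -> C) (b : nat -> bool) B M : 0 <= B ->
  (forall i i', b i = true -> b i' = true -> i = i') ->
  (forall i, b i = true -> Cmod (v i) <= B) ->
  Cmod (csum (fun i => if b i then v i else RtoC 0) M) <= B.
Proof.
  intros HB Hinj Hv.
  assert (H : Cmod (csum (fun i => if b i then v i else RtoC 0) M) <= B /\
     ((forall i, (i < M)%nat -> b i = false) ->
       csum (fun i => if b i then v i else RtoC 0) M = RtoC 0)).
  { induction M as [|M [IH1 IH2]].
    - split; [simpl; rewrite Cmod_0; lra|reflexivity].
    - rewrite csum_S. destruct (b M) eqn:E.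
      + split; [|intros H; rewrite H in E by lia; discriminate].
        rewrite IH2; [rewrite Cplus_0_l; auto|].
        intros i Hi. destruct (b i) eqn:E'; [|reflexivity].
        specialize (Hinj i M E' E). lia.
      + rewrite Cplus_0_r. split; [auto|]. intros H. apply IH2. intros i Hi. apply H. lia. }
  apply H.
Qed.

(** Against the kernel a trigonometric polynomial only shows finitely many terms,
    so that it contributes a bounded amount. *)
Lemma trig_power_kernel_bounded alpha Q : trig Q -> exists K, 0 <= K /\
  forall M v y, 0 <= y ->
    Cmod (Cint (fun u => Q u * power_kernel alpha M (e ((v - u)%R, y)))%C) <= K.
Proof.
  intros H. induction H as [c k|h1 h2 H1 [K1 [HK1 IH1]] H2 [K2 [HK2 IH2]]|h1 h2 E _ [K [HK IH]]].
  - assert (HB : 0 <= Rpower (INR k) alpha * Cmod c)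
      by (apply Rmult_le_pos; [left; apply Rpower_pos|apply Cmod_ge_0]).
    exists (Rpower (INR k) alpha * Cmod c). split; [auto|].
    intros M v y Hy.
    rewrite Cint_power_kernel by apply Ccont_scal, Ccont_e.
    rewrite (csum_ext _ (fun i => if Nat.eqb (S i) k then
      RtoC (Rpower (INR (S i)) alpha) * e (RtoC (INR (S i)) * (v, y)) * c else RtoC 0)%C).
    + apply csum_single_bound; [auto| |].
      * intros i i' Hi Hi'. apply Nat.eqb_eq in Hi, Hi'. lia.
      * intros i Hi. apply Nat.eqb_eq in Hi. rewrite <- Hi.
        rewrite !Cmod_mult, Cmod_R, Cmod_e, Rabs_right by (apply Rle_ge; left; apply Rpower_pos).
        apply Rmult_le_compat_r; [apply Cmod_ge_0|]. rewrite <- Rmult_1_r.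
        apply Rmult_le_compat_l; [left; apply Rpower_pos|].
        rewrite <- exp_0. apply exp_le. rewrite im_scal_l. simpl Im.
        assert (W := INR_S_ge_1 i). assert (HPI := PI_RGT_0).
        assert (0 <= INR (S i) * y) by nra. nra.
    + intros i _.
      assert (E : Cint (fun u => c * e (RtoC (INR k * u)) * e (RtoC (- INR (S i) * u)))%C =
                  (c * Cint (fun u => e (RtoC (IZR (Z.of_nat k - Z.of_nat (S i)) * u))))%C).
      { rewrite <- Cint_scal by apply Ccont_e. apply Cint_ext. intros u.
        rewrite <- Cmult_assoc, <- e_plus, <- RtoC_plus. f_equal. f_equal. f_equal.
        rewrite minus_IZR, <- !INR_IZR_INZ. ring. }
      rewrite E. destruct (Nat.eqb_spec (S i) k) as [->|Hne].
      * rewrite Z.sub_diag. rewrite (Cint_ext _ (fun _ => RtoC 1)).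
        -- rewrite Cint_1. ring.
        -- intros u. rewrite Rmult_0_l. apply e_0.
      * rewrite Cint_e by lia. ring.
  - exists (K1 + K2). split; [lra|]. intros M v y Hy.
    rewrite (Cint_ext _ (fun u => h1 u * power_kernel alpha M (e ((v - u)%R, y)) +
      h2 u * power_kernel alpha M (e ((v - u)%R, y)))%C) by (intros; ring).
    rewrite Cint_plus.
    + eapply Rle_trans; [apply Cmod_triangle|]. apply Rplus_le_compat; auto.
    + apply Ccont_mult; [now apply Ccont_trig|apply Ccont_power_kernel].
    + apply Ccont_mult; [now apply Ccont_trig|apply Ccont_power_kernel].
  - exists K. split; [auto|]. intros M v y Hy.
    rewrite (Cint_ext _ (fun u => h1 u * power_kernel alpha M (e ((v - u)%R, y)))%C); [auto|].
    intros u. now rewrite E.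
Qed.

Lemma Ccont_bounded h : Ccont h -> exists B, 0 < B /\ forall u, Rabs u <= 1 -> Cmod (h u) <= B.
Proof.
  intros [H1 H2].
  assert (K : forall f : R -> R, (forall x, continuous f x) -> exists B, forall u, Rabs u <= 1 ->
    Rabs (f u) <= B).
  { intros f Hf. destruct (continuity_ab_maj (fun u => Rabs (f u)) (-1) 1) as [m [Hm _]]; [lra| |].
    - intros c _. apply continuity_pt_filterlim.
      apply (continuous_comp f Rabs); [apply Hf|apply continuous_Rabs].
    - exists (Rabs (f m)). intros u Hu. apply Hm. now apply Rabs_le_between. }
  destruct (K _ H1) as [B1 HB1]. destruct (K _ H2) as [B2 HB2].
  assert (P1 := Rle_trans _ _ _ (Rabs_pos _) (HB1 0 ltac:(rewrite Rabs_R0; lra))).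
  assert (P2 := Rle_trans _ _ _ (Rabs_pos _) (HB2 0 ltac:(rewrite Rabs_R0; lra))).
  exists (B1 + B2 + 1). split; [lra|]. intros u Hu.
  eapply Rle_trans; [apply Cmod_le_Re_Im|]. specialize (HB1 u Hu). specialize (HB2 u Hu).
  cbv beta in *. lra.
Qed.

(** Near [x0] the polynomial is replaced by a trigonometric one of sufficient
    precision; at a distance from [x0] the difference is only bounded, which a
    large constant absorbs.  At [u = 0] the difference vanishes by continuity. *)
Lemma taylor_to_trig g x0 s p d K delta : Ccont g -> 0 < s -> 0 < delta -> 0 <= K ->
  (forall u, 0 < Rabs u < delta -> Cmod (g (x0 + u) - taylor p d u) <= K * Rpower (Rabs u) s) ->
  exists Q K', trig Q /\ 0 < K' /\
    forall u y, Rabs u <= 1 -> 0 < y -> Cmod (g (x0 + u) - Q u) <= K' * Rpower (Rabs u + y) s.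
Proof.
  intros Hg Hs Hdelta HK H.
  destruct (INR_unbounded s) as [D HD].
  destruct (trig_taylor p d D) as [Q [K1 [HQ [HK1 H1]]]].
  set (R0 := fun u => (g (x0 + u)%R - Q u)%C).
  assert (HR : Ccont R0).
  { apply Ccont_minus; [now apply Ccont_shift|now apply Ccont_trig]. }
  set (d1 := Rmin delta 1).
  assert (Hd1 : 0 < d1 <= 1) by (split; [apply Rmin_glb_lt; lra|apply Rmin_r]).
  assert (Hd1' : d1 <= delta) by apply Rmin_l.
  assert (Hnear : forall u, 0 < Rabs u < d1 -> Cmod (R0 u) <= (K + K1) * Rpower (Rabs u) s).
  { intros u Hu. unfold R0.
    replace (g (x0 + u)%R - Q u)%C with ((g (x0 + u)%R - taylor p d u) + (taylor p d u - Q u))%C by ring.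
    eapply Rle_trans; [apply Cmod_triangle|]. rewrite Rmult_plus_distr_r.
    apply Rplus_le_compat; [apply H; lra|].
    eapply Rle_trans; [apply H1; lra|]. apply Rmult_le_compat_l; [lra|].
    rewrite <- Rpower_pow by lra.
    apply Rpower_exponent_antitone; [lra|]. rewrite S_INR. lra. }
  assert (H0 : R0 0 = RtoC 0).
  { apply Cmod_eq_0_eps. intros eps He.
    destruct (Ccont_eps R0 0 HR (eps / 2)) as [d2 [Hd2 HR2]]; [lra|].
    destruct (power_small (K + K1) s (eps / 2)) as [d3 [Hd3 Hsm]]; [auto|lra|].
    set (t := Rmin d1 (Rmin d2 d3) / 2).
    assert (M1 := Rmin_l d1 (Rmin d2 d3)). assert (M2 := Rmin_r d1 (Rmin d2 d3)).
    assert (M3 := Rmin_l d2 d3). assert (M4 := Rmin_r d2 d3).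
    assert (M5 : 0 < Rmin d1 (Rmin d2 d3)) by (repeat apply Rmin_glb_lt; lra).
    assert (Ht : 0 < t) by (unfold t; lra).
    assert (Hta : Rabs t = t) by (apply Rabs_right; lra).
    assert (N1 := HR2 t ltac:(rewrite Rminus_0_r, Hta; unfold t; lra)).
    assert (N2 := Hnear t ltac:(rewrite Hta; unfold t in *; lra)). rewrite Hta in N2.
    assert (N3 := Hsm t ltac:(unfold t in *; lra)).
    replace (R0 0) with (R0 t + - (R0 t - R0 0))%C by ring.
    eapply Rle_trans; [apply Cmod_triangle|]. rewrite Cmod_opp. lra. }
  destruct (Ccont_bounded R0 HR) as [B [HB HRB]].
  assert (HBs : 0 < B * Rpower d1 (- s)) by (apply Rmult_lt_0_compat; [auto|apply Rpower_pos]).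
  exists Q, (K + K1 + B * Rpower d1 (- s)). split; [auto|]. split; [lra|]. intros u y Hu Hy.
  fold (R0 u). assert (Hu0 := Rabs_pos u). assert (W := Rpower_pos (Rabs u + y) s).
  destruct (Rle_lt_dec d1 (Rabs u)) as [L|L].
  - eapply Rle_trans; [apply HRB; auto|].
    assert (V : 1 <= Rpower d1 (- s) * Rpower (Rabs u + y) s).
    { rewrite Rpower_Ropp. assert (P := Rpower_pos d1 s).
      apply (Rmult_le_reg_l (Rpower d1 s)); [auto|].
      rewrite Rmult_1_r, <- Rmult_assoc, Rinv_r, Rmult_1_l by lra.
      apply Rle_Rpower_l; lra. }
    rewrite !Rmult_plus_distr_r, (Rmult_assoc B).
    assert (0 <= K * Rpower (Rabs u + y) s) by (apply Rmult_le_pos; lra).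
    assert (0 <= K1 * Rpower (Rabs u + y) s) by (apply Rmult_le_pos; lra). nra.
  - destruct (Req_dec u 0) as [->|Hne].
    + rewrite H0, Cmod_0. apply Rmult_le_pos; lra.
    + assert (Hup := Rabs_pos_lt u Hne).
      eapply Rle_trans; [apply Hnear; lra|].
      apply Rmult_le_compat; [lra|left; apply Rpower_pos|lra|].
      apply Rle_Rpower_l; lra.
Qed.

(** A wavelet-type estimate: Hölder regularity [s] at [x0] of the fractional integral
    forces [f] to be [O(y ^ (s - alpha))] in the cones over [x0].  The function
    [f] is recovered by integrating against [sum n ^ alpha e(n z)]. *)
Lemma regularity_bounds_form A f alpha (g : R -> C) x0 kappa s p d K delta T :
  fourier_expansion A f -> Ccont g -> kappa <> RtoC 0 ->
  (forall i, Cint (fun u => g (x0 + u)%R * e (RtoC (- INR (S i) * u)))%C =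
             (kappa * (weighted A alpha i * e (RtoC (INR (S i) * x0))))%C) ->
  0 < s < alpha -> 0 < delta -> 0 <= K -> 0 < T ->
  (forall u, 0 < Rabs u < delta -> Cmod (g (x0 + u) - taylor p d u) <= K * Rpower (Rabs u) s) ->
  exists K1 K2 eta, 0 < eta /\ forall x y, 0 < y < eta -> Rabs (x - x0) <= T * y ->
    Cmod (f (x, y)) <= K1 + K2 * Rpower y (s - alpha).
Proof.
  intros HA Hg Hkap Hco Hs Hdelta HK HT H.
  destruct (taylor_to_trig g x0 s p d K delta Hg ltac:(lra) Hdelta HK H)
    as [Q [K' [HQ [HK' HgQ]]]].
  destruct (trig_power_kernel_bounded alpha Q HQ) as [KQ [HKQ HQb]].
  destruct (power_kernel_bound alpha ltac:(lra)) as (J & KP & HKP & HPb).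
  destruct one_minus_e_lower as [c [Hc Hlow]].
  set (c1 := c / (T + 1)). assert (Hc1 : 0 < c1) by (apply Rdiv_lt_0_compat; lra).
  assert (HPI := PI_RGT_0).
  set (A1 := K' * (KP * Rpower c1 (- alpha - 1))).
  assert (HA1 : 0 < A1) by (unfold A1; assert (W := Rpower_pos c1 (- alpha - 1)); repeat apply Rmult_lt_0_compat; auto).
  assert (Hkm : 0 < Cmod kappa) by (now apply Cmod_gt_0).
  set (K2 := 4 * A1 / (alpha - s)).
  exists (KQ / Cmod kappa), (K2 / Cmod kappa), (/ (4 * (T + 1))).
  split; [apply Rinv_0_lt_compat; lra|]. intros x y [Hy Hye] Hx.
  assert (HTy : (T + 1) * y < 1/4).
  { apply (Rmult_lt_compat_l (4 * (T + 1))) in Hye; [|lra]. rewrite Rinv_r in Hye by lra. lra. }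
  assert (Hy1 : y <= 1) by nra.
  assert (Hcy : 0 < c1 * y) by nra.
  assert (Hlow' : forall u, Rabs u <= 1/2 ->
     c1 * (Rabs u + y) <= Cmod (1 - e (((x - x0) - u)%R, y))%C).
  { intros u Hu. set (v := x - x0) in *.
    assert (V1 : Rabs (v - u) <= 3/4).
    { unfold Rminus. eapply Rle_trans; [apply Rabs_triang|]. rewrite Rabs_Ropp. nra. }
    eapply Rle_trans; [|apply Hlow; [auto|lra]].
    assert (V2 : Rabs u <= Rabs (v - u) + Rabs v).
    { replace u with (v + - (v - u)) at 1 by ring. eapply Rle_trans; [apply Rabs_triang|].
      rewrite Rabs_Ropp. lra. }
    assert (V3 := Rabs_pos (v - u)).
    assert (V4 : Rabs u + y <= (T + 1) * (Rabs (v - u) + y)) by nra.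
    apply (Rmult_le_compat_l c1) in V4; [|lra].
    replace (c1 * ((T + 1) * (Rabs (v - u) + y))) with (c * (Rabs (v - u) + y)) in V4
      by (unfold c1; field; lra). exact V4. }
  assert (Hlow2 : forall u, Rabs u <= 1/2 -> c1 * y <= Cmod (1 - e (((x - x0) - u)%R, y))%C).
  { intros u Hu. eapply Rle_trans; [|apply Hlow'; auto]. assert (W := Rabs_pos u). nra. }
  (* partial sums long enough for [power_kernel_bound] to apply at this height,
     uniformly in the variable of integration *)
  destruct (power_exp_lim alpha (2 * PI * y) ltac:(nra) (Rpower (c1 * y) (INR J)) (Rpower_pos _ _))
    as [N1 [HN1 HN1b]].
  destruct (INR_unbounded (/ (c1 * y))) as [N2 HN2].
  assert (Hfin : forall M, (max N1 N2 <= M)%nat ->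
    Cmod (kappa * csum (fun i => A i * e (RtoC (INR (S i)) * (x, y))) M)%C
    <= KQ + K2 * Rpower y (s - alpha)).
  { intros M HM.
    assert (E : (kappa * csum (fun i => A i * e (RtoC (INR (S i)) * (x, y))) M)%C =
      Cint (fun u => g (x0 + u)%R * power_kernel alpha M (e (((x - x0) - u)%R, y)))%C).
    { rewrite (Cint_power_kernel (fun u => g (x0 + u))) by (now apply Ccont_shift).
      rewrite <- csum_mult_l. apply csum_ext. intros i _. rewrite Hco. unfold weighted.
      replace (RtoC (INR (S i)) * (x, y))%C
        with (RtoC (INR (S i)) * ((x - x0)%R, y) + RtoC (INR (S i) * x0))%C
        by (apply C_ext; simpl; ring).
      rewrite e_plus.
      assert (P : (RtoC (Rpower (INR (S i)) alpha) * RtoC (Rpower (INR (S i)) (- alpha)))%C = RtoC 1).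
      { rewrite <- RtoC_mult, <- Rpower_plus, Rplus_opp_r, Rpower_O; [reflexivity|].
        assert (W := INR_S_ge_1 i). lra. }
      transitivity (kappa * (A i * (e (RtoC (INR (S i)) * ((x - x0)%R, y)) * e (RtoC (INR (S i) * x0))))
        * (RtoC (Rpower (INR (S i)) alpha) * RtoC (Rpower (INR (S i)) (- alpha))))%C;
        [rewrite P; ring|ring]. }
    rewrite E. set (kern := fun u => power_kernel alpha M (e (((x - x0) - u)%R, y))).
    assert (Hkern : Ccont kern) by apply Ccont_power_kernel.
    rewrite (Cint_ext _ (fun u => Q u * kern u + (g (x0 + u)%R - Q u) * kern u)%C)
      by (intros u; unfold kern; ring).
    rewrite Cint_plus.
    2: { apply Ccont_mult; [now apply Ccont_trig|auto]. }
    2: { apply Ccont_mult; [apply Ccont_minus; [now apply Ccont_shift|now apply Ccont_trig]|auto]. }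
    eapply Rle_trans; [apply Cmod_triangle|]. apply Rplus_le_compat; [apply HQb; lra|].
    eapply Rle_trans; [apply (Cint_power_bound _ A1 0 (alpha - s) y)|].
    - apply Ccont_mult; [apply Ccont_minus; [now apply Ccont_shift|now apply Ccont_trig]|auto].
    - lra.
    - auto.
    - lra.
    - intros u Hu. assert (Hu1 : Rabs u <= 1/2) by (apply Rabs_le; lra).
      assert (Hu0 := Rabs_pos u). rewrite Rplus_0_r, Cmod_mult.
      assert (L1 := Hlow' u Hu1). assert (L2 := Hlow2 u Hu1).
      set (w := e (((x - x0) - u)%R, y)) in *.
      assert (Hw : Cmod w = exp (- (2 * PI * y))) by apply Cmod_e.
      assert (Hkb : Cmod (kern u) <= KP * Rpower (Cmod (1 - w)) (- alpha - 1)).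
      { apply HPb.
        - rewrite Hw. left. apply exp_neg_lt_1. nra.
        - lra.
        - apply Rle_trans with (INR N2); [|apply le_INR; lia].
          apply Rle_trans with (/ (c1 * y)); [apply Rinv_le_contravar; lra|lra].
        - apply Rle_trans with (Rpower (c1 * y) (INR J)).
          + specialize (HN1b (S M) ltac:(lia)). eapply Rle_trans; [|exact HN1b].
            right. f_equal. rewrite Hw, <- Rpower_pow by apply exp_pos.
            unfold Rpower. rewrite ln_exp. f_equal. ring.
          + apply Rle_Rpower_l; [apply pos_INR|lra]. }
      assert (Hpow : Rpower (Cmod (1 - w)) (- alpha - 1)
                 <= Rpower c1 (- alpha - 1) * Rpower (Rabs u + y) (- alpha - 1)).
      { rewrite Rpower_mult_distr by lra. apply Rpower_antitone; [|lra]. split; [nra|auto]. }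
      apply Rle_trans with ((K' * Rpower (Rabs u + y) s) *
        (KP * (Rpower c1 (- alpha - 1) * Rpower (Rabs u + y) (- alpha - 1)))).
      + apply Rmult_le_compat; try apply Cmod_ge_0.
        * apply HgQ; lra.
        * eapply Rle_trans; [exact Hkb|]. apply Rmult_le_compat_l; lra.
      + right. unfold A1. replace (- (alpha - s) - 1) with (s + (- alpha - 1)) by ring.
        rewrite (Rpower_plus s). ring.
    - right. unfold K2. replace (- (alpha - s)) with (s - alpha) by ring. ring. }
  assert (HC : Cmod (f (x, y) - 0)%C <= (KQ + K2 * Rpower y (s - alpha)) / Cmod kappa).
  { apply (Clim_le _ _ _ _ (max N1 N2) (HA (x, y) Hy)). intros n Hn.
    specialize (Hfin n Hn). rewrite Cmod_mult in Hfin.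
    replace (csum (fun i => A i * e (RtoC (INR (S i)) * (x, y)))%C n - 0)%C
      with (csum (fun i => A i * e (RtoC (INR (S i)) * (x, y)))%C n) by ring.
    apply (Rmult_le_reg_l (Cmod kappa)); [auto|].
    replace (Cmod kappa * ((KQ + K2 * Rpower y (s - alpha)) / Cmod kappa))
      with (KQ + K2 * Rpower y (s - alpha)) by (field; lra). exact Hfin. }
  replace (f (x, y) - 0)%C with (f (x, y)) in HC by ring.
  eapply Rle_trans; [exact HC|]. right. field. lra.
Qed.

Lemma Cs_taylor s x0 g : Cs s x0 g -> Ccont g /\
  exists d p K delta, 0 <= K /\ 0 < delta /\ INR d <= s /\
    forall u, 0 < Rabs u < delta -> Cmod (g (x0 + u) - taylor p d u) <= K * Rpower (Rabs u) s.
Proof.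
  intros [Hc (d & p & K & Hd & Hloc)]. split; [now apply continuous_Ccont|].
  destruct Hloc as [delta Hdelta].
  exists d, p, (Rabs K), delta. split; [apply Rabs_pos|]. split; [apply cond_pos|].
  split; [auto|]. intros u Hu.
  assert (Hne : x0 + u <> x0) by (intros E; assert (u = 0) by lra; subst; rewrite Rabs_R0 in Hu; lra).
  assert (Hb : ball x0 delta (x0 + u)).
  { unfold ball; simpl; unfold AbsRing_ball, abs, minus, plus, opp; simpl.
    replace (x0 + u + - x0) with u by ring. lra. }
  specialize (Hdelta (x0 + u) Hb Hne). cbv beta in Hdelta.
  rewrite csum_sum_n in Hdelta. replace (x0 + u - x0) with u in Hdelta by ring.
  eapply Rle_trans; [exact Hdelta|]. apply Rmult_le_compat_r; [left; apply Rpower_pos|apply Rle_abs].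
Qed.

(** A lower bound [y ^ (- r / 2)] and an upper bound [1 + y ^ (s - alpha)] up to
    constants exclude each other as [y] tends to 0 if [alpha - r / 2 < s]. *)
Lemma Cs_upper_bound A f alpha r T c g x0 kappa s :
  fourier_expansion A f -> kappa <> RtoC 0 -> 0 < r -> r / 2 < alpha -> 0 < T -> 0 < c ->
  (Ccont g -> forall i, Cint (fun u => g (x0 + u)%R * e (RtoC (- INR (S i) * u)))%C =
             (kappa * (weighted A alpha i * e (RtoC (INR (S i) * x0))))%C) ->
  (forall eta, 0 < eta -> exists x y, 0 < y < eta /\ Rabs (x - x0) <= T * y /\
      c * Rpower y (- (r / 2)) <= Cmod (f (x, y))) ->
  Cs s x0 g -> s <= alpha - r / 2.
Proof.
  intros HA Hkap Hr Halpha HT Hc Hco Hlarge HCs.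
  apply Rnot_lt_le. intros Hlt.
  destruct (Cs_taylor s x0 g HCs) as [Hg (d & p & K & delta & HK & Hdelta & _ & Hb)].
  (* the size [y ^ (s - alpha)] requires an exponent below [alpha] *)
  set (s' := Rmin s (alpha - r / 4)).
  assert (Hs1 : s' <= s) by apply Rmin_l. assert (Hs2 : s' <= alpha - r / 4) by apply Rmin_r.
  assert (Hs3 : alpha - r / 2 < s') by (apply Rmin_glb_lt; lra).
  destruct (regularity_bounds_form A f alpha g x0 kappa s' p d K (Rmin delta 1) T)
    as (K1 & K2 & eta & Heta & Hbound); auto; try lra.
  { apply Rmin_glb_lt; lra. }
  { intros u Hu. assert (M1 := Rmin_l delta 1). assert (M2 := Rmin_r delta 1).
    eapply Rle_trans; [apply Hb; lra|]. apply Rmult_le_compat_l; [auto|].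
    apply Rpower_exponent_antitone; lra. }
  destruct (power_small K1 (r / 2) (c / 4)) as [d1 [Hd1 Hs1']]; [lra|lra|].
  destruct (power_small K2 (s' - alpha + r / 2) (c / 4)) as [d2 [Hd2 Hs2']]; [lra|lra|].
  assert (M1 := Rmin_l eta (Rmin d1 d2)). assert (M2 := Rmin_r eta (Rmin d1 d2)).
  assert (M3 := Rmin_l d1 d2). assert (M4 := Rmin_r d1 d2).
  destruct (Hlarge (Rmin eta (Rmin d1 d2))) as (x & y & Hy & Hx & Hf).
  { repeat apply Rmin_glb_lt; auto. }
  specialize (Hbound x y ltac:(lra) Hx). specialize (Hs1' y ltac:(lra)). specialize (Hs2' y ltac:(lra)).
  set (Y := Rpower y (r / 2)) in *. assert (HY : 0 < Y) by apply Rpower_pos.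
  set (Z := Rpower y (s' - alpha + r / 2)) in *. assert (HZ : 0 < Z) by apply Rpower_pos.
  assert (E1 : Rpower y (- (r / 2)) * Y = 1).
  { unfold Y. rewrite <- Rpower_plus, Rplus_opp_l, Rpower_O; lra. }
  assert (E2 : Rpower y (s' - alpha) * Y = Z) by (unfold Y, Z; rewrite <- Rpower_plus; reflexivity).
  assert (F : c * Rpower y (- (r / 2)) <= K1 + K2 * Rpower y (s' - alpha)) by lra.
  apply (Rmult_le_compat_r Y) in F; [|lra].
  rewrite Rmult_assoc, E1, Rmult_plus_distr_r, Rmult_assoc, E2 in F.
  lra.
Qed.

(** * Real and imaginary parts *)

Lemma holder_expansion_Cs g x0 s : Ccont g -> holder_expansion g x0 s -> Cs s x0 g.
Proof.
  intros Hg (d & p & K & HK & Hd & _ & H). split; [now apply Ccont_continuous|].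
  exists d, p, K. split; [auto|]. exists (mkposreal 1 Rlt_0_1). intros x Hx Hne.
  rewrite csum_sum_n. replace x with (x0 + (x - x0)) at 1 by ring.
  apply H. split; [apply Rabs_pos_lt; lra|].
  unfold ball in Hx; simpl in Hx; unfold AbsRing_ball, abs, minus, plus, opp in Hx; simpl in Hx.
  exact Hx.
Qed.

(** The factor [mu] is 1 for the cosine series and [- i] for the sine series. *)
Definition real_part (mu : C) (g : R -> C) (x : R) : C := RtoC (Re (mu * g x)%C).

Lemma real_part_taylor mu p d h :
  taylor (fun k => RtoC (Re (mu * p k)%C)) d h = real_part mu (taylor p d) h.
Proof.
  unfold real_part, taylor. rewrite <- csum_mult_l.
  induction (S d) as [|n IH]; [reflexivity|].
  rewrite !csum_S, IH, Re_plus, Cmult_assoc, re_scal_r, RtoC_plus, RtoC_mult. reflexivity.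
Qed.

Lemma holder_expansion_real_part mu g x0 s : holder_expansion g x0 s ->
  holder_expansion (real_part mu g) x0 s.
Proof.
  intros (d & p & K & HK & Hd & Hp0 & H). assert (Hm := Cmod_ge_0 mu).
  exists d, (fun k => RtoC (Re (mu * p k)%C)), ((Cmod mu + 1) * K).
  split; [apply Rmult_lt_0_compat; lra|]. split; [auto|].
  split; [unfold real_part; now rewrite Hp0|]. intros h Hh.
  rewrite real_part_taylor. unfold real_part. rewrite <- RtoC_minus, <- Re_minus, Cmod_R.
  eapply Rle_trans; [apply re_le_Cmod|].
  replace (mu * g (x0 + h)%R - mu * taylor p d h)%C with (mu * (g (x0 + h)%R - taylor p d h))%C by ring.
  rewrite Cmod_mult, Rmult_assoc. apply Rmult_le_compat; auto using Cmod_ge_0. lra.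
Qed.

Lemma Ccont_conj h : Ccont h -> Ccont (fun t => Cconj (h t)).
Proof.
  intros [H1 H2]. split; intros x; simpl; [apply H1|].
  apply (continuous_opp (fun t => Im (h t))), H2.
Qed.

Lemma Cint_conj h : Ccont h -> Cint (fun t => Cconj (h t)) = Cconj (Cint h).
Proof.
  intros [H1 H2]. apply C_ext; simpl; [reflexivity|].
  apply (RInt_opp (fun t => Im (h t))). now apply ex_RInt_cont.
Qed.

(** The conjugate of a series with positive frequencies has none, so that real
    and imaginary parts keep the positive Fourier coefficients up to a constant. *)
Lemma Cint_conj_coef c h i : uniform_fourier c h ->
  Cint (fun t => Cconj (h t) * e (RtoC (- INR (S i) * t)))%C = RtoC 0.
Proof.
  intros H. assert (Hh := uniform_fourier_cont _ _ H).
  rewrite (Cint_ext _ (fun t => Cconj (h t * e (RtoC (INR (S i) * t)))%C)).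
  - rewrite Cint_conj by (apply Ccont_mult; [auto|apply Ccont_e]).
    rewrite (uniform_fourier_coef_pos c h (S i) H). apply C_ext; simpl; ring.
  - intros t. rewrite <- Ropp_mult_distr_l, e_conj.
    generalize (h t) (e (RtoC (INR (S i) * t))). intros [a b] [c' d]. apply C_ext; simpl; ring.
Qed.

Lemma uniform_fourier_shift c h x0 : uniform_fourier c h ->
  uniform_fourier (fun i => c i * e (RtoC (INR (S i) * x0)))%C (fun u => h (x0 + u)).
Proof.
  intros H eps He. destruct (H eps He) as [M0 HM]. exists M0. intros M t Hn.
  specialize (HM M (x0 + t) Hn). unfold fourier_sum in *.
  rewrite (csum_ext _ (fun i => c i * e (RtoC (INR (S i) * (x0 + t))))%C); [auto|].
  intros i _. rewrite <- Cmult_assoc, <- e_plus, <- RtoC_plus. do 3 f_equal. ring.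
Qed.

Lemma real_part_coef mu c h i : uniform_fourier c h ->
  Cint (fun t => real_part mu h t * e (RtoC (- INR (S i) * t)))%C = (RtoC (1/2) * mu * c i)%C.
Proof.
  intros H. assert (Hh := uniform_fourier_cont _ _ H).
  rewrite (Cint_ext _ (fun t => RtoC (1/2) * mu * (h t * e (RtoC (- INR (S i) * t))) +
     RtoC (1/2) * Cconj mu * (Cconj (h t) * e (RtoC (- INR (S i) * t))))%C).
  - assert (C1 : Ccont (fun t => h t * e (RtoC (- INR (S i) * t)))%C)
      by (apply Ccont_mult; [auto|apply Ccont_e]).
    assert (C2 : Ccont (fun t => Cconj (h t) * e (RtoC (- INR (S i) * t)))%C)
      by (apply Ccont_mult; [now apply Ccont_conj|apply Ccont_e]).
    rewrite Cint_plus by (now apply Ccont_scal). rewrite !Cint_scal by auto.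
    rewrite (uniform_fourier_coef c h i H), (Cint_conj_coef c h i H). ring.
  - intros t. unfold real_part. generalize (h t) (e (RtoC (- INR (S i) * t))).
    destruct mu as [m1 m2]. intros [a b] [c' d]. apply C_ext; simpl; field.
Qed.

(** * The three series of the theorem *)

Lemma Series_zero (u : nat -> R) : (forall n, u n = 0) -> Series u = 0.
Proof.
  intros H. rewrite (Series_ext u (fun n => 0 * u n)).
  - rewrite Series_scal_l. ring.
  - intros n. rewrite H. ring.
Qed.

Lemma f_exp_frac_series a alpha x : f_exp a alpha x = frac_series (fun i => a (S i)) alpha x.
Proof.
  unfold f_exp, frac_series, CSeries, weighted.
  assert (E : forall n, (a (S n) / RtoC (Rpower (INR (S n)) alpha) * e (RtoC (INR (S n) * x)))%C
    = (a (S n) * RtoC (Rpower (INR (S n)) (- alpha)) * e (RtoC (INR (S n) * x)))%C).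
  { intros n. unfold Cdiv. rewrite Rpower_Ropp, RtoC_inv; [reflexivity|].
    assert (W := Rpower_pos (INR (S n)) alpha). lra. }
  f_equal; apply Series_ext; intros n; now rewrite E.
Qed.

Lemma real_terms_Series (u : nat -> R) : CSeries (fun n => RtoC (u n)) = RtoC (Series u).
Proof.
  apply C_ext; simpl; [reflexivity|]. now apply Series_zero.
Qed.

Lemma CSeries_ext u v : (forall n, u n = v n) -> CSeries u = CSeries v.
Proof.
  intros H. apply C_ext; simpl; apply Series_ext; intros n; now rewrite H.
Qed.

Lemma real_term b w t : Im b = 0 -> w <> 0 ->
  (b / RtoC w * RtoC (cos (2 * PI * t)))%C = RtoC (Re (b / RtoC w * e (RtoC t))%C) /\
  (b / RtoC w * RtoC (sin (2 * PI * t)))%C = RtoC (Im (b / RtoC w * e (RtoC t))%C).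
Proof.
  intros Hb Hw. destruct b as [b1 b2]; simpl in Hb; subst.
  unfold Cdiv. rewrite <- RtoC_inv, e_R by auto.
  split; apply C_ext; simpl; ring.
Qed.

Lemma f_cos_Re a alpha : (forall n : nat, (1 <= n)%nat -> Im (a n) = 0) ->
  forall x, f_cos a alpha x = RtoC (Re (f_exp a alpha x)).
Proof.
  intros Ha x. transitivity (RtoC (Series (fun n =>
    Re (a (S n) / RtoC (Rpower (INR (S n)) alpha) * e (RtoC (INR (S n) * x)))%C))); [|reflexivity].
  rewrite <- real_terms_Series. apply CSeries_ext. intros n. rewrite (Rmult_assoc (2 * PI)).
  apply real_term; [apply Ha; lia|]. assert (W := Rpower_pos (INR (S n)) alpha). lra.
Qed.

Lemma f_sin_Im a alpha : (forall n : nat, (1 <= n)%nat -> Im (a n) = 0) ->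
  forall x, f_sin a alpha x = RtoC (Im (f_exp a alpha x)).
Proof.
  intros Ha x. transitivity (RtoC (Series (fun n =>
    Im (a (S n) / RtoC (Rpower (INR (S n)) alpha) * e (RtoC (INR (S n) * x)))%C))); [|reflexivity].
  rewrite <- real_terms_Series. apply CSeries_ext. intros n. rewrite (Rmult_assoc (2 * PI)).
  apply real_term; [apply Ha; lia|]. assert (W := Rpower_pos (INR (S n)) alpha). lra.
Qed.

Lemma Cs_ext s x0 g1 g2 : (forall x, g1 x = g2 x) -> Cs s x0 g1 -> Cs s x0 g2.
Proof.
  intros E [H1 (d & p & K & Hd & H)]. split.
  - intros x. apply (continuous_ext g1); auto.
  - exists d, p, K. split; [auto|]. revert H. apply filter_imp. intros x Hx.
    rewrite <- E. auto.
Qed.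

Lemma holder_exponent_ext g1 g2 x : (forall t, g1 t = g2 t) ->
  holder_exponent g1 x = holder_exponent g2 x.
Proof.
  intros E. apply Lub_Rbar_eqset. intros s. split; intros [H1 H2]; split; auto.
  - now apply (Cs_ext s x g1).
  - apply (Cs_ext s x g2); auto.
Qed.

Lemma holder_exponent_eq g x sigma : 0 < sigma ->
  (forall s, 0 <= s < sigma -> Cs s x g) -> (forall s, Cs s x g -> s <= sigma) ->
  holder_exponent g x = Finite sigma.
Proof.
  intros Hs Hlow Hup. apply is_lub_Rbar_unique. split.
  - intros s [_ H]. simpl. auto.
  - intros b Hb. destruct b as [b| |]; simpl; auto.
    + apply Rnot_lt_le. intros Hlt.
      set (s := (Rmax 0 b + sigma) / 2).
      assert (M1 := Rmax_l 0 b). assert (M2 := Rmax_r 0 b).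
      assert (M3 : Rmax 0 b < sigma) by (apply Rmax_lub_lt; auto).
      assert (Q := Hb s). simpl in Q. unfold s in Q.
      assert (Q' : (Rmax 0 b + sigma) / 2 <= b); [|lra].
      apply Q. split; [lra|]. apply Hlow. lra.
    + assert (Q := Hb 0). simpl in Q. apply Q. split; [lra|]. apply Hlow. lra.
Qed.

(** * Spectrum *)

Lemma rationals_enumerated : exists enum : nat -> R, forall x, ~ irrational x -> exists n, enum n = x.
Proof.
  exists (fun n => let (ab, c) := Cantor.of_nat n in let (a, b) := Cantor.of_nat ab in
                   (INR a - INR b) / (INR c + 1)).
  intros x Hx. apply not_all_ex_not in Hx. destruct Hx as [p Hx].
  apply not_all_ex_not in Hx. destruct Hx as [q Hx].
  apply imply_to_and in Hx. destruct Hx as [Hq Hx]. apply NNPP in Hx.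
  exists (Cantor.to_nat (Cantor.to_nat (Z.to_nat p, Z.to_nat (- p)), Z.to_nat (q - 1))).
  rewrite !Cantor.cancel_of_to, !INR_IZR_INZ, <- minus_IZR.
  replace (Z.of_nat (Z.to_nat p) - Z.of_nat (Z.to_nat (- p)))%Z with p by lia.
  rewrite Z2Nat.id by lia. rewrite minus_IZR.
  assert (Hq' : 0 < IZR q) by (now apply IZR_lt).
  rewrite <- Hx. field. lra.
Qed.

Lemma diam_singleton c : diam (fun x => x = c) = Finite 0.
Proof.
  apply is_lub_Rbar_unique. split.
  - intros d [->|(x & y & -> & -> & ->)]; simpl; [lra|].
    rewrite Rminus_diag, Rabs_R0. lra.
  - intros b Hb. apply Hb. now left.
Qed.

Lemma pospow_nonneg t s : 0 <= pospow t s.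
Proof. unfold pospow. destruct (Rle_dec t 0); [lra|left; apply Rpower_pos]. Qed.

(** Singletons have diameter 0 and cost nothing as a covering. *)
Lemma premeasure_countable s delta A (enum : nat -> R) : 0 < delta ->
  (forall x, A x -> exists n, enum n = x) -> hausdorff_premeasure s delta A = Finite 0.
Proof.
  intros Hd HA. apply Rbar_is_glb_unique. split.
  - intros v (U & _ & _ & ->). rewrite <- (Lim_seq_const 0). apply Lim_seq_le_loc.
    exists O. intros n _. rewrite rsum_sum_n. apply rsum_pos. intros i _. apply pospow_nonneg.
  - intros b Hb. apply Hb. exists (fun n x => x = enum n). split; [|split].
    + intros x Hx. destruct (HA x Hx) as [n Hn]. exists n. auto.
    + intros n. rewrite diam_singleton. simpl. lra.
    + rewrite <- (Lim_seq_const 0). apply Lim_seq_ext. intros n. rewrite rsum_sum_n.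
      rewrite (rsum_ext _ (fun _ => 0 * 0)).
      * rewrite rsum_mult_l. ring.
      * intros i _. rewrite diam_singleton. unfold pospow. simpl.
        destruct (Rle_dec 0 0); lra.
Qed.

Lemma hausdorff_dim_countable A (enum : nat -> R) :
  (forall x, A x -> exists n, enum n = x) -> hausdorff_dim A = Finite 0.
Proof.
  intros HA.
  assert (H : forall s, hausdorff_measure s A = Finite 0).
  { intros s. apply Rbar_is_lub_unique. split.
    - intros v (delta & Hd & ->). rewrite (premeasure_countable s delta A enum Hd HA). simpl. lra.
    - intros b Hb. apply Hb. exists 1. split; [lra|].
      symmetry. apply (premeasure_countable s 1 A enum); auto. lra. }
  apply is_glb_Rbar_unique. split.
  - intros s [Hs _]. simpl. lra.
  - intros b Hb. destruct b as [b| |]; simpl; auto.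
    + apply Rnot_lt_le. intros Hlt.
      assert (Hb2 : 0 < b / 2) by lra.
      assert (Q := Hb (b / 2) (conj Hb2 (H _))). simpl in Q. lra.
    + exact (Hb 1 (conj Rlt_0_1 (H 1))).
Qed.

Lemma Rbar_nbhd_and l V W : Rbar_nbhd l V -> Rbar_nbhd l W -> Rbar_nbhd l (fun y => V y /\ W y).
Proof.
  destruct l as [x| |]; simpl.
  - intros [e1 H1] [e2 H2].
    assert (He : 0 < Rmin e1 e2) by (apply Rmin_glb_lt; apply cond_pos).
    exists (mkposreal _ He). simpl. assert (M1 := Rmin_l e1 e2). assert (M2 := Rmin_r e1 e2).
    intros y Hy1 Hy2. split; [apply H1|apply H2]; destruct y; simpl in *; auto; lra.
  - intros [M1 H1] [M2 H2]. exists (Rmax M1 M2).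
    assert (Q1 := Rmax_l M1 M2). assert (Q2 := Rmax_r M1 M2).
    intros y Hy. split; [apply H1|apply H2]; destruct y; simpl in *; auto; lra.
  - intros [M1 H1] [M2 H2]. exists (Rmin M1 M2).
    assert (Q1 := Rmin_l M1 M2). assert (Q2 := Rmin_r M1 M2).
    intros y Hy. split; [apply H1|apply H2]; destruct y; simpl in *; auto; lra.
Qed.

Lemma Rbar_nbhd_imp l (V W : Rbar -> Prop) : (forall y, V y -> W y) -> Rbar_nbhd l V -> Rbar_nbhd l W.
Proof.
  intros H. destruct l; simpl; intros [M HM]; exists M; auto.
Qed.

Lemma Rbar_nbhd_separates l a : Rbar_nbhd l (fun y => y = a -> l = a).
Proof.
  destruct l as [x| |], a as [t| |]; simpl.
  - destruct (Req_dec x t) as [->|Hne].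
    + exists (mkposreal 1 Rlt_0_1). auto.
    + assert (He : 0 < Rabs (x - t)) by (apply Rabs_pos_lt; lra).
      exists (mkposreal _ He). simpl. intros y H1 H2 ->. simpl in *.
      exfalso. revert H1 H2. unfold Rabs. destruct (Rcase_abs (x - t)); lra.
  - exists (mkposreal 1 Rlt_0_1). intros y H1 H2 ->. contradiction.
  - exists (mkposreal 1 Rlt_0_1). intros y H1 H2 ->. contradiction.
  - exists t. intros y H1 ->. simpl in H1. lra.
  - exists 0. auto.
  - exists 0. intros y H1 ->. contradiction.
  - exists t. intros y H1 ->. simpl in H1. lra.
  - exists 0. intros y H1 ->. contradiction.
  - exists 0. auto.
Qed.

Lemma discrete_three (S : Rbar -> Prop) a b c :
  (forall y, S y -> y = a \/ y = b \/ y = c) -> discrete S.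
Proof.
  intros H l _.
  eapply Rbar_nbhd_imp; [|exact (Rbar_nbhd_and _ _ _ (Rbar_nbhd_separates l a)
    (Rbar_nbhd_and _ _ _ (Rbar_nbhd_separates l b) (Rbar_nbhd_separates l c)))].
  intros y (Ha & Hb & Hc) Hy. destruct (H y Hy) as [E|[E|E]]; rewrite E; symmetry; auto.
Qed.

(** Only one level set can contain irrational points; the others are countable
    and have dimension 0. *)
Lemma not_multifractal g sigma : (forall x, irrational x -> holder_exponent g x = Finite sigma) ->
  ~ multifractal g.
Proof.
  intros H Hm. apply Hm. clear Hm.
  apply (discrete_three _ m_infty (Finite 0) (spectrum g (Finite sigma))).
  intros y [delta <-]. destruct (Rbar_eq_dec delta (Finite sigma)) as [->|Hne]; [auto|].
  assert (Hs : spectrum g delta = m_infty \/ spectrum g delta = Finite 0); [|tauto].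
  unfold spectrum. destruct (excluded_middle_informative _) as [_|_]; [right|now left].
  destruct rationals_enumerated as [enum Henum].
  apply (hausdorff_dim_countable _ enum). intros x [_ Hx]. apply Henum. intros Hirr.
  apply Hne. rewrite <- Hx. auto.
Qed.

Theorem corollary3p2 (G : M2Z -> Prop) (r alpha : R) (f : C -> C) (a : nat -> C)
  (hG : congruence_group G)
  (hwidth : width_at_infinity G 1)
  (hr : (0 < r)%R)
  (hf : cusp_form G r f)
  (hf0 : exists z : C, upper_half_plane z /\ f z <> RtoC 0)
  (ha : forall z : C, upper_half_plane z ->
     @is_series C_AbsRing C_NormedModule
       (fun n => Cmult (a (S n)) (e (Cmult (RtoC (INR (S n))) z))) (f z))
  (halpha : (r / 2 < alpha)%R) :
  ~ multifractal (f_exp a alpha) /\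
  ((forall n : nat, (1 <= n)%nat -> Im (a n) = 0%R) ->
     ~ multifractal (f_cos a alpha) /\ ~ multifractal (f_sin a alpha)).
Proof.
  set (A := fun i => a (S i)).
  assert (HA : fourier_expansion A f) by (intros z Hz; apply is_series_Clim; now apply ha).
  destruct (cusp_form_bound G r f hG hf) as [M [HM Hbound]].
  destruct (cusp_form_large G r f hG hf hf0) as (T & c & HT & Hc & Hlarge).
  assert (Hps : forall rho, r / 2 < rho -> partial_sums_bounded A rho)
    by (intros rho Hrho; exact (cusp_form_partial_sums A f M r rho HA HM Hbound Hrho)).
  set (F := frac_series A alpha).
  assert (HF : uniform_fourier (weighted A alpha) F).
  { apply (frac_series_uniform A ((r / 2 + alpha) / 2)); [lra|apply Hps; lra]. }
  assert (HFc := uniform_fourier_cont _ _ HF).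
  assert (Hreg : forall x s, 0 <= s < alpha - r / 2 -> holder_expansion F x s).
  { intros x s Hs. destruct (INR_unbounded s) as [n Hn].
    apply (frac_series_regular A (r / 2) x ltac:(lra) Hps n); lra. }
  assert (Hirr : forall g kappa, Ccont g -> kappa <> RtoC 0 ->
    (forall x s, 0 <= s < alpha - r / 2 -> holder_expansion g x s) ->
    (forall x i, Cint (fun u => g (x + u)%R * e (RtoC (- INR (S i) * u)))%C =
       (kappa * (weighted A alpha i * e (RtoC (INR (S i) * x))))%C) ->
    forall x, irrational x -> holder_exponent g x = Finite (alpha - r / 2)).
  { intros g kappa Hg Hk Hgr Hco x Hx. apply holder_exponent_eq; [lra| |].
    - intros s Hs. apply holder_expansion_Cs; auto.
    - intros s. apply (Cs_upper_bound A f alpha r T c g x kappa s); auto. }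
  assert (Hparts : forall mu x, mu <> RtoC 0 -> irrational x ->
    holder_exponent (real_part mu F) x = Finite (alpha - r / 2)).
  { intros mu x Hmu Hx. apply (Hirr _ (RtoC (1/2) * mu)%C); auto.
    - now apply Ccont_RtoC_Re, Ccont_scal.
    - apply Cmult_neq_0; [intros E; apply RtoC_inj in E; lra|auto].
    - intros x' s Hs. now apply holder_expansion_real_part, Hreg.
    - intros x' i. exact (real_part_coef mu _ _ i (uniform_fourier_shift _ _ x' HF)). }
  assert (Hfe : forall x, F x = f_exp a alpha x) by (intros x; symmetry; apply f_exp_frac_series).
  split; [|intros Hreal; split].
  - apply (not_multifractal _ (alpha - r / 2)). intros x Hx.
    rewrite <- (holder_exponent_ext F) by auto. apply (Hirr F (RtoC 1)); auto.
    + apply C1_nz.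
    + intros x' i. rewrite (uniform_fourier_coef _ _ i (uniform_fourier_shift _ _ x' HF)). ring.
  - apply (not_multifractal _ (alpha - r / 2)). intros x Hx.
    rewrite <- (holder_exponent_ext (real_part (RtoC 1) F)).
    2: { intros t. unfold real_part. rewrite f_cos_Re, <- Hfe, Cmult_1_l by auto. reflexivity. }
    apply Hparts; auto. apply C1_nz.
  - apply (not_multifractal _ (alpha - r / 2)). intros x Hx.
    rewrite <- (holder_exponent_ext (real_part (- Ci) F)).
    2: { intros t. rewrite f_sin_Im, <- Hfe by auto. unfold real_part. f_equal. simpl. ring. }
    apply Hparts; auto. apply Cmod_gt_0. rewrite Cmod_opp, Cmod_Ci. lra.
Qed.
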